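(* Let $a\in\mathcal B(\mathcal H)$ be normal. If $\mathcal O_a$ is closed in $\mathcal B(\mathcal H)$ in the operator norm and $\tau_q=\tau_{\mathcal M}$ on $\mathcal O_a$, then $\operatorname{spec}(a)$ is a finite set, and therefore $\mathcal O_a\subseteq\mathcal B(\mathcal H)$ is a closed embedded split submanifold.
   Context: $\mathcal H$ is a separable infinite-dimensional complex Hilbert space and $\mathcal M=\mathcal B(\mathcal H)$. $p_a$ is the orthogonal projection onto $\overline{\operatorname{Ran}a}$, $\mathcal V_a=\{v\in\mathcal B(\mathcal H)\mid v^*v=p_a\}$ with the norm topology, and $\mathcal O_a=\{vav^*\mid v\in\mathcal V_a\}$ is the groupoid orbit. $\tau_q$ is the quotient topology on $\mathcal O_a$ for the map $\alpha_a\colon\mathcal V_a\to\mathcal O_a$, $v\mapsto vav^*$ (equivalently, neighborhoods of $vav^*$ are generated by the sets $\{zaz^*\mid z\in\mathcal V_a,\ \|z-v\|<\varepsilon\}$, $\varepsilon>0$); $\tau_{\mathcal M}$ is the operator norm topology on $\mathcal O_a$. An embedded split submanifold of a Banach space $X$ is the image of a smooth injective map $f\colon M\to X$ from a Banach manifold that is a homeomorphism onto its image and whose tangent maps are injective with closed, complemented (real) range. *)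

(* Defs.v *)
From HB Require Import structures.
From mathcomp Require Import all_boot all_order all_algebra.
From mathcomp Require Import sesquilinear complex lra.
From mathcomp Require Import all_classical all_reals all_analysis.

Set Implicit Arguments.
Unset Strict Implicit.
Unset Printing Implicit Defensive.

Import Order.TTheory GRing.Theory Num.Theory.
Import numFieldNormedType.Exports.

Local Open Scope classical_set_scope.
Local Open Scope complex_scope.
Local Open Scope ring_scope.

(* The inner product is linear in the first argument and conjugate-linear in
   the second. *)
Record hilbertSpace (R : realType) := HilbertSpace {
  hilbert_carrier :> completeNormedModType R[i];
  inner : {dot hilbert_carrier for Num.conj};
  normr_inner : forall x, `|x| ^+ 2 = inner x x }.

Definition separable_space (T : topologicalType) :=
  exists2 D : set T, countable D & dense D.

Definition infinite_dimensional (K : fieldType) (V : lmodType K) :=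
  ~ exists (n : nat) (e : 'I_n -> V),
      forall x, exists c : 'I_n -> K, x = \sum_i c i *: e i.

Section BoundedOperators.
Context (R : realType) (H : hilbertSpace R).
Implicit Types x y : H.

(* The norm of [H] takes values in [R[i]]; this is the same number in [R]. *)
Definition hnorm x : R := complex.Re `|x|.

Record boundedOp := BoundedOp {
  op_fun :> H -> H;
  op_linear : linear op_fun;
  op_bounded : exists k : R, forall x, hnorm (op_fun x) <= k * hnorm x }.

Implicit Types a b c : boundedOp.

HB.instance Definition _ a :=
  GRing.isLinear.Build R[i] H H _ (op_fun a) (op_linear a).

Lemma boundedOpP a b : (a : H -> H) =1 b -> a = b.
Proof.
case: a b => [f fl fb] [g gl gb] /= fg.
have {}fg : f = g by apply/funext => x; exact: fg.
by subst g; rewrite (Prop_irrelevance fl gl) (Prop_irrelevance fb gb).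
Qed.

Lemma hnormE x : `|x| = (hnorm x)%:C.
Proof.
by have := ger0_Im (normr_ge0 x); rewrite /hnorm; case: `|x| => u v /= ->.
Qed.

Lemma hnorm_ge0 x : 0 <= hnorm x.
Proof. by rewrite -lecR -hnormE; exact: normr_ge0. Qed.

Lemma hnormD x y : hnorm (x + y) <= hnorm x + hnorm y.
Proof. by rewrite -lecR rmorphD /= -!hnormE ler_normD. Qed.

Lemma hnormZ z x : hnorm (z *: x) = complex.Re `|z| * hnorm x.
Proof.
have zE : `|z| = (complex.Re `|z|)%:C.
  by have := ger0_Im (normr_ge0 z); case: `|z| => u v /= ->.
apply: (@complexI R); rewrite rmorphM /= -!hnormE normrZ.
by rewrite {1}zE.
Qed.

Lemma hnormZr (r : R) x : hnorm (r%:C *: x) = `|r| * hnorm x.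
Proof. by rewrite hnormZ normc_def /= expr0n addr0 sqrtr_sqr. Qed.

Lemma hnormN x : hnorm (- x) = hnorm x.
Proof. by rewrite /hnorm normrN. Qed.

Lemma hnorm0 : hnorm 0 = 0.
Proof. by rewrite /hnorm normr0. Qed.

Lemma hnorm0_eq0 x : hnorm x = 0 -> x = 0.
Proof. by move=> x0; apply/normr0_eq0; rewrite hnormE x0. Qed.

Fact zero_op_subproof : linear (fun _ : H => 0 : H).
Proof. by move=> z x y; rewrite scaler0 addr0. Qed.
Fact zero_op_bounded : exists k : R, forall x, hnorm (0 : H) <= k * hnorm x.
Proof. by exists 0 => x; rewrite hnorm0 mul0r. Qed.
Definition zero_op := BoundedOp zero_op_subproof zero_op_bounded.

Fact opp_op_subproof a : linear (fun x => - a x).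
Proof. by move=> z x y; rewrite linearP opprD scalerN. Qed.
Fact opp_op_bounded a : exists k : R, forall x, hnorm (- a x) <= k * hnorm x.
Proof. by have [k ak] := op_bounded a; exists k => x; rewrite hnormN. Qed.
Definition opp_op a := BoundedOp (opp_op_subproof a) (opp_op_bounded a).

Fact add_op_subproof a b : linear (fun x => a x + b x).
Proof. by move=> z x y; rewrite !linearP scalerDr addrACA. Qed.
Fact add_op_bounded a b :
  exists k : R, forall x, hnorm (a x + b x) <= k * hnorm x.
Proof.
have [k ak] := op_bounded a; have [l bl] := op_bounded b.
by exists (k + l) => x; rewrite mulrDl (le_trans (hnormD _ _))// lerD.
Qed.
Definition add_op a b := BoundedOp (add_op_subproof a b) (add_op_bounded a b).

Fact mul_op_subproof a b : linear (fun x => a (b x)).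
Proof. by move=> z x y; rewrite !linearP. Qed.
Fact mul_op_bounded a b :
  exists k : R, forall x, hnorm (a (b x)) <= k * hnorm x.
Proof.
have [k ak] := op_bounded a; have [l bl] := op_bounded b.
exists (`|k| * l) => x; rewrite (le_trans (ak _))// -mulrA.
by rewrite (le_trans (ler_wpM2r (hnorm_ge0 _) (ler_norm k)))// ler_wpM2l.
Qed.
Definition mul_op a b := BoundedOp (mul_op_subproof a b) (mul_op_bounded a b).

Fact scalar_op_subproof (z : R[i]) : linear (fun x : H => z *: x).
Proof. by move=> w x y; rewrite scalerDr !scalerA mulrC. Qed.
Fact scalar_op_bounded (z : R[i]) :
  exists k : R, forall x, hnorm (z *: x) <= k * hnorm x.
Proof. by exists (complex.Re `|z|) => x; rewrite hnormZ. Qed.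
Definition scalar_op z := BoundedOp (scalar_op_subproof z) (scalar_op_bounded z).

HB.instance Definition _ := gen_eqMixin boundedOp.
HB.instance Definition _ := gen_choiceMixin boundedOp.

Fact add_opA : associative add_op.
Proof. by move=> a b c; apply/boundedOpP => x; exact: addrA. Qed.
Fact add_opC : commutative add_op.
Proof. by move=> a b; apply/boundedOpP => x; exact: addrC. Qed.
Fact add_0op : left_id zero_op add_op.
Proof. by move=> a; apply/boundedOpP => x; exact: add0r. Qed.
Fact add_Nop : left_inverse zero_op opp_op add_op.
Proof. by move=> a; apply/boundedOpP => x; exact: addNr. Qed.
HB.instance Definition _ :=
  GRing.isZmodule.Build boundedOp add_opA add_opC add_0op add_Nop.

Fact mul_opA : associative mul_op.
Proof. by move=> a b c; apply/boundedOpP. Qed.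
Fact mul_1op : left_id (scalar_op 1) mul_op.
Proof. by move=> a; apply/boundedOpP => x; exact: scale1r. Qed.
Fact mul_op1 : right_id (scalar_op 1) mul_op.
Proof. by move=> a; apply/boundedOpP => x /=; rewrite scale1r. Qed.
Fact mul_opDl : left_distributive mul_op add_op.
Proof. by move=> a b c; apply/boundedOpP. Qed.
Fact mul_opDr : right_distributive mul_op add_op.
Proof. by move=> a b c; apply/boundedOpP => x; exact: linearD. Qed.
HB.instance Definition _ := GRing.Zmodule_isPzRing.Build boundedOp
  mul_opA mul_1op mul_op1 mul_opDl mul_opDr.

(* Submanifolds of the space of bounded operators are real, so that it is made a
   real Banach space; complex scalars act through [scalar_op]. *)
Definition real_scale_op (r : R) a := scalar_op r%:C * a.

Fact real_scale_opA r s a :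
  real_scale_op r (real_scale_op s a) = real_scale_op (r * s) a.
Proof. by apply/boundedOpP => x /=; rewrite scalerA rmorphM. Qed.
Fact real_scale_1op : left_id 1 real_scale_op.
Proof. by move=> a; apply/boundedOpP => x; exact: scale1r. Qed.
Fact real_scale_opDr : right_distributive real_scale_op +%R.
Proof. by move=> r a b; apply/boundedOpP => x; exact: scalerDr. Qed.
Fact real_scale_opDl a : {morph real_scale_op^~ a : r s / r + s}.
Proof. by move=> r s; apply/boundedOpP => x /=; rewrite rmorphD scalerDl. Qed.
HB.instance Definition _ := GRing.Zmodule_isLmodule.Build R boundedOp
  real_scale_opA real_scale_1op real_scale_opDr real_scale_opDl.

Definition opnorm a : R := sup [set hnorm (a x) | x in [set x | hnorm x <= 1]].

Lemma has_sup_opnorm a :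
  has_sup [set hnorm (a x) | x in [set x | hnorm x <= 1]].
Proof.
split; first by exists (hnorm (a 0)), 0 => //=; rewrite hnorm0.
have [k ak] := op_bounded a; exists `|k| => _ [x /= x1 <-].
rewrite (le_trans (ak x))// (le_trans (ler_wpM2r (hnorm_ge0 _) (ler_norm k)))//.
by rewrite ler_piMr.
Qed.

Lemma opnorm_ge0 a : 0 <= opnorm a.
Proof.
rewrite (le_trans (hnorm_ge0 (a 0)))//; apply: (sup_upper_bound (has_sup_opnorm a)).
by exists 0 => //=; rewrite hnorm0.
Qed.

Lemma opnormP a x : hnorm (a x) <= opnorm a * hnorm x.
Proof.
have [->|x0] := eqVneq x 0; first by rewrite linear0 hnorm0 mulr0.
have n0 : 0 < hnorm x.
  by rewrite lt_neqAle hnorm_ge0 andbT eq_sym; apply: contra_neq x0 => /hnorm0_eq0.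
rewrite -ler_pdivrMr//; apply: (sup_upper_bound (has_sup_opnorm a)).
exists ((hnorm x)^-1%:C *: x).
  by rewrite /= hnormZr ger0_norm ?invr_ge0 ?hnorm_ge0// mulVf ?gt_eqF.
by rewrite linearZ/= hnormZr ger0_norm ?invr_ge0 ?hnorm_ge0// mulrC.
Qed.

Lemma opnorm_le a k : 0 <= k -> (forall x, hnorm (a x) <= k * hnorm x) ->
  opnorm a <= k.
Proof.
move=> k0 ak; apply: ge_sup; first exact: (has_sup_opnorm a).1.
by move=> _ [x /= x1 <-]; rewrite (le_trans (ak x))// ler_piMr.
Qed.

Fact opnormD a b : opnorm (a + b) <= opnorm a + opnorm b.
Proof.
apply: opnorm_le => [|x]; first by rewrite addr_ge0 ?opnorm_ge0.
by rewrite mulrDl (le_trans (hnormD _ _))// lerD ?opnormP.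
Qed.

Let opnormZ_le (r : R) a : opnorm (r *: a) <= `|r| * opnorm a.
Proof.
apply: opnorm_le => [|x]; first by rewrite mulr_ge0 ?opnorm_ge0.
by rewrite /= hnormZr -mulrA ler_wpM2l// opnormP.
Qed.

Fact opnormZ (r : R) a : opnorm (r *: a) = `|r| * opnorm a.
Proof.
apply/eqP; rewrite eq_le opnormZ_le/=.
have [->|r0] := eqVneq r 0; first by rewrite normr0 mul0r opnorm_ge0.
rewrite -ler_pdivlMl ?normr_gt0// -normfV.
by rewrite -{1}[a](scalerK r0) opnormZ_le.
Qed.

Fact opnorm0_eq0 a : opnorm a = 0 -> a = 0.
Proof.
move=> a0; apply/boundedOpP => x; apply: hnorm0_eq0; apply/eqP.
by rewrite eq_le hnorm_ge0 andbT (le_trans (opnormP a x))// a0 mul0r.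
Qed.

HB.instance Definition _ :=
  Lmodule_isNormed.Build R boundedOp opnormD opnormZ opnorm0_eq0.

Section op_complete.
Variables (F : set_system boundedOp) (FF : ProperFilter F) (Fc : cauchy F).

Let Fdist (e : R) : 0 < e -> \forall a \near F, \forall b \near F, `|a - b| <= e.
Proof.
move=> e0; apply: nearP_dep.
have := (@cauchy_ballP _ _ F FF).2 Fc e e0; apply: filterS => -[a b] /=.
by rewrite -ball_normE => /ltW.
Qed.

Let Fx x : cvg ((fun a : boundedOp => a x) @ F).
Proof.
apply: cauchy_cvg; apply/cauchy_ballP => e e0.
have eE : e = (complex.Re e)%:C by rewrite RRe_real// gtr0_real.
have r0 : 0 < complex.Re e / (hnorm x + 1).
  by rewrite divr_gt0 ?ltr_wpDl ?hnorm_ge0// -(ltcR 0) -eE.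
have : \forall a & b \near F, `|a - b| < complex.Re e / (hnorm x + 1).
  have := (@cauchy_ballP _ _ F FF).2 Fc _ r0; apply: filterS => -[a b] /=.
  by rewrite -ball_normE.
pose ev (a : boundedOp) := a x.
rewrite (near_map2 ev ev) //; apply: filterS => -[a b] /= ab.
rewrite -ball_normE /= hnormE eE ltcR.
rewrite ltr_pdivlMr in ab; last by rewrite ltr_wpDl ?hnorm_ge0.
apply: le_lt_trans ab; apply: (le_trans (opnormP (a - b) x)).
apply: ler_wpM2l; first exact: opnorm_ge0.
by rewrite lerDl.
Qed.

Let L x : H := lim ((fun a : boundedOp => a x) @ F).

Let FL x : (fun a : boundedOp => a x) @ F --> L x.
Proof. exact: Fx. Qed.

Fact lim_op_subproof : linear L.
Proof.
move=> z x y; apply: (@cvg_lim H) => //.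
under eq_fun do rewrite linearP.
by apply: cvgD; [apply: cvgZl_tmp; exact: FL|exact: FL].
Qed.

Let LF (e : R) : 0 < e ->
  \forall a \near F, forall x : H, hnorm (op_fun a x - L x) <= e * hnorm x.
Proof.
move=> e0; apply: filterS (Fdist e0) => a ab x; apply/ler_addgt0Pr => d d0.
have dC : 0 < d%:C by rewrite ltcR.
have /cvgrPdist_le/(_ _ dC) Lx := @FL x.
have [b [/= bL {}ab]] := filter_ex (filterI Lx ab).
rewrite -[a x](subrK (b x)) -addrA (le_trans (hnormD _ _))// lerD//.
  by rewrite (le_trans (opnormP (a - b) x))// ler_wpM2r ?hnorm_ge0.
by rewrite -lecR -hnormE distrC.
Qed.

Fact lim_op_bounded : exists k : R, forall x, hnorm (L x) <= k * hnorm x.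
Proof.
have [a aL] := filter_ex (LF ltr01).
exists (opnorm a + 1) => x; rewrite -[L x](subKr (a x)).
by rewrite mulrDl (le_trans (hnormD _ _))// hnormN lerD ?opnormP.
Qed.

Fact op_complete_subproof : cvg F.
Proof.
apply/cvg_ex; exists (BoundedOp lim_op_subproof lim_op_bounded).
apply/cvgrPdist_le => e e0; apply: filterS (LF e0) => a aL.
rewrite distrC; apply: opnorm_le; first exact: ltW.
exact: aL.
Qed.

End op_complete.

HB.instance Definition _ := Uniform_isComplete.Build boundedOp op_complete_subproof.

End BoundedOperators.



Definition is_subspace (K : pzRingType) (V : lmodType K) (S : set V) :=
  [/\ S 0, forall x y, S x -> S y -> S (x + y)
    & forall z x, S x -> S (z *: x)].

Section HilbertTheory.
Context (R : realType) (H : hilbertSpace R).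
Implicit Types x y s t : H.

Lemma inner_hnorm x : inner H x x = (hnorm x ^+ 2)%:C.
Proof. by rewrite -normr_inner hnormE rmorphXn. Qed.

Lemma inner_conj x y : inner H x y = (inner H y x)^*.
Proof. by rewrite hermC expr0 mul1r. Qed.

Lemma inner_proj q s : s != 0 ->
  let t := inner H q s / inner H s s in
  inner H (q - t *: s) (q - t *: s) =
  inner H q q - `|inner H q s| ^+ 2 / inner H s s.
Proof.
move=> s0 /=; set c := inner H q s; set N := inner H s s.
have N0 : 0 < N by rewrite dnorm_gt0.
have NC : N^* = N by apply/CrealP; exact: gtr0_real.
have -> : inner H q q - `|c| ^+ 2 / N =
  inner H q q + `|c| ^+ 2 / N - (`|c| ^+ 2 / N + `|c| ^+ 2 / N).
  by rewrite opprD addrA addrK.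
have cN : inner H q ((c / N) *: s) = `|c| ^+ 2 / N.
  by rewrite linearZr_LR /= -/c rmorphM fmorphV /= NC normCK mulrAC [_ * c]mulrC.
rewrite dnormB /= cN dnormZ; congr (_ + _ - (_ + _)).
  rewrite -/N normf_div exprMn exprVn (gtr0_norm N0) expr2 invfM.
  by rewrite mulrA mulfVK ?gt_eqF.
by apply/CrealP/ger0_real; rewrite divr_ge0 ?exprn_ge0// ltW.
Qed.

Lemma cauchy_schwarz x y : `|inner H x y| <= (hnorm x * hnorm y)%:C.
Proof.
have [->|y0] := eqVneq y 0; first by rewrite linear0r normr0 hnorm0 mulr0.
rewrite -(@ler_pXn2r _ 2) ?nnegrE//; last by rewrite ler0c mulr_ge0 ?hnorm_ge0.
have := dnorm_ge0 (inner H) (x - (inner H x y / inner H y y) *: y).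
rewrite inner_proj// subr_ge0 ler_pdivrMr ?dnorm_gt0// => /le_trans; apply.
by rewrite !inner_hnorm -rmorphM -rmorphXn /= exprMn.
Qed.

Lemma parallelogram x y :
  hnorm (x + y) ^+ 2 + hnorm (x - y) ^+ 2 =
  (hnorm x ^+ 2 + hnorm y ^+ 2) *+ 2.
Proof.
apply: (@complexI R); rewrite rmorphMn !rmorphD /= -!inner_hnorm.
by rewrite dnormB dnormD /= mulr2n addrACA subrr addr0.
Qed.

Lemma inner_inj x y : (forall z, inner H z x = inner H z y) -> x = y.
Proof.
move=> xy; apply/eqP; rewrite -subr_eq0 -(dnorm_eq0 (inner H)).
by rewrite linearBr /= xy subrr.
Qed.

Section best_approximation.
Variables (S : set H) (Sc : closed S) (Ss : is_subspace S) (x : H).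

Let E := [set hnorm (x - s) ^+ 2 | s in S].
Let d := inf E.

Let Einf : has_inf E.
Proof.
have [S0 _ _] := Ss.
by split; [exists (hnorm (x - 0) ^+ 2), 0|exists 0 => _ [s _ <-]; exact: sqr_ge0].
Qed.

Let dE s : S s -> d <= hnorm (x - s) ^+ 2.
Proof. by move=> s0; apply: ge_inf; [exact: Einf.2|exists s]. Qed.

Let A (e : R) := [set s | S s /\ hnorm (x - s) ^+ 2 <= d + e].

Let A0 e : 0 < e -> A e !=set0.
Proof.
by move=> /inf_adherent/(_ Einf)[_ [s Ss' <-] /ltW sd]; exists s.
Qed.

Let Adist e s t : A e s -> A e t -> hnorm (s - t) ^+ 2 <= 4 * e.
Proof.
have [_ SD SZ] := Ss.
move=> [As se] [At te].
have := parallelogram (x - s) (x - t).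
have -> : (x - s) - (x - t) = t - s by rewrite opprB addrC addrA subrK.
have -> : (x - s) + (x - t) = (2 : R)%:C *: (x - (2^-1 : R)%:C *: (s + t)).
  rewrite scalerBr scalerA -rmorphM /= divff// scale1r rmorphMn /= scaler_nat.
  by rewrite opprD addrACA mulr2n.
rewrite hnormZr ger0_norm// -(hnormN (t - s)) opprB exprMn => st.
have := dE (SZ (2^-1 : R)%:C _ (SD _ _ As At)).
move: st se te; lra.
Qed.

Let F : set_system H := filter_from [set e : R | 0 < e] A.

Let Ale e e' : e <= e' -> A e `<=` A e'.
Proof. by move=> ee s [? se]; split=> //; rewrite (le_trans se)// lerD2l. Qed.

Let FF : ProperFilter F.
Proof.
apply: filter_from_proper; last exact: A0.
apply: filter_from_filter; first by exists 1 => /=.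
move=> e e' /= e0 e'0; exists (Num.min e e') => /=; first by rewrite lt_min e0.
by move=> s As; split; apply: Ale As; rewrite ge_min lexx ?orbT.
Qed.

Let Fcvg : cvg F.
Proof.
suff Fex : cauchy_ex F.
  exact: (@cauchy_cvg H F FF (@cauchy_exP R[i] H F FF Fex)).
move=> e e0.
have eE : e = (complex.Re e)%:C by rewrite RRe_real// gtr0_real.
have r0 : 0 < complex.Re e by rewrite -(ltcR 0) -eE.
have r0' : 0 < complex.Re e ^+ 2 / 8 by rewrite divr_gt0// exprn_gt0.
have [s As] := A0 r0'; exists s; exists (complex.Re e ^+ 2 / 8) => //= t At.
rewrite -ball_normE /= hnormE eE ltcR.
rewrite -(@ltr_pXn2r _ 2) ?nnegrE ?hnorm_ge0 ?(ltW r0)//.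
rewrite (le_lt_trans (Adist As At))//.
have := exprn_gt0 2 r0; lra.
Qed.

Lemma best_approximation : exists2 p, S p &
  forall s, S s -> hnorm (x - p) <= hnorm (x - s).
Proof.
have Sp : S (lim F).
  apply: (@closed_cvg _ _ F _ id) Fcvg => //.
  by exists 1 => //= s [].
exists (lim F) => // s Ss'.
apply/ler_addgt0Pr => e e0.
have eC : 0 < (e / 2)%:C by rewrite ltcR divr_gt0.
have e20 : 0 < (e / 2) ^+ 2 by rewrite exprn_gt0// divr_gt0.
have FA : F (A ((e / 2) ^+ 2)) by exists ((e / 2) ^+ 2).
have /cvgrPdist_le/(_ _ eC) FL : id @ F --> lim F by exact: Fcvg.
have LA := @filterI _ F FF _ _ (FL FF) FA.
have [u Lu] := @filter_ex _ F FF _ LA.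
case: Lu => /= Lu [Su ud].
rewrite -(subrKA u) addrC (le_trans (hnormD _ _))//.
have : hnorm (x - u) <= hnorm (x - s) + e / 2.
  rewrite -(@ler_pXn2r _ 2) ?nnegrE ?addr_ge0 ?hnorm_ge0//; last first.
    by rewrite ltW// divr_gt0.
  rewrite (le_trans ud)// sqrrD lerD2r.
  rewrite (le_trans (dE Ss'))// lerDl mulrn_wge0// mulr_ge0 ?hnorm_ge0//.
  by rewrite ltW// divr_gt0.
have : hnorm (u - lim F) <= e / 2 by rewrite -lecR -hnormE distrC.
lra.
Qed.

Lemma orth_decomposition : exists2 p, S p &
  forall s, S s -> inner H (x - p) s = 0.
Proof.
have [_ SD SZ] := Ss.
have [p Sp pmin] := best_approximation; exists p => // s Ss'.
have [->|s0] := eqVneq s 0; first by rewrite linear0r.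
set c := inner H (x - p) s.
have := pmin _ (SD _ _ Sp (SZ (c / inner H s s) _ Ss')).
rewrite opprD addrA -(@ler_pXn2r _ 2) ?nnegrE ?hnorm_ge0// -lecR.
rewrite -!inner_hnorm inner_proj// lerBrDr gerDl -/c.
rewrite pmulr_lle0 ?invr_gt0 ?dnorm_gt0// => c0.
apply/eqP; rewrite -normr_eq0 -sqrf_eq0 eq_le c0 /=.
exact: exprn_ge0.
Qed.

End best_approximation.
End HilbertTheory.

Section OrthProjection.
Context (R : realType) (H : hilbertSpace R).
Implicit Types (x y : H) (a b : boundedOp H).

Definition is_orth_proj (S : set H) (p : boundedOp H) :=
  forall x, S (p x) /\ forall s, S s -> inner H (x - p x) s = 0.

Lemma orth_decomposition_uniq (S : set H) x p q : is_subspace S ->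
  S p -> S q -> (forall s, S s -> inner H (x - p) s = 0) ->
  (forall s, S s -> inner H (x - q) s = 0) -> p = q.
Proof.
move=> [_ SD SZ] Sp Sq xp xq; apply/eqP; rewrite -subr_eq0.
rewrite -(dnorm_eq0 (inner H)).
have Spq : S (p - q) by apply: SD => //; rewrite -scaleN1r; exact: SZ.
have {1}-> : p - q = (x - q) - (x - p).
  by rewrite opprB [RHS]addrC addrA subrK.
by rewrite linearBl /= xp// xq// subrr.
Qed.

Lemma is_orth_proj_uniq (S : set H) a b : is_subspace S ->
  is_orth_proj S a -> is_orth_proj S b -> a = b.
Proof.
move=> Ss aS bS; apply/boundedOpP => x.
have [[? ?] [? ?]] := (aS x, bS x).
exact: (@orth_decomposition_uniq S x).
Qed.

Section existence.
Variables (S : set H) (Sc : closed S) (Ss : is_subspace S).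

Let f x := s2val (cid2 (orth_decomposition Sc Ss x)).
Let fS x : S (f x). Proof. exact: s2valP (cid2 (orth_decomposition Sc Ss x)). Qed.
Let fo x s : S s -> inner H (x - f x) s = 0.
Proof. exact: s2valP' (cid2 (orth_decomposition Sc Ss x)) s. Qed.

Fact orth_proj_op_subproof : linear f.
Proof.
have [_ SD SZ] := Ss => z x y.
apply: (@orth_decomposition_uniq S (z *: x + y)) => // [|s sS|s sS].
- by apply: SD => //; exact: SZ.
- exact: fo.
- by rewrite opprD addrACA -scalerBr linearDl linearZl_LR /= !fo// mulr0 addr0.
Qed.

Fact orth_proj_op_bounded : exists k : R, forall x, hnorm (f x) <= k * hnorm x.
Proof.
exists 1 => x; rewrite mul1r.
have [fx0|fx0] := eqVneq (f x) 0; first by rewrite fx0 hnorm0 hnorm_ge0.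
have n0 : 0 < hnorm (f x).
  rewrite lt_neqAle hnorm_ge0 andbT eq_sym.
  by apply: contra_neq fx0 => /hnorm0_eq0.
rewrite -(ler_pM2r n0) -expr2 -lecR -inner_hnorm.
have -> : inner H (f x) (f x) = inner H x (f x).
  by apply/eqP; rewrite eq_sym -subr_eq0 -linearBl /= fo.
rewrite (le_trans _ (cauchy_schwarz x (f x)))// real_ler_norm//.
have /eqP := fo x (fS x); rewrite linearBl subr_eq0 => /eqP /= ->.
exact/ger0_real/dnorm_ge0.
Qed.

Lemma ex_orth_proj : exists p, is_orth_proj S p.
Proof.
exists (BoundedOp orth_proj_op_subproof orth_proj_op_bounded) => x.
by split; [exact: fS|exact: fo].
Qed.

End existence.

(* The junk value [0] is taken when [S] is not a closed subspace *)
Definition orth_proj (S : set H) : boundedOp H := xget 0 (is_orth_proj S).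

Lemma orth_projP (S : set H) : closed S -> is_subspace S ->
  is_orth_proj S (orth_proj S).
Proof. by move=> Sc Ss; apply: xgetPex; exact: ex_orth_proj. Qed.

Lemma closure_subspace (S : set H) : is_subspace S -> is_subspace (closure S).
Proof.
have clP (A : set H) x : closure A x <->
    forall e : R, 0 < e -> exists2 y, A y & hnorm (x - y) < e.
  split=> [Ax e e0|Ax B].
    have eC : 0 < e%:C by rewrite ltcR.
    have [y [Ay]] := Ax _ (nbhsx_ballx x _ eC).
    by rewrite -ball_normE /= hnormE ltcR; exists y.
  move=> /nbhs_ballP[e /= e0 eB].
  have eE : e = (complex.Re e)%:C by rewrite RRe_real// gtr0_real.
  have r0 : 0 < complex.Re e by rewrite -(ltcR 0) -eE.
  have [y Ay xy] := Ax _ r0; exists y; split=> //; apply: eB.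
  by rewrite -ball_normE /= hnormE eE ltcR.
move=> [S0 SD SZ]; split.
- exact: subset_closure.
- move=> x y /clP Sx /clP Sy; apply/clP => e e0.
  have e20 : 0 < e / 2 by rewrite divr_gt0.
  have [[u Su xu] [v Sv yv]] := (Sx _ e20, Sy _ e20).
  exists (u + v); first exact: SD.
  by rewrite opprD addrACA (le_lt_trans (hnormD _ _))// [e]splitr ltrD.
- move=> z x /clP Sx; apply/clP => e e0.
  have k0 : 0 < complex.Re `|z| + 1.
    by rewrite ltr_wpDl// -lecR RRe_real ?normr_real// normr_ge0.
  have [u Su xu] := Sx _ (divr_gt0 e0 k0).
  exists (z *: u); first exact: SZ.
  rewrite -scalerBr hnormZ; rewrite ltr_pdivlMr// in xu.
  by apply: le_lt_trans xu; rewrite mulrC ler_wpM2l ?hnorm_ge0// lerDl.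
Qed.

Lemma range_subspace a : is_subspace (range a).
Proof.
split; first by exists 0 => //; rewrite linear0.
  by move=> _ _ [x _ <-] [y _ <-]; exists (x + y) => //; rewrite linearD.
by move=> z _ [x _ <-]; exists (z *: x) => //; rewrite linearZ.
Qed.

Definition range_proj a : boundedOp H := orth_proj (closure (range a)).

Lemma range_projP a : is_orth_proj (closure (range a)) (range_proj a).
Proof.
apply: orth_projP; first exact: closed_closure.
exact/closure_subspace/range_subspace.
Qed.

End OrthProjection.

Section Adjoint.
Context (R : realType) (H : hilbertSpace R).
Implicit Types (x y : H) (a b : boundedOp H).

Definition is_adjoint a b := forall x y, inner H (a x) y = inner H x (b y).

Lemma riesz (f : H -> R[i]) (k : R) : (forall z x y, f (z *: x + y) = z * f x + f y) ->
  (forall x, `|f x| <= (k * hnorm x)%:C) -> exists z, forall x, f x = inner H x z.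
Proof.
move=> fl fk.
have f0 : f 0 = 0.
  apply/eqP; rewrite -normr_eq0 eq_le normr_ge0 andbT.
  by rewrite (le_trans (fk 0))// hnorm0 mulr0.
have fD x y : f (x + y) = f x + f y by have := fl 1 x y; rewrite scale1r mul1r.
have fZ z x : f (z *: x) = z * f x by have := fl z x 0; rewrite f0 !addr0.
pose K := [set x | f x = 0].
have Ks : is_subspace K.
  split=> [//|x y Kx Ky|z x Kx]; first by rewrite /K /= fD Kx Ky addr0.
  by rewrite /K /= fZ Kx mulr0.
have Kc : closed K.
  move=> x clx; rewrite /K /=; apply/eqP; rewrite -normr_eq0 eq_le normr_ge0 andbT.
  have -> : `|f x| = (complex.Re `|f x|)%:C by rewrite RRe_real// normr_real.
  rewrite lecR; apply/ler_addgt0Pr => e e0; rewrite add0r.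
  have k0 : 0 < `|k| + 1 by rewrite ltr_wpDl.
  have eC : 0 < (e / (`|k| + 1))%:C by rewrite ltcR divr_gt0.
  have [y [Ky]] := clx _ (nbhsx_ballx x _ eC).
  rewrite -ball_normE /= hnormE ltcR ltr_pdivlMr// => xy.
  have -> : f x = f (x - y) by rewrite -{1}(subrK y x) (fD (x - y) y) (Ky : f y = 0) addr0.
  rewrite -lecR; apply: le_trans (fk _) _; rewrite lecR.
  rewrite (le_trans _ (ltW xy))// mulrC ler_wpM2l ?hnorm_ge0//.
  by rewrite (le_trans (ler_norm k))// lerDl.
have [fE|/existsNP[u /eqP fu]] := pselect (forall x, f x = 0).
  by exists 0 => x; rewrite linear0r fE.
have [p Kp po] := orth_decomposition Kc Ks u.
set w := u - p in po.
have fw : f w = f u by rewrite -{1}(subrK p u) (fD w p) (Kp : f p = 0) addr0.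
have w0 : w != 0 by apply: contra_neq fu => w0; rewrite -fw w0 f0.
have W0 : inner H w w != 0 by rewrite dnorm_eq0.
exists ((f w / inner H w w)^* *: w) => x.
rewrite linearZr_LR /= conjCK.
have Kx : K (x - (f x / f w) *: w).
  by rewrite /K /= addrC -scaleNr fl mulNr divfK ?fw// addNr.
have := po _ Kx; rewrite inner_conj => /eqP; rewrite conjC_eq0 linearBl subr_eq0.
rewrite linearZl_LR /= => /eqP ->.
by rewrite mulrACA mulVf// mulr1 mulrC divfK// fw.
Qed.

Lemma ex_adjoint a : exists b, is_adjoint a b.
Proof.
have ex y : exists z, forall x, inner H (a x) y = inner H x z.
  apply: (@riesz (fun x => inner H (a x) y) (opnorm a * hnorm y)) => [z u v|x].
    by rewrite linearP linearDl linearZl_LR.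
  rewrite (le_trans (cauchy_schwarz _ _))// lecR mulrAC ler_wpM2r ?hnorm_ge0//.
  exact: opnormP.
have [b bE] := choice ex.
have bl : linear b.
  move=> z x y; apply: inner_inj => u.
  by rewrite -bE linearDr linearZr_LR /= !bE linearDr linearZr_LR.
have bb : exists k : R, forall x, hnorm (b x) <= k * hnorm x.
  exists (opnorm a) => x.
  have [bx0|bx0] := eqVneq (b x) 0.
    by rewrite bx0 hnorm0 mulr_ge0 ?opnorm_ge0 ?hnorm_ge0.
  have n0 : 0 < hnorm (b x).
    rewrite lt_neqAle hnorm_ge0 andbT eq_sym.
    by apply: contra_neq bx0 => /hnorm0_eq0.
  rewrite -(ler_pM2r n0) -expr2 -lecR -inner_hnorm -bE.
  apply: le_trans (real_ler_norm _) _.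
    by rewrite bE; exact/ger0_real/dnorm_ge0.
  rewrite (le_trans (cauchy_schwarz _ _))// lecR mulrAC ler_wpM2r ?hnorm_ge0//.
  exact: opnormP.
by exists (BoundedOp bl bb) => x y; rewrite bE.
Qed.

(* The value exists by [ex_adjoint] and is unique by [is_adjoint_uniq]. *)
Definition adjoint a : boundedOp H := xget 0 (is_adjoint a).

Lemma adjointP a x y : inner H (a x) y = inner H x (adjoint a y).
Proof. by move: x y; apply: (@xgetPex _ 0 (is_adjoint a)); exact: ex_adjoint. Qed.

Lemma is_adjoint_uniq a b c : is_adjoint a b -> is_adjoint a c -> b = c.
Proof.
by move=> ab ac; apply/boundedOpP => y; apply: inner_inj => x; rewrite -ab -ac.
Qed.

End Adjoint.

Definition relative_opens (T : topologicalType) (A : set T) : set (set T) :=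
  [set A `&` W | W in open].

Section GroupoidOrbit.
Context (R : realType) (H : hilbertSpace R).
Implicit Types (a v : boundedOp H).

Definition normal_op a := adjoint a * a = a * adjoint a.

Definition spectrum a : set R[i] :=
  [set z | ~ exists b : boundedOp H,
               b * (a - scalar_op H z) = 1 /\ (a - scalar_op H z) * b = 1].

Definition isometries_on_range a : set (boundedOp H) :=
  [set v | adjoint v * v = range_proj a].

Definition orbit_map a v : boundedOp H := v * a * adjoint v.

Definition groupoid_orbit a : set (boundedOp H) :=
  orbit_map a @` isometries_on_range a.

Definition orbit_norm_topology a : set (set (boundedOp H)) :=
  relative_opens (groupoid_orbit a).

Definition orbit_quotient_topology a : set (set (boundedOp H)) :=
  [set U | U `<=` groupoid_orbit a /\
    relative_opens (isometries_on_range a)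
      (isometries_on_range a `&` orbit_map a @^-1` U)].

End GroupoidOrbit.

(* [f] is of class C^oo on the open set [U]: [D x [:: v1; ...; vn]] is the
   [n]-th Frechet derivative of [f] at [x], a bounded [n]-linear map, applied to
   [v1, ..., vn]. The last clause says that the map sending [x] to the [n]-th
   derivative is Frechet differentiable for the operator norm of [n]-linear
   maps, its derivative being the [n+1]-st derivative. *)
Definition smooth_on (R : realType) (E F : normedModType R) (U : set E)
    (f : E -> F) :=
  exists D : E -> seq E -> F, forall x, U x ->
    [/\ D x [::] = f x,
        forall s t, linear (fun v => D x (s ++ v :: t)),
        forall n, exists C : R, forall s, size s = n ->
          `|D x s| <= C * \prod_(v <- s) `|v|
      & forall n (e : R), 0 < e -> \forall h \near (0 : E),
          forall s, size s = n ->
          `|D (x + h) s - D x s - D x (h :: s)|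
            <= e * `|h| * \prod_(v <- s) `|v| ].

(* The model space may depend on the chart: the components of a manifold need
   not be modelled on isomorphic Banach spaces. *)
Record chart (R : realType) (M : topologicalType) := Chart {
  chart_model : completeNormedModType R;
  chart_dom : set M;
  chart_cod : set chart_model;
  chart_map : M -> chart_model;
  chart_inv : chart_model -> M;
  chart_dom_open : open chart_dom;
  chart_cod_open : open chart_cod;
  chart_map_cod : forall x, chart_dom x -> chart_cod (chart_map x);
  chart_inv_dom : forall y, chart_cod y -> chart_dom (chart_inv y);
  chart_mapK : forall x, chart_dom x -> chart_inv (chart_map x) = x;
  chart_invK : forall y, chart_cod y -> chart_map (chart_inv y) = y;
  chart_map_continuous : {within chart_dom, continuous chart_map};
  chart_inv_continuous : {within chart_cod, continuous chart_inv} }.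
Arguments chart_cod {R M} c.
Arguments chart_map {R M} c.
Arguments chart_inv {R M} c.

Record banachManifold (R : realType) := BanachManifold {
  manifold_space :> topologicalType;
  atlas : chart R manifold_space -> Prop;
  atlas_cover : forall x, exists2 c, atlas c & chart_dom c x;
  atlas_smooth : forall c d, atlas c -> atlas d ->
    smooth_on (chart_cod c `&` chart_inv c @^-1` chart_dom d)
      (chart_map d \o chart_inv c) }.

Section Submanifold.
Context (R : realType) (X : completeNormedModType R).

Definition smooth_map (M : banachManifold R) (f : M -> X) :=
  forall c, atlas c -> smooth_on (chart_cod c) (f \o chart_inv c).

(* The tangent map of [f] at [x], the tangent space at [x] being identified with
   the model space by means of the chart [c] *)
Definition tangent_map (M : banachManifold R) (f : M -> X) (c : chart R M)
    (x : M) : chart_model c -> X :=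
  'd (f \o chart_inv c) (chart_map c x).

Arguments tangent_map {M} f c x _.

Definition homeomorphism_onto_image (T : topologicalType) (f : T -> X) :=
  [/\ continuous f, injective f
    & forall U, open U -> relative_opens (range f) (f @` U)].

Definition complemented (Y : set X) :=
  exists Z : set X, [/\ closed Z, is_subspace Z, Y `&` Z = [set 0]
    & forall x, exists y z, [/\ Y y, Z z & x = y + z]].

Definition embedded_split_submanifold (S : set X) :=
  exists (M : banachManifold R) (f : M -> X),
    [/\ smooth_map f, homeomorphism_onto_image f,
        S = range f
      & forall (c : chart R M) (x : M), atlas c -> chart_dom c x ->
          [/\ injective (tangent_map f c x),
              closed (range (tangent_map f c x))
            & complemented (range (tangent_map f c x))] ].

End Submanifold.

(* Main.v *)
Require Import Defs.
From HB Require Import structures.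
From mathcomp Require Import all_boot all_order all_algebra.
From mathcomp Require Import sesquilinear complex lra ring.
From mathcomp Require Import all_classical all_reals all_analysis.
Set Implicit Arguments.
Unset Strict Implicit.
Unset Printing Implicit Defensive.
Import Order.TTheory GRing.Theory Num.Theory.
Import numFieldNormedType.Exports.
Local Open Scope classical_set_scope.
Local Open Scope complex_scope.
Local Open Scope ring_scope.

(** Why the theorem holds.

    Finiteness of the spectrum. Call isotropy group of [a] the set of partial
    isometries [t] with [t^* t = p_a] and [t a t^* = a]. The partial isometries
    at distance less than [1] from it form a saturated relatively open set, so
    that their orbit points form a neighbourhood of [a] in the quotient topology,
    hence in norm ([orbit_topology_lift]). Now let [l <> m] be two points of the
    spectrum, [l] being nonzero, and let [x], [y] be unit approximate
    eigenvectors for them. Elements of the isotropy group commute with [a], so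
    they map [x] to approximate eigenvectors for [l], which are almost orthogonal
    to [y]. The reflection that exchanges [x] and [y] is therefore far from the
    isotropy group, although it moves [a] by at most [6 |l - m|]
    ([close_spectrum]). Hence the nonzero points of the spectrum stay at a fixed
    distance from each other, and the spectrum, being bounded, is finite
    ([spectrum_finite]).

    Structure of the orbit. A polynomial that vanishes on the spectrum
    annihilates a normal operator ([poly_op_eq0]); this is proved with joint
    approximate eigenvectors in the place of a functional calculus. Lagrange
    interpolation then writes [a] as a sum of [e_i p_i], over the nonzero points
    [e_i] of the spectrum and orthogonal projections [p_i] with zero products
    ([finite_spectrum_decomposition]). The orbit consists of sums of [e_i q_i]
    with families [q] of the same kind, and it contains all those that are close
    to one of its points, because nearby families are unitarily equivalent
    ([conj_unitary]).

    Charts. A family [q] is the same thing as the flag of the projections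
    [Q_n = q_0 + ... + q_(n-1)]. If the flag is close to that of [p], it is
    spanned by the columns of a unique operator [N = 1 + x] with [x] strictly
    block lower triangular with respect to [p]. With [P_n] the flag of [p], the
    two directions of this correspondence are rational in [x], [Q_n] and their
    adjoints:
      [Q_n = N P_n (P_n N^* N P_n + 1 - P_n)^-1 P_n N^*],
      [N p_i = (1 - Q_(i+1) + P_(i+1))^-1 p_i]
    ([frame_ofK], [frame_family_of_flag]), and [q_i] is a polynomial in the sum
    of the [e_i q_i]. So the orbit is locally parametrized by [x], and both the
    parametrization and its inverse are rational expressions on open sets of
    bounded operators.

    Smoothness. Formal derivation shows that rational expressions are of class
    C^oo ([rexpr_smooth_on]). Because the inverse of the parametrization is
    defined on an open set of operators, the chain rule provides a left inverse
    of the differential of the parametrization, which is therefore injective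
    with closed complemented range ([tangent_split],
    [embedded_of_rational_charts]). *)

(** * Bounded operators as a Banach algebra with involution *)

Section OperatorAlgebra.
Context (R : realType) (H : hilbertSpace R).
Implicit Types (a b c u v : boundedOp H) (x y z : H).

Lemma is_adjointE a b : is_adjoint a b -> adjoint a = b.
Proof. by apply: is_adjoint_uniq => x y; exact: adjointP. Qed.

Lemma inner_adjoint a x y : inner H x (a y) = inner H (adjoint a x) y.
Proof. by rewrite inner_conj adjointP -inner_conj. Qed.

Lemma adjointK a : adjoint (adjoint a) = a.
Proof. by apply: is_adjointE => x y; rewrite inner_adjoint. Qed.

Lemma adjointD a b : adjoint (a + b) = adjoint a + adjoint b.
Proof.
apply: is_adjointE => x y.
by rewrite [(a + b) x]/(a x + b x) linearDl /= !adjointP -linearDr.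
Qed.

Lemma adjointM a b : adjoint (a * b) = adjoint b * adjoint a.
Proof. by apply: is_adjointE => x y; rewrite [(a * b) x]/(a (b x)) !adjointP. Qed.

Lemma adjoint_scalar (z : R[i]) : adjoint (scalar_op H z) = scalar_op H z^*.
Proof.
by apply: is_adjointE => x y /=; rewrite linearZl_LR linearZr_LR /= conjCK.
Qed.

Lemma adjoint1 : adjoint 1 = 1 :> boundedOp H.
Proof. by rewrite -[1]/(scalar_op H 1) adjoint_scalar rmorph1. Qed.

Lemma adjoint0 : adjoint 0 = 0 :> boundedOp H.
Proof. by apply: is_adjointE => x y; rewrite linear0l linear0r. Qed.

Lemma adjointN a : adjoint (- a) = - adjoint a.
Proof. by apply/eqP; rewrite -addr_eq0 -adjointD addNr adjoint0. Qed.

Lemma adjointB a b : adjoint (a - b) = adjoint a - adjoint b.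
Proof. by rewrite adjointD adjointN. Qed.

Lemma scalar_opC (z : R[i]) a : scalar_op H z * a = a * scalar_op H z.
Proof. by apply/boundedOpP => x /=; rewrite linearZ. Qed.

Lemma scalar_op_real (r : R) a : r *: a = scalar_op H r%:C * a.
Proof. by []. Qed.

Lemma adjointZ (r : R) a : adjoint (r *: a) = r *: adjoint a.
Proof.
rewrite !scalar_op_real adjointM adjoint_scalar scalar_opC.
by rewrite [X in scalar_op H X]conjc_real.
Qed.

Lemma scalar_opD (z w : R[i]) : scalar_op H (z + w) = scalar_op H z + scalar_op H w.
Proof. by apply/boundedOpP => x; exact: scalerDl. Qed.

Lemma scalar_opM (z w : R[i]) : scalar_op H (z * w) = scalar_op H z * scalar_op H w.
Proof. by apply/boundedOpP => x; rewrite /= scalerA. Qed.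

Lemma scalar_op0 : scalar_op H 0 = 0.
Proof. by apply/boundedOpP => x; exact: scale0r. Qed.

Lemma scale_opl (r : R) a b : r *: a * b = r *: (a * b).
Proof. by rewrite !scalar_op_real mulrA. Qed.

Lemma scale_opr (r : R) a b : a * (r *: b) = r *: (a * b).
Proof. by rewrite !scalar_op_real mulrA -scalar_opC -mulrA. Qed.

Lemma mul_opE a b x : (a * b) x = a (b x). Proof. by []. Qed.
Lemma sub_opE a b x : (a - b) x = a x - b x. Proof. by []. Qed.
Lemma one_opE x : (1 : boundedOp H) x = x. Proof. exact: scale1r. Qed.
Lemma real_opE (r : R) a x : (r *: a) x = r%:C *: a x. Proof. by []. Qed.

Lemma hnorm_sqr x : hnorm x ^+ 2 = complex.Re (inner H x x).
Proof. by rewrite inner_hnorm. Qed.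

Lemma opnormM a b : `|a * b| <= `|a| * `|b|.
Proof.
apply: opnorm_le => [|x]; first by rewrite mulr_ge0 ?normr_ge0.
by rewrite (le_trans (opnormP a (b x)))// -mulrA ler_wpM2l ?opnorm_ge0// opnormP.
Qed.

Lemma hnormB_sqr x y :
  hnorm (x - y) ^+ 2 = hnorm x ^+ 2 + hnorm y ^+ 2 - complex.Re (inner H x y) *+ 2.
Proof.
rewrite hnorm_sqr dnormB raddfB/= raddfD/= -!hnorm_sqr; congr (_ - _).
by case: (inner H x y) => u v /=; rewrite mulr2n.
Qed.

(** Duality: test [x] against itself. *)
Lemma hnorm_le_inner x (k : R) : 0 <= k ->
  (forall y, complex.Re (inner H x y) <= k * hnorm y) -> hnorm x <= k.
Proof.
move=> k0 xk; have [->|x0] := eqVneq x 0; first by rewrite hnorm0.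
have n0 : 0 < hnorm x.
  rewrite lt_neqAle hnorm_ge0 andbT eq_sym.
  by apply: contra_neq x0 => /hnorm0_eq0.
by rewrite -(ler_pM2r n0) -expr2 hnorm_sqr.
Qed.

Lemma Re_inner_le x y : complex.Re (inner H x y) <= hnorm x * hnorm y.
Proof.
have := cauchy_schwarz x y; case: (inner H x y) => u v /=.
rewrite normc_def /= lecR; apply: le_trans.
by rewrite (le_trans (ler_norm u))// -sqrtr_sqr ler_sqrt ?addr_ge0 ?sqr_ge0// lerDl sqr_ge0.
Qed.

Lemma opnorm_adjoint a : `|adjoint a| = `|a|.
Proof.
suff le b : `|adjoint b| <= `|b|.
  by apply/eqP; rewrite eq_le le/= -{1}[a]adjointK le.
apply: opnorm_le => [|x]; first exact: normr_ge0.
apply: hnorm_le_inner => [|y]; first by rewrite mulr_ge0 ?normr_ge0 ?hnorm_ge0.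
rewrite -inner_adjoint (le_trans (Re_inner_le _ _))//.
by rewrite mulrAC mulrC ler_wpM2r ?hnorm_ge0// opnormP.
Qed.

Lemma le0_eps (m K : R) : (forall d : R, 0 < d -> m <= K * d) -> m <= 0.
Proof.
move=> h; apply/ler_addgt0Pr => e e0; rewrite add0r.
have K0 : 0 < `|K| + 1 by rewrite ltr_wpDl.
rewrite (le_trans (h _ (divr_gt0 e0 K0)))// mulrA ler_pdivrMr// mulrC ler_wpM2l ?(ltW e0)//.
by rewrite (le_trans (ler_norm K))// lerDl.
Qed.

Lemma adjoint_sum (I : Type) (r : seq I) (P : pred I) (F : I -> boundedOp H) :
  adjoint (\sum_(i <- r | P i) F i) = \sum_(i <- r | P i) adjoint (F i).
Proof. by elim/big_rec2: _ => [|i u v _ <-]; rewrite ?adjoint0 ?adjointD. Qed.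

Lemma adjoint_exp a n : adjoint (a ^+ n) = adjoint a ^+ n.
Proof. by elim: n => [|n ih]; rewrite ?adjoint1// exprS adjointM ih exprSr. Qed.

Definition op_unit a := exists b, b * a = 1 /\ a * b = 1.

Definition op_inv a : boundedOp H := xget 0 [set b | b * a = 1 /\ a * b = 1].

Lemma op_invP a : op_unit a -> op_inv a * a = 1 /\ a * op_inv a = 1.
Proof. by move=> ua; apply: (@xgetPex _ 0 [set b | b * a = 1 /\ a * b = 1]). Qed.

Lemma op_mulVr a : op_unit a -> op_inv a * a = 1.
Proof. by case/op_invP. Qed.

Lemma op_mulrV a : op_unit a -> a * op_inv a = 1.
Proof. by case/op_invP. Qed.

Lemma op_mulKr a b : op_unit a -> op_inv a * (a * b) = b.
Proof. by move=> ua; rewrite mulrA op_mulVr// mul1r. Qed.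

Lemma op_mulrI a b c : op_unit a -> a * b = a * c -> b = c.
Proof. by move=> ua /(congr1 ( *%R (op_inv a))); rewrite !op_mulKr. Qed.

Lemma op_unit1 : op_unit 1.
Proof. by exists 1; rewrite mul1r. Qed.

Lemma op_inv1 : op_inv 1 = 1.
Proof. by have := op_mulVr op_unit1; rewrite mulr1. Qed.

Lemma op_unitM a b : op_unit a -> op_unit b -> op_unit (a * b).
Proof.
move=> ua ub; exists (op_inv b * op_inv a); split.
  by rewrite -mulrA op_mulKr// op_mulVr.
by rewrite mulrA -(mulrA a) op_mulrV// mulr1 op_mulrV.
Qed.

Lemma op_unit_inv a : op_unit a -> op_unit (op_inv a).
Proof. by move=> ua; exists a; rewrite op_mulVr// op_mulrV. Qed.

Lemma op_inv_comm a b : op_unit a -> a * b = b * a -> op_inv a * b = b * op_inv a.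
Proof.
move=> ua ab; apply: (op_mulrI ua).
by rewrite mulrA op_mulrV// mul1r mulrA ab -mulrA op_mulrV// mulr1.
Qed.

Lemma op_unit_adjoint a : op_unit a -> op_unit (adjoint a).
Proof.
move=> ua; exists (adjoint (op_inv a)).
by rewrite -!adjointM op_mulrV// op_mulVr// adjoint1.
Qed.

Lemma op_inv_uniq a b : op_unit a -> a * b = 1 -> b = op_inv a.
Proof. by move=> ua ab; apply: (op_mulrI ua); rewrite ab op_mulrV. Qed.

Lemma op_inv_adjoint a : op_unit a -> op_inv (adjoint a) = adjoint (op_inv a).
Proof.
move=> ua; apply/esym/op_inv_uniq; first exact: op_unit_adjoint.
by rewrite -adjointM op_mulVr// adjoint1.
Qed.

(** The Neumann series, in the form of Banach's fixed point theorem: [1 - a]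
    has the right inverse [b] as soon as [b = 1 + a b]. *)
Lemma neumann_right a : `|a| < 1 -> exists b, (1 - a) * b = 1.
Proof.
move=> a1.
pose f (b : boundedOp H) : boundedOp H := 1 + a * b.
have fS : set_fun setT setT f by [].
pose f' : {fun [set: boundedOp H] >-> [set: boundedOp H]} := HB.pack f (isFun.Build _ _ _ _ f fS).
have ctr : is_contraction f'.
  exists (NngNum (normr_ge0 a)); split=> // -[b c] _ /=.
  by rewrite /f opprD addrACA subrr add0r -mulrBr opnormM.
have [b _ bE] := banach_fixed_point ctr (@closedT _) (ex_intro _ 0 I).
by exists b; rewrite mulrBl mul1r {1}bE /= /f addrK.
Qed.

Lemma neumann a : `|a| < 1 -> op_unit (1 - a).
Proof.
move=> a1; have [b ab] := neumann_right a1.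
have : `|adjoint a| < 1 by rewrite opnorm_adjoint.
move=> /neumann_right[c /(congr1 (@adjoint _ _))].
rewrite adjointM adjointB !adjoint1 adjointK => ca.
exists b; split=> //.
(* The right inverse of [1 - a^*] is a left inverse of [1 - a] after taking
   adjoints, and a left inverse equals a right inverse. *)
by have <- : adjoint c = b by rewrite -[LHS]mulr1 -ab mulrA ca mul1r.
Qed.

End OperatorAlgebra.

(** * Joint approximate eigenvectors of normal operators *)

Section NormalOperators.
Context (R : realType) (H : hilbertSpace R).
Implicit Types (a b c t u v : boundedOp H) (x y z : H).

Lemma hnorm_sqr_le x y : (hnorm x ^+ 2 <= hnorm y ^+ 2) = (hnorm x <= hnorm y).
Proof. by rewrite ler_pXn2r ?nnegrE ?hnorm_ge0. Qed.

Lemma normal_hnorm a x : normal_op a -> hnorm (adjoint a x) = hnorm (a x).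
Proof.
move=> na; apply/eqP; rewrite -(@eqrXn2 _ 2) ?hnorm_ge0// !hnorm_sqr adjointP adjointK.
by rewrite adjointP -[a (_ x)]/((a * adjoint a) x) -na.
Qed.

Lemma op_unit_lr a b c : b * a = 1 -> a * c = 1 -> op_unit a.
Proof.
move=> ba ac; exists b; split=> //.
by rewrite -[RHS]ac -[b]mulr1 -ac (mulrA b) ba mul1r.
Qed.

Lemma normal_subscalar a (w : R[i]) : normal_op a -> normal_op (a - scalar_op H w).
Proof.
rewrite /normal_op adjointB adjoint_scalar => na.
rewrite !mulrBl !mulrBr na -(scalar_opC w (adjoint a)) (scalar_opC _ a).
rewrite (scalar_opC _ (scalar_op H w)) !opprB addrACA [RHS]addrACA.
by congr (_ + _); rewrite addrC.
Qed.

Lemma op_unitZ (r : R) a : r != 0 -> op_unit (r *: a) -> op_unit a.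
Proof.
move=> r0 [b [ba ab]]; exists (r *: b).
move: ba ab; rewrite !scalar_op_real => ba ab; split.
  by rewrite scalar_opC -mulrA.
by rewrite mulrA -scalar_opC.
Qed.

(** For [s = t^* t] and a small [k], [1 - k s] is a strict contraction, since
    [<s x, x> = |t x|^2] is bounded below; so [s] is invertible, and with it [t],
    which commutes with its adjoint. *)
Lemma normal_bounded_below_unit t (c : R) : normal_op t -> 0 < c ->
  (forall x, c * hnorm x <= hnorm (t x)) -> op_unit t.
Proof.
move=> nt c0 ct; pose s : boundedOp H := adjoint t * t; pose m : R := `|t| ^+ 2.
have m0 : 0 <= m by exact: sqr_ge0.
have sm x : hnorm (s x) <= m * hnorm x.
  rewrite (le_trans (opnormP _ _))// ler_wpM2r ?hnorm_ge0//.
  by rewrite (le_trans (opnormM _ _))// opnorm_adjoint.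
pose k := c ^+ 2 / (m ^+ 2 + 1).
have m1 : 0 < m ^+ 2 + 1 by rewrite ltr_wpDl ?sqr_ge0.
have k0 : 0 < k by rewrite divr_gt0 ?exprn_gt0.
have km : k * (m ^+ 2 + 1) = c ^+ 2 by rewrite /k divfK// gt_eqF.
pose q : R := 1 - k * c ^+ 2.
have le x : hnorm ((1 - k *: s) x) ^+ 2 <= q * hnorm x ^+ 2.
  have -> : (1 - k *: s) x = x - k%:C *: s x.
    by rewrite -[LHS]/((1 : boundedOp H) x - k%:C *: s x) [(1 : boundedOp H) x]scale1r.
  rewrite hnorm_sqr dnormB raddfB/= raddfD/= -!hnorm_sqr hnormZr gtr0_norm// exprMn.
  have -> : inner H x (k%:C *: s x) = k%:C * (hnorm (t x) ^+ 2)%:C.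
    rewrite linearZr_LR /= [k%:C^*]conjc_real -inner_hnorm.
    by rewrite -adjointP.
  rewrite -rmorphM [_^*]conjc_real -rmorphD /= -[adjoint t (t x)]/(s x).
  have ct2 : c ^+ 2 * hnorm x ^+ 2 <= hnorm (t x) ^+ 2.
    by rewrite -exprMn ler_pXn2r ?nnegrE ?mulr_ge0 ?hnorm_ge0 ?(ltW c0).
  have sm2 : hnorm (s x) ^+ 2 <= m ^+ 2 * hnorm x ^+ 2.
    by rewrite -exprMn ler_pXn2r ?nnegrE ?mulr_ge0 ?hnorm_ge0.
  move: sm2 ct2.
  have := sqr_ge0 (hnorm x).
  move: (hnorm x ^+ 2) (hnorm (t x) ^+ 2) (hnorm (s x) ^+ 2) => X Y Z X0 ZX XY.
  rewrite /q /=.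
  have h1 : k ^+ 2 * Z <= k * (c ^+ 2 * X).
    rewrite expr2 -mulrA ler_wpM2l ?(ltW k0)// -km -mulrA ler_wpM2l ?(ltW k0)//.
    by rewrite (le_trans ZX)// mulrDl mul1r lerDl.
  have h2 : k * (c ^+ 2 * X) <= k * Y by rewrite ler_wpM2l ?(ltW k0).
  rewrite mulrBl mul1r -mulrA; move: h1 h2; lra.
pose q' := Num.max q 0.
have q'1 : Num.sqrt q' < 1.
  rewrite -sqrtr1 ltr_sqrt// gt_max ltr01 andbT /q ltrBlDr ltrDl.
  by rewrite mulr_gt0 ?exprn_gt0.
have /neumann : `|1 - k *: s| < 1.
  apply: le_lt_trans q'1; apply: opnorm_le => [|x]; first exact: sqrtr_ge0.
  rewrite -(@ler_pXn2r _ 2) ?nnegrE ?mulr_ge0 ?hnorm_ge0 ?sqrtr_ge0//.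
  rewrite exprMn sqr_sqrtr ?le_max ?lexx ?orbT// (le_trans (le x))//.
  by rewrite ler_wpM2r ?sqr_ge0// le_max lexx.
rewrite subKr => /(op_unitZ (lt0r_neq0 k0))[b [bs sb]].
apply: (@op_unit_lr _ (b * adjoint t) (adjoint t * b)); first by rewrite -mulrA.
by rewrite mulrA -nt.
Qed.
End NormalOperators.

Section JointApproximateSpectrum.
Context (R : realType) (H : hilbertSpace R).
Implicit Types (a b c k s t u v : boundedOp H) (x y z : H) (ts : seq (boundedOp H)).

(** The joint approximate point spectrum: [0] is an approximate eigenvalue of all
    the operators of [ts] with the same approximate eigenvectors. *)
Definition approx_null ts := forall d : R, 0 < d ->
  exists x, hnorm x = 1 /\ {in ts, forall t, hnorm (t x) <= d}.

Lemma hnorm_gt0 x : (0 < hnorm x) = (x != 0).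
Proof.
rewrite lt_neqAle hnorm_ge0 andbT eq_sym; congr (~~ _).
by apply/eqP/eqP => [/hnorm0_eq0//|->]; rewrite hnorm0.
Qed.

Lemma normalize x : x != 0 ->
  exists y, hnorm y = 1 /\ forall t, hnorm (t y) = hnorm (t x) / hnorm x.
Proof.
move=> x0; have n0 : 0 < hnorm x by rewrite hnorm_gt0.
exists ((hnorm x)^-1%:C *: x).
rewrite hnormZr ger0_norm ?invr_ge0 ?hnorm_ge0// mulVf ?gt_eqF//; split=> // t.
by rewrite linearZ hnormZr ger0_norm ?invr_ge0 ?hnorm_ge0// mulrC.
Qed.

Lemma approx_nullW ts : (forall d : R, 0 < d ->
    exists2 x, x != 0 & {in ts, forall t, hnorm (t x) <= d * hnorm x}) ->
  approx_null ts.
Proof.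
move=> h d /h[x x0 tx]; have [y [y1 yx]] := normalize x0.
exists y; split=> // t /tx; rewrite yx ler_pdivrMr ?hnorm_gt0//.
Qed.

Lemma not_approx_null_cons t ts : ~ approx_null (t :: ts) ->
  exists2 d : R, 0 < d & forall x, hnorm x = 1 ->
    {in ts, forall s, hnorm (s x) <= d} -> d < hnorm (t x).
Proof.
move=> nA; apply: contrapT => hn; apply: nA => d d0; apply: contrapT => hx.
apply: hn; exists d => // x x1 xt; rewrite ltNge; apply/negP => le; apply: hx.
by exists x; split=> // s; rewrite inE => /orP[/eqP ->|/xt].
Qed.

(** A normal operator that is bounded below is invertible. *)
Lemma spectrum_approx_null a (w : R[i]) : normal_op a ->
  spectrum a w -> approx_null [:: a - scalar_op H w].
Proof.
move=> na sw; apply: contrapT => /not_approx_null_cons[d d0 h]; apply: sw.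
apply: (@normal_bounded_below_unit _ _ _ d) => //; first exact: normal_subscalar.
move=> x; have [->|x0] := eqVneq x 0; first by rewrite hnorm0 mulr0 hnorm_ge0.
have [y [y1 yx]] := normalize x0.
have /ltW := h _ y1 (fun s (hs : s \in [::]) => False_ind _ (Bool.diff_false_true hs)).
by rewrite yx ler_pdivlMr ?hnorm_gt0.
Qed.

Lemma approx_null_spectrum a (w : R[i]) ts : approx_null ts ->
  a - scalar_op H w \in ts -> spectrum a w.
Proof.
move=> ts0 aw [b [ba _]].
suff : (1 : R) <= 0 by rewrite ler10.
apply: (@le0_eps _ _ `|b|) => d /ts0[x [x1 /(_ _ aw) tx]].
rewrite -x1 -[in leLHS](scale1r x) -[1 *: x]/((1 : boundedOp H) x) -ba.
by rewrite (le_trans (opnormP b ((a - scalar_op H w) x)))// ler_wpM2l ?opnorm_ge0.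
Qed.

(** Among the unit vectors that are almost annihilated by [ts], those on which
    [b] is largest are almost eigenvectors of [adjoint b * b]. *)
Lemma approx_null_modulus ts b : approx_null ts -> normal_op b ->
    {in ts, forall t, t * b = b * t} ->
  exists M : R, [/\ 0 <= M,
    forall e, 0 < e -> exists2 d, 0 < d & forall x, hnorm x = 1 ->
      {in ts, forall t, hnorm (t x) <= d} -> hnorm (b x) <= M + e
    & approx_null (adjoint b * b - scalar_op H (M ^+ 2)%:C :: ts)].
Proof.
move=> ts0 nb bt.
(* The limit, as [d] decreases to [0], of the supremum of [hnorm (b x)] over the
   unit vectors with [hnorm (t x) <= d] for all [t]. *)
pose B := [set m : R | exists2 d, 0 < d & forall x, hnorm x = 1 ->
  {in ts, forall t, hnorm (t x) <= d} -> hnorm (b x) <= m].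
have Binf : has_inf B.
  split; first by exists `|b|, 1 => // x x1 _; rewrite (le_trans (opnormP _ _))// x1 mulr1.
  exists 0 => m [d d0 h]; have [x [x1 xt]] := ts0 _ d0.
  by rewrite (le_trans _ (h x x1 xt))// hnorm_ge0.
pose M := inf B.
have M0 : 0 <= M.
  apply: lb_le_inf; first exact: Binf.1.
  move=> m [d d0 h]; have [x [x1 xt]] := ts0 _ d0.
  by rewrite (le_trans _ (h x x1 xt))// hnorm_ge0.
have Mup (e : R) : 0 < e -> exists2 d, 0 < d & forall x, hnorm x = 1 ->
      {in ts, forall t, hnorm (t x) <= d} -> hnorm (b x) <= M + e.
  move=> /(inf_adherent)/(_ Binf)[m [d d0 h] /ltW mM].
  by exists d => // x x1 xt; rewrite (le_trans (h x x1 xt)).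
have Mlow (e d : R) : 0 < e -> 0 < d -> exists x, [/\ hnorm x = 1,
    {in ts, forall t, hnorm (t x) <= d} & M - e <= hnorm (b x)].
  move=> e0 d0; apply: contrapT => hn.
  have : B (M - e).
    exists d => // x x1 xt; rewrite leNgt; apply/negP => /ltW le.
    by apply: hn; exists x.
  by move=> /(ge_inf Binf.2); rewrite -/M lerBrDr gerDl leNgt e0.
exists M; split=> // d d0.
have sqE x : hnorm x = 1 -> hnorm ((adjoint b * b - scalar_op H (M ^+ 2)%:C) x) ^+ 2
    = hnorm (b (b x)) ^+ 2 - M ^+ 2 * hnorm (b x) ^+ 2 *+ 2 + (M ^+ 2) ^+ 2.
  move=> x1.
  have -> : (adjoint b * b - scalar_op H (M ^+ 2)%:C) x = adjoint b (b x) - (M ^+ 2)%:C *: x by [].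
  rewrite hnormB_sqr hnormZr x1 normal_hnorm// mulr1.
  have -> : inner H (adjoint b (b x)) ((M ^+ 2)%:C *: x) = (M ^+ 2 * hnorm (b x) ^+ 2)%:C.
    by rewrite linearZr_LR /= [_^*]conjc_real -inner_adjoint inner_hnorm -rmorphM.
  by rewrite /= ger0_norm ?sqr_ge0// addrAC.
move: M0; rewrite le_eqVlt => /orP[/eqP M0|M0].
  have e0 : 0 < d / (`|b| + 1) by rewrite divr_gt0// ltr_wpDl.
  have [d' d'0 h] := Mup _ e0.
  have [x [x1 xt]] := ts0 (Num.min d d') ltac:(by rewrite lt_min d0).
  exists x; split=> // t; rewrite inE => /orP[/eqP ->|/xt tx]; last first.
    by rewrite (le_trans tx)// ge_min lexx.
  have -> : (adjoint b * b - scalar_op H (M ^+ 2)%:C) x = adjoint b (b x).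
    by rewrite -M0 expr0n -[LHS]/(adjoint b (b x) - (0 : R)%:C *: x) scale0r subr0.
  rewrite normal_hnorm// (le_trans (opnormP b (b x)))//.
  have bx : hnorm (b x) <= d / (`|b| + 1).
    rewrite (le_trans (h x x1 _)) -?M0 ?add0r// => s /xt sx.
    by rewrite (le_trans sx)// ge_min lexx orbT.
  rewrite (le_trans (ler_wpM2l (opnorm_ge0 b) bx))//.
  rewrite mulrA ler_pdivrMr ?ltr_wpDl// mulrC ler_wpM2l ?(ltW d0)//.
  by rewrite lerDl.
(* [hnorm (b x)] lies between [M - e] and [M + e], while
   [hnorm (b (b x)) <= (M + e) * hnorm (b x)]; the square to be bounded is then at
   most [13 M^3 e]. *)
pose e := Num.min (M / 2) (d ^+ 2 / (13 * M ^+ 3)).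
have M3 : 0 < 13 * M ^+ 3 by rewrite mulr_gt0 ?exprn_gt0.
have e0 : 0 < e by rewrite lt_min !divr_gt0 ?exprn_gt0.
have eM : e <= M / 2 by rewrite ge_min lexx.
have ed : 13 * M ^+ 3 * e <= d ^+ 2.
  by rewrite mulrC -ler_pdivlMr// ge_min lexx orbT.
have [d1 d10 h] := Mup _ e0.
have b1 : 0 < `|b| + 1 by rewrite ltr_wpDl.
pose d2 := Num.min d (Num.min d1 (d1 * (M / 2) / (`|b| + 1))).
have d20 : 0 < d2 by rewrite !lt_min d0 d10 /= divr_gt0// mulr_gt0// divr_gt0.
have [x [x1 xt bx]] := Mlow e d2 e0 d20.
have MeM : M / 2 <= M - e by move: eM; lra.
have bx0 : 0 < hnorm (b x).
  by rewrite (lt_le_trans _ bx)// (lt_le_trans _ MeM)// divr_gt0.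
(* [b x] too is almost annihilated by [ts], which commutes with [b]. *)
have bbx : hnorm (b (b x)) <= (M + e) * hnorm (b x).
  have [y [y1 yx]] : exists y, hnorm y = 1 /\ forall t, hnorm (t y) = hnorm (t (b x)) / hnorm (b x).
    by apply: normalize; rewrite -hnorm_gt0.
  rewrite -ler_pdivrMr// -yx; apply: h => // t tt; rewrite yx ler_pdivrMr//.
  rewrite -[t (b x)]/((t * b) x) bt// (le_trans (opnormP b (t x)))//.
  rewrite (le_trans (ler_wpM2l (opnorm_ge0 b) (xt _ tt)))//.
  apply: (@le_trans _ _ (d1 * (M / 2))); last first.
    by rewrite ler_wpM2l ?(ltW d10)// (le_trans MeM).
  apply: (@le_trans _ _ ((`|b| + 1) * d2)).
    by rewrite ler_wpM2r ?(ltW d20)// lerDl.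
  by rewrite mulrC -ler_pdivlMr// !ge_min lexx !orbT.
have bxM : hnorm (b x) <= M + e.
  by apply: h => // t /xt tx; rewrite (le_trans tx)// !ge_min lexx orbT.
exists x; split=> // t; rewrite inE => /orP[/eqP ->|/xt tx]; last first.
  by rewrite (le_trans tx)// ge_min lexx.
rewrite -(@ler_pXn2r _ 2) ?nnegrE ?hnorm_ge0 ?(ltW d0)// sqE//.
rewrite (le_trans _ ed)//.
have h1 : hnorm (b (b x)) ^+ 2 <= (M + e) ^+ 2 * hnorm (b x) ^+ 2.
  by rewrite -exprMn ler_pXn2r ?nnegrE ?mulr_ge0 ?hnorm_ge0// addr_ge0 ?ltW.
have h3 : (M - e) ^+ 2 <= hnorm (b x) ^+ 2.
  by rewrite ler_pXn2r ?nnegrE ?hnorm_ge0// (le_trans _ MeM)// divr_ge0 ?ltW.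
have h4 : hnorm (b x) ^+ 2 <= (M + e) ^+ 2.
  by rewrite ler_pXn2r ?nnegrE ?hnorm_ge0// addr_ge0 ?ltW.
move: h1 h3 h4; move: (hnorm (b x) ^+ 2) (hnorm (b (b x)) ^+ 2) => p q h1 h3 h4.
have Me : e ^+ 2 <= M * e / 2.
  by rewrite expr2 mulrAC ler_wpM2r ?(ltW e0).
have Me0 : 0 < M * e by rewrite mulr_gt0.
have h5 : M ^+ 2 - 2 * (M * e) <= p.
  by have := sqr_ge0 e; move: h3; rewrite sqrrB -mulr_natl; lra.
have h2 : (M + e) ^+ 2 <= M ^+ 2 + 5 / 2 * (M * e).
  by rewrite sqrrD -mulr_natl; move: Me; lra.
have M2e : M * e <= M ^+ 2 / 2 by rewrite expr2 -mulrA ler_wpM2l ?(ltW M0).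
have B94 : p <= 9 / 4 * M ^+ 2 by rewrite (le_trans h4)// (le_trans h2)//; move: M2e; lra.
have p0 : 0 <= p by rewrite (le_trans _ h3) ?sqr_ge0.
have h6 : q <= (M ^+ 2 + 5 / 2 * (M * e)) * p.
  by rewrite (le_trans h1)// ler_wpM2r.
have h7 : M * e * p <= M * e * (9 / 4 * M ^+ 2) by rewrite ler_wpM2l ?(ltW Me0).
have h8 : M ^+ 2 * (M ^+ 2 - 2 * (M * e)) <= M ^+ 2 * p by rewrite ler_wpM2l ?sqr_ge0.
have e3 : M ^+ 3 * e = M * e * M ^+ 2 by ring.
rewrite -mulrA e3; move: h6 h7 h8 (mulr_gt0 Me0 (exprn_gt0 2 M0)); rewrite -mulr_natl; lra.
Qed.

(** For a selfadjoint [k], [adjoint k * k - M^2 = (k - M) * (k + M)]: either [k + M]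
    almost annihilates the vectors given by [approx_null_modulus], or [k - M] almost
    annihilates their images under [k + M]. *)
Lemma approx_null_selfadjoint ts k : approx_null ts -> adjoint k = k ->
    {in ts, forall t, t * k = k * t} ->
  exists r : R, approx_null (k - scalar_op H r%:C :: ts).
Proof.
move=> ts0 kk kt.
have nk : normal_op k by rewrite /normal_op kk.
have [M [M0 _]] := approx_null_modulus ts0 nk kt.
rewrite kk => kM.
have [?|/not_approx_null_cons[e e0 he]] :=
  pselect (approx_null (k - scalar_op H (- M)%:C :: ts)); first by exists (- M).
exists M; apply: approx_nullW => d d0.
set l := k - scalar_op H (- M)%:C in he.
have lE : l = k + scalar_op H M%:C.
  by rewrite /l; congr (_ + _); apply/boundedOpP => x; rewrite /= rmorphN scaleNr opprK.
pose d' := Num.min e (Num.min (d * e) (d * e / (`|l| + 1))).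
have l1 : 0 < `|l| + 1 by rewrite ltr_wpDl.
have d'0 : 0 < d' by rewrite !lt_min e0 /= mulr_gt0//= divr_gt0// mulr_gt0.
have [x [x1 xt]] := kM _ d'0.
have xts : {in ts, forall t, hnorm (t x) <= d'}.
  by move=> t tt; apply: xt; rewrite inE tt orbT.
have lx : e < hnorm (l x).
  by apply: he => // t /xts tx; rewrite (le_trans tx)// ge_min lexx.
exists (l x); first by rewrite -hnorm_gt0 (lt_trans e0).
have de : d * e <= d * hnorm (l x) by rewrite ler_wpM2l ?ltW.
move=> t; rewrite inE => /orP[/eqP ->|tt]; apply: le_trans de.
  rewrite -[_ (l x)]/(((k - scalar_op H M%:C) * l) x).
  have -> : (k - scalar_op H M%:C) * l = k * k - scalar_op H (M ^+ 2)%:C.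
    rewrite lE mulrBl !mulrDr (scalar_opC _ k) opprD addrACA addrA.
    rewrite subrK.
    by rewrite -scalar_opM -rmorphM expr2.
  by rewrite (le_trans (xt _ (mem_head _ _)))// !ge_min lexx orbT.
have tl : t * l = l * t by rewrite lE mulrDr mulrDl kt// scalar_opC.
rewrite -[t (l x)]/((t * l) x) tl (le_trans (opnormP l (t x)))//.
apply: (@le_trans _ _ ((`|l| + 1) * d')).
  by rewrite ler_pM ?opnorm_ge0 ?hnorm_ge0 ?xts// lerDl.
by rewrite mulrC -ler_pdivlMr// !ge_min lexx !orbT.
Qed.

End JointApproximateSpectrum.

(** * Polynomials in a normal operator *)

Section PolynomialCalculus.
Context (R : realType) (H : hilbertSpace R).
Implicit Types (a b c k s t u v : boundedOp H) (x y z : H) (ts : seq (boundedOp H)).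
Implicit Types (p q r : {poly R[i]}).

Definition poly_op p a : boundedOp H := \sum_(i < size p) scalar_op H p`_i * a ^+ i.

(** Sums longer than the degree make the sum of two polynomials manageable. *)
Lemma poly_op_wide n p a : (size p <= n)%N ->
  poly_op p a = \sum_(i < n) scalar_op H p`_i * a ^+ i.
Proof.
move=> pn; rewrite /poly_op (big_ord_widen n (fun i => scalar_op H p`_i * a ^+ i))//.
rewrite big_mkcond; apply: eq_bigr => i _; case: ltnP => // ip.
by rewrite nth_default// scalar_op0 mul0r.
Qed.

Lemma poly_opD p q a : poly_op (p + q) a = poly_op p a + poly_op q a.
Proof.
pose n := maxn (size p) (size q).
rewrite !(@poly_op_wide n) ?size_polyD ?leq_max ?leqnn ?orbT//.
rewrite -big_split /=; apply: eq_bigr => i _.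
by rewrite coefD scalar_opD mulrDl.
Qed.

Lemma poly_opC (w : R[i]) a : poly_op w%:P a = scalar_op H w.
Proof.
rewrite (@poly_op_wide 1) ?size_polyC ?leq_b1// big_ord1 coefC eqxx.
by rewrite expr0 mulr1.
Qed.

Lemma poly_opMX p a : poly_op (p * 'X) a = poly_op p a * a.
Proof.
rewrite (@poly_op_wide (size p).+1).
  rewrite big_ord_recl coefMX /= scalar_op0 mul0r add0r.
  rewrite /poly_op mulr_suml; apply: eq_bigr => i _.
  by rewrite coefMX /= exprSr mulrA.
have [->|p0] := eqVneq p 0; first by rewrite mul0r size_poly0.
by rewrite size_mulX.
Qed.

Lemma poly_opM p q a : poly_op (p * q) a = poly_op p a * poly_op q a.
Proof.
elim/poly_ind: q => [|q w ih].
  by rewrite mulr0 -(rmorph0 polyC) poly_opC scalar_op0 mulr0.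
rewrite mulrDr !poly_opD mulrA !poly_opMX ih mulrDr mulrA; congr (_ + _).
rewrite poly_opC -scalar_opC; elim/poly_ind: p {ih} => [|p v ih].
  by rewrite mul0r -(rmorph0 polyC) poly_opC scalar_op0 mulr0.
rewrite mulrDl !poly_opD -mulrA [in _ * w%:P]mulrC mulrA !poly_opMX ih.
by rewrite mulrDr mulrA -rmorphM !poly_opC mulrC scalar_opM.
Qed.

Lemma poly_opX a : poly_op 'X a = a.
Proof.
by rewrite -[in LHS](mul1r 'X) poly_opMX -[1 in LHS]/(1%:P) poly_opC mul1r.
Qed.

Lemma poly_opB p q a : poly_op (p - q) a = poly_op p a - poly_op q a.
Proof. by apply/eqP; rewrite eq_sym subr_eq -poly_opD subrK. Qed.

Lemma poly_op_comm p a b : a * b = b * a -> poly_op p a * b = b * poly_op p a.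
Proof.
move=> ab; rewrite /poly_op mulr_suml mulr_sumr; apply: eq_bigr => i _.
have : GRing.comm b (a ^+ i) by apply: commrX.
rewrite /GRing.comm => ba.
by rewrite mulrA -scalar_opC -!mulrA ba.
Qed.

Lemma poly_op_adjoint p a :
  adjoint (poly_op p a) = poly_op (map_poly Num.conj p) (adjoint a).
Proof.
rewrite (@poly_op_wide (size p) (map_poly _ _)) ?size_poly//.
rewrite /poly_op adjoint_sum; apply: eq_bigr => i _.
rewrite adjointM adjoint_scalar -scalar_opC adjoint_exp coef_map_id0 ?rmorph0//.
Qed.

Lemma normal_poly_op p a : normal_op a -> normal_op (poly_op p a).
Proof.
move=> na; rewrite /normal_op poly_op_adjoint.
by apply: poly_op_comm; apply/esym/poly_op_comm.
Qed.

(** Take vectors on which [n = p(a)] almost reaches its norm [M]: they are almost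
    eigenvectors of [n^* n] for [M^2]. They can be chosen to be approximate
    eigenvectors of the real and imaginary parts of [a] too, hence of [a], for a
    point [w] of the spectrum. As [p] vanishes at [w], [n] almost annihilates
    them, so that [M = 0]. *)
Lemma poly_op_eq0 p a : normal_op a -> (forall w, spectrum a w -> root p w) ->
  poly_op p a = 0.
Proof.
move=> na pa.
have [H0|/existsNP[x0 /eqP x00]] := pselect (forall x : H, x = 0).
  by apply/boundedOpP => x; rewrite [LHS]H0 [RHS]H0.
pose n := poly_op p a.
have nn : normal_op n by exact: normal_poly_op.
have nil0 : approx_null ([::] : seq (boundedOp H)).
  by apply: approx_nullW => d _; exists x0.
have [M [M0 Mup nM]] := approx_null_modulus nil0 nn ltac:(by []).
have nle : forall x, hnorm (n x) <= M * hnorm x.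
  move=> x; have [->|xn0] := eqVneq x 0; first by rewrite linear0 hnorm0 mulr0.
  have [y [y1 yx]] := normalize xn0.
  rewrite -ler_pdivrMr ?hnorm_gt0// -yx; apply/ler_addgt0Pr => e /Mup[d d0]; exact.
suff M00 : M <= 0.
  apply/boundedOpP => x; apply: hnorm0_eq0; apply/eqP.
  by rewrite eq_le hnorm_ge0 andbT (le_trans (nle x))// mulr_le0_ge0 ?hnorm_ge0.
set t := _ - _ in nM.
have an : a * n = n * a by rewrite -poly_op_comm.
have aan : adjoint a * n = n * adjoint a.
  by rewrite -poly_op_comm.
have sC (v : R[i]) b : GRing.comm b (scalar_op H v) by rewrite /GRing.comm scalar_opC.
have at_ : GRing.comm a t.
  apply: commrB => //; apply: commrM => //.
  by rewrite /GRing.comm -[a in LHS]adjointK -adjointM -aan adjointM adjointK.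
have aat_ : GRing.comm (adjoint a) t.
  by apply: commrB => //; apply: commrM => //; rewrite /GRing.comm -!adjointM an.
(* Twice the real and imaginary parts of [a]. *)
pose h := a + adjoint a; pose k := scalar_op H (- 'i) * (a - adjoint a).
have hh : adjoint h = h by rewrite /h adjointD adjointK addrC.
have kk : adjoint k = k.
  rewrite /k adjointM adjoint_scalar -scalar_opC adjointB adjointK.
  have -> : (- 'i : R[i])^* = 'i by rewrite rmorphN /= conjCi opprK.
  by apply/boundedOpP => x /=; rewrite scaleNr -scalerN opprB.
have ha : GRing.comm h a by apply/commr_sym/commrD.
have haa : GRing.comm h (adjoint a) by apply/commr_sym/commrD.
have hk : GRing.comm h k by apply: commrM => //; apply: commrB.
have th : GRing.comm t h by apply: commrD; apply: commr_sym.
have tk : GRing.comm t k by apply: commrM => //; apply: commrB; apply: commr_sym.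
have [r rh] : exists r : R, approx_null [:: h - scalar_op H r%:C; t].
  by apply: approx_null_selfadjoint => // s; rewrite inE => /eqP ->.
have [q] : exists q : R, approx_null [:: k - scalar_op H q%:C; h - scalar_op H r%:C; t].
  apply: approx_null_selfadjoint => // s; rewrite !inE => /orP[|] /eqP -> //.
  by apply/commr_sym; apply: commrB => //; apply: commr_sym.
move=> hkt.
pose w : R[i] := (r%:C + 'i * q%:C) / 2.
have aE : a - scalar_op H w = scalar_op H (2^-1) *
    ((h - scalar_op H r%:C) + scalar_op H 'i * (k - scalar_op H q%:C)).
  have half2 : 2^-1 + 2^-1 = 1 :> R[i] by rewrite [RHS]splitr mul1r.
  have ik : scalar_op H 'i * k = a - adjoint a.
    by rewrite /k mulrA -scalar_opM mulrN -expr2 sqrCi opprK [LHS]mul1r.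
  rewrite mulrBr ik -scalar_opM addrACA [h + _]addrACA subrr addr0 -opprD -scalar_opD.
  rewrite mulrBr -scalar_opM mulrDr -mulrDl -scalar_opD half2 [2^-1 * _]mulrC.
  by congr (_ - _); rewrite -[RHS]/(1 * a) mul1r.
have aw : approx_null [:: a - scalar_op H w; t].
  move=> d d0; have [x [x1 xt]] := hkt d d0; exists x; split=> // s.
  rewrite !inE => /orP[|] /eqP ->; last by apply: xt; rewrite !inE eqxx !orbT.
  rewrite aE -[_ x]/(2^-1 *: ((h - scalar_op H r%:C) x + 'i *: (k - scalar_op H q%:C) x)).
  rewrite hnormZ.
  have -> : complex.Re `|2^-1 : R[i]| = 2^-1.
    by rewrite ger0_norm ?invr_ge0// -(rmorph_nat (real_complex R)) -fmorphV.
  rewrite ler_pdivrMl// (le_trans (Defs.hnormD _ _))// hnormZ normCi mul1r.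
  by rewrite mulr_natl mulr2n lerD// xt// !inE eqxx ?orbT.
have pw : root p w by apply: pa; apply: approx_null_spectrum aw _; rewrite mem_head.
have [f fE] := factor_theorem p w pw.
have nE : n = poly_op f a * (a - scalar_op H w).
  by rewrite /n fE poly_opM poly_opB poly_opX poly_opC.
suff : M ^+ 2 <= 0 by move=> M2; rewrite leNgt; apply/negP => M00; rewrite leNgt exprn_gt0 in M2.
apply: (@le0_eps R _ (`|adjoint n| * `|poly_op f a| + 1)) => d /aw[x [x1 xt]].
have nx : hnorm (n x) <= `|poly_op f a| * d.
  rewrite nE (le_trans (opnormP (poly_op f a) _))// ler_wpM2l ?opnorm_ge0//.
  by apply: xt; rewrite mem_head.
have tx : hnorm (t x) <= d by apply: xt; rewrite !inE eqxx orbT.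
have -> : M ^+ 2 = hnorm (adjoint n (n x) - t x).
  have -> : adjoint n (n x) - t x = (M ^+ 2)%:C *: x.
    by rewrite -[t x]/(adjoint n (n x) - (M ^+ 2)%:C *: x) subKr.
  by rewrite hnormZr x1 mulr1 ger0_norm ?sqr_ge0.
rewrite (le_trans (Defs.hnormD _ _))// Defs.hnormN mulrDl mul1r lerD//.
by rewrite (le_trans (opnormP _ _))// -mulrA ler_wpM2l ?opnorm_ge0.
Qed.
End PolynomialCalculus.

(** * Partial isometries and the isotropy group *)

Section RangeProjection.
Context (R : realType) (H : hilbertSpace R).
Implicit Types (a b c k s t u v : boundedOp H) (x y z : H).

Lemma closure_hnorm (A : set H) x : closure A x ->
  forall e : R, 0 < e -> exists2 y, A y & hnorm (x - y) < e.
Proof.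
move=> Ax e e0; have coshift_rexpr : 0 < e%:C by rewrite ltcR.
have [y [Ay]] := Ax _ (nbhsx_ballx x _ coshift_rexpr).
by rewrite -ball_normE /= hnormE ltcR; exists y.
Qed.

Lemma range_proj_mem a x : closure (range a) (range_proj a x).
Proof. by have [] := range_projP a x. Qed.

Lemma range_proj_id a y : closure (range a) y -> range_proj a y = y.
Proof.
move=> cs; have [pcs po] := range_projP a y.
apply: (@orth_decomposition_uniq _ _ _ y _ _ (closure_subspace (range_subspace a))) => //.
by move=> r _; rewrite subrr linear0l.
Qed.

Lemma range_proj_mul a : range_proj a * a = a.
Proof.
apply/boundedOpP => x; apply: range_proj_id; apply: subset_closure; by exists x.
Qed.

Lemma range_proj_idem a : range_proj a * range_proj a = range_proj a.
Proof. apply/boundedOpP => x; apply: range_proj_id; exact: range_proj_mem. Qed.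

Lemma range_proj_selfadjoint a : adjoint (range_proj a) = range_proj a.
Proof.
apply: is_adjointE => x y; set p := range_proj a.
have pp (u v : H) : inner H (p u) v = inner H (p u) (p v).
  have [_ /(_ _ (@range_proj_mem a u))] := range_projP a v.
  rewrite inner_conj => /eqP; rewrite conjC_eq0 linearBr /= subr_eq0 => /eqP.
  by [].
by rewrite (pp x) [RHS]inner_conj (pp y x) -inner_conj.
Qed.

(** By continuity, [t] vanishes on the closure of the range of [a]. *)
Lemma range_proj_vanish a t : t * a = 0 -> t * range_proj a = 0.
Proof.
move=> ta; apply/boundedOpP => x; apply: hnorm0_eq0; apply/eqP.
rewrite eq_le hnorm_ge0 andbT; apply: (@le0_eps _ _ `|t|) => d d0.
have [_ [y _ <-] xy] := closure_hnorm (@range_proj_mem a x) d0.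
have -> : (t * range_proj a) x = t (range_proj a x - a y).
  have tay : t (a y) = 0 by rewrite -[LHS]/((t * a) y) ta.
  by rewrite linearB /= tay subr0.
by rewrite (le_trans (opnormP _ _))// ler_wpM2l ?opnorm_ge0// ltW.
Qed.

(** [1 - range_proj a] maps to the kernel of the adjoint of [a], which is the kernel
    of [a] by normality. *)
Lemma normal_range_proj a : normal_op a -> a * range_proj a = a.
Proof.
move=> na; apply/boundedOpP => x; apply/eqP; rewrite eq_sym -subr_eq0.
rewrite -[_ - _]/(a x - a (range_proj a x)) -linearB; apply/eqP/hnorm0_eq0.
rewrite -normal_hnorm//.
have -> : x - range_proj a x = (1 - range_proj a) x.
  by rewrite -[RHS]/((1 : boundedOp H) x - range_proj a x) [(1 : boundedOp H) x]scale1r.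
have : adjoint a * (1 - range_proj a) = 0.
  apply: (can_inj (@adjointK _ H)); rewrite adjointM adjointB adjointK adjoint1 adjoint0.
  by rewrite range_proj_selfadjoint mulrBl mul1r range_proj_mul subrr.
by move=> p0; rewrite -[adjoint a _]/((adjoint a * (1 - range_proj a)) x) p0 hnorm0.
Qed.

Lemma adjoint_mul_eq0 t : adjoint t * t = 0 -> t = 0.
Proof.
move=> tt; apply/boundedOpP => x; apply: hnorm0_eq0; apply/eqP.
rewrite -sqrf_eq0 hnorm_sqr adjointP -[adjoint t _]/((adjoint t * t) x) tt.
by rewrite linear0r.
Qed.

Lemma isometry_range_proj a v : isometries_on_range a v -> v * range_proj a = v.
Proof.
move=> Vv; apply/eqP; rewrite -subr_eq0; apply/eqP/adjoint_mul_eq0.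
rewrite adjointB adjointM range_proj_selfadjoint mulrBl !mulrBr -!mulrA.
by rewrite (mulrA (adjoint v)) Vv !range_proj_idem !subrr.
Qed.

Lemma isometry_hnorm a v x : isometries_on_range a v -> hnorm (v x) = hnorm (range_proj a x).
Proof.
move=> Vv; apply/eqP; rewrite -(@eqrXn2 _ 2) ?hnorm_ge0// !hnorm_sqr adjointP.
rewrite adjointP range_proj_selfadjoint -[_ (v x)]/((adjoint v * v) x) Vv.
by rewrite (range_proj_id (@range_proj_mem a x)).
Qed.

Lemma opnorm_isometry a v : isometries_on_range a v -> `|v| <= 1.
Proof.
move=> Vv; apply: opnorm_le => // x; rewrite mul1r (isometry_hnorm _ Vv).
have [->|p0] := eqVneq (range_proj a x) 0; first by rewrite hnorm0 hnorm_ge0.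
rewrite -(ler_pM2r (_ : 0 < hnorm (range_proj a x))) ?hnorm_gt0//.
rewrite -expr2 hnorm_sqr adjointP range_proj_selfadjoint.
rewrite (range_proj_id (@range_proj_mem a x)).
exact: Re_inner_le.
Qed.

(** Take [s = v^* w]. Since [w a = (v a v^* ) w], the operators [w] and [v v^* w]
    agree on the range of [a], hence on its closure. *)
Lemma same_orbit_point a v w : normal_op a ->
    isometries_on_range a v -> isometries_on_range a w ->
    orbit_map a v = orbit_map a w ->
  exists s, [/\ isometries_on_range a s, orbit_map a s = a & w = v * s].
Proof.
move=> na Vv Vw vw; pose s := adjoint v * w; exists s.
have pa := range_proj_mul a; have ap := normal_range_proj na.
have wE : w = v * s.
  apply/eqP; rewrite -subr_eq0; apply/eqP.
  have : (w - v * s) * range_proj a = 0.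
    apply: range_proj_vanish; apply/eqP; rewrite mulrBl subr_eq0; apply/eqP.
    have wa : w * a = orbit_map a v * w.
      by rewrite vw /orbit_map -!mulrA Vw ap.
    rewrite /s -!mulrA wa /orbit_map !mulrA -(mulrA v (adjoint v) v) Vv.
    by rewrite (isometry_range_proj Vv).
  by rewrite mulrBl /s -!mulrA (isometry_range_proj Vw).
split=> //.
  by rewrite /isometries_on_range /= -Vw {2}wE /s !adjointM adjointK !mulrA.
rewrite /orbit_map /s adjointM adjointK -!mulrA (mulrA a) (mulrA w).
have -> : w * (a * adjoint w) = orbit_map a v by rewrite vw /orbit_map mulrA.
rewrite /orbit_map !mulrA Vv pa -mulrA Vv.
by rewrite ap.
Qed.
End RangeProjection.

(** * Finiteness of the spectrum *)

Section FiniteSpectrum.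
Context (R : realType) (H : hilbertSpace R).
Implicit Types (a b c k s t u v : boundedOp H) (x y z : H) (l : R[i]).

Fact rank1_subproof z : linear (fun x => inner H x z *: z).
Proof. by move=> w x y; rewrite linearPl /= scalerDl scalerA. Qed.
Fact rank1_bounded z : exists k : R, forall x, hnorm (inner H x z *: z) <= k * hnorm x.
Proof.
exists (hnorm z * hnorm z) => x; rewrite hnormZ mulrAC ler_wpM2r ?hnorm_ge0//.
have := cauchy_schwarz x z; rewrite -[`|_|]RRe_real ?normr_real// lecR mulrC.
by move/le_trans; apply; rewrite mulrC.
Qed.
(** [hnorm z ^+ 2] times the orthogonal projection onto the line of [z]. *)
Definition rank1 z : boundedOp H := BoundedOp (@rank1_subproof z) (@rank1_bounded z).

Lemma rank1_adjoint z : adjoint (rank1 z) = rank1 z.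
Proof.
apply: is_adjointE => x y /=; rewrite linearZl_LR linearZr_LR /=.
by rewrite -inner_conj mulrC.
Qed.

Lemma opnorm_mul_rank1 b z : `|b * rank1 z| <= hnorm (b z) * hnorm z.
Proof.
apply: opnorm_le => [|x]; first by rewrite mulr_ge0 ?hnorm_ge0.
rewrite mul_opE linearZ hnormZ.
rewrite mulrC -mulrA ler_wpM2l ?hnorm_ge0// mulrC.
by have := cauchy_schwarz x z; rewrite -[`|_|]RRe_real ?normr_real// lecR.
Qed.

Lemma opnorm_rank1_mul b z : `|rank1 z * b| <= hnorm (adjoint b z) * hnorm z.
Proof.
by rewrite -opnorm_adjoint adjointM rank1_adjoint; exact: opnorm_mul_rank1.
Qed.

(** The reflection in the hyperplane orthogonal to [x - y]. It exchanges [x] and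
    [y] because their inner product is real, and its commutator with [b] only
    involves the values of [b] and of its adjoint at [x - y]. *)
Lemma swap_reflection x y : x != y -> hnorm x = hnorm y ->
    complex.Im (inner H x y) = 0 ->
  exists r : boundedOp H, [/\ adjoint r = r, r * r = 1, r x = y
    & forall b, normal_op b ->
        `|r * b - b * r| <= 4 * hnorm (b (x - y)) / hnorm (x - y)].
Proof.
move=> xy nxy im; set z := x - y.
have z0 : 0 < hnorm z by rewrite hnorm_gt0 subr_eq0.
pose k : R := 2 / hnorm z ^+ 2.
have kz : k * hnorm z ^+ 2 = 2 by rewrite /k divfK// gt_eqF// exprn_gt0.
have rr : rank1 z * rank1 z = (hnorm z ^+ 2) *: rank1 z.
  apply/boundedOpP => w; rewrite -[LHS]/(inner H (inner H w z *: z) z *: z).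
  by rewrite real_opE /= linearZl_LR /= inner_hnorm scalerA mulrC.
exists (1 - k *: rank1 z); split.
- by rewrite adjointB adjoint1 adjointZ rank1_adjoint.
- rewrite mulrBl mul1r mulrBr mulr1.
  have -> : k *: rank1 z * (k *: rank1 z) = k *: rank1 z + k *: rank1 z.
    have -> : k *: rank1 z * (k *: rank1 z) = k *: (k *: (rank1 z * rank1 z)).
      apply/boundedOpP => w.
      by rewrite /= !linearZl_LR /= !scalerA; congr (_ *: _); ring.
    by rewrite rr (scalerA k (hnorm z ^+ 2)) kz scaler_nat mulr2n scalerDr.
  by rewrite (opprD (k *: rank1 z) (k *: rank1 z)) (addrA (k *: rank1 z)) subrr sub0r opprK subrK.
- rewrite sub_opE one_opE real_opE /= scalerA.
  suff -> : k%:C * inner H x z = 1 by rewrite scale1r /z subKr.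
  have -> : inner H x z = (hnorm x ^+ 2 - complex.Re (inner H x y))%:C.
    rewrite /z linearBr /= inner_hnorm rmorphB; congr (_ - _).
    by move: im; case: (inner H x y) => u v /= ->.
  have := kz; rewrite /z hnormB_sqr -nxy => kz'.
  rewrite -rmorphM; congr (_%:C); move: kz'; rewrite -mulr2n -mulrnBl mulrnAr.
  by move=> /eqP; rewrite -[2]/(1 *+ 2) eqrMn2r// => /eqP.
- move=> b nb; have -> : (1 - k *: rank1 z) * b - b * (1 - k *: rank1 z) =
      k *: (b * rank1 z - rank1 z * b).
    rewrite mulrBl mul1r mulrBr mulr1 opprB addrC addrA subrK addrC.
    rewrite scalerBr addrC; congr (_ - _); apply/boundedOpP => w.
      by rewrite /= linearZ.
    by [].
  rewrite normrZ ger0_norm; last by rewrite divr_ge0 ?sqr_ge0.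
  have -> : 4 * hnorm (b z) / hnorm z = k * (hnorm (b z) * hnorm z + hnorm (b z) * hnorm z).
    by rewrite /k; field; rewrite gt_eqF.
  rewrite ler_wpM2l ?divr_ge0 ?sqr_ge0// (le_trans (ler_normB _ _))//.
  rewrite lerD ?opnorm_mul_rank1// (le_trans (opnorm_rank1_mul b z))//.
  by rewrite normal_hnorm.
Qed.
End FiniteSpectrum.

Section FiniteSpectrumMain.
Context (R : realType) (H : hilbertSpace R).
Implicit Types (a b c k s t u v : boundedOp H) (x y z : H) (l : R[i]).

(** The modulus as an element of [R]. *)
Definition cabs l : R := complex.Re `|l|.

Lemma cabsE l : `|l| = (cabs l)%:C.
Proof. by rewrite /cabs RRe_real ?normr_real. Qed.

Lemma cabs_ge0 l : 0 <= cabs l.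
Proof. by rewrite -lecR -cabsE normr_ge0. Qed.

Lemma cabs_gt0 l : (0 < cabs l) = (l != 0).
Proof. by rewrite -ltcR -cabsE normr_gt0. Qed.

Lemma cabsM l m : cabs (l * m) = cabs l * cabs m.
Proof. by apply: (@complexI R); rewrite rmorphM /= -!cabsE normrM. Qed.

Lemma Re_le_cabs l : complex.Re l <= cabs l.
Proof.
case: l => u v; rewrite /cabs normc_def /= (le_trans (ler_norm u))//.
by rewrite -sqrtr_sqr ler_sqrt ?addr_ge0 ?sqr_ge0// lerDl sqr_ge0.
Qed.

Lemma cabs_inner x y : cabs (inner H x y) <= hnorm x * hnorm y.
Proof. by rewrite -lecR -cabsE cauchy_schwarz. Qed.

(** [(l - m) <x, y>] is the difference of [<(a - m) x, y> = <x, (a - m)^* y>] and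
    [<(a - l) x, y>]. *)
Lemma approx_eigenvectors_orthogonal a (l m : R[i]) x y (d : R) : normal_op a ->
    hnorm x = 1 -> hnorm y = 1 ->
    hnorm ((a - scalar_op H l) x) <= d -> hnorm ((a - scalar_op H m) y) <= d ->
  cabs (l - m) * cabs (inner H x y) <= d *+ 2.
Proof.
move=> na x1 y1 lx my; rewrite -cabsM.
have -> : (l - m) * inner H x y =
    inner H x (adjoint (a - scalar_op H m) y) - inner H ((a - scalar_op H l) x) y.
  rewrite -adjointP -linearBl -linearZl_LR /=; congr (inner H _ y).
  by rewrite opprB [RHS]addrC addrA subrK scalerBl.
rewrite -lecR -cabsE (le_trans (ler_normB _ _))// !cabsE -rmorphD lecR mulr2n.
rewrite lerD// (le_trans (cabs_inner _ _))// ?x1 ?y1 ?mul1r ?mulr1//.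
by rewrite normal_hnorm//; exact: normal_subscalar.
Qed.

(** If [z] is an approximate eigenvector for a nonzero [l], then [a z] is not
    small, so that its normalization is one too. *)
Lemma approx_eigenvector_range a l (d : R) : normal_op a -> l != 0 -> spectrum a l ->
  0 < d -> exists x, [/\ hnorm x = 1, range_proj a x = x
                       & hnorm ((a - scalar_op H l) x) <= d].
Proof.
move=> na l0 sl d0.
have L0 : 0 < cabs l by rewrite cabs_gt0.
have a1 : 0 < `|a| + 1 by rewrite ltr_wpDl.
pose e := Num.min (cabs l / 2) (d * (cabs l / 2) / (`|a| + 1)).
have e0 : 0 < e by rewrite lt_min !divr_gt0// mulr_gt0// divr_gt0.
have [z [z1 /(_ _ (mem_head _ _)) ze]] := spectrum_approx_null na sl e0.
have az : cabs l / 2 <= hnorm (a z).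
  have : cabs l <= hnorm (a z) + e.
    rewrite -[cabs l]mulr1 -z1 -hnormZ.
    have -> : l *: z = a z - (a - scalar_op H l) z by rewrite sub_opE subKr.
    by rewrite (le_trans (Defs.hnormD _ _))// Defs.hnormN lerD.
  have : e <= cabs l / 2 by rewrite ge_min lexx.
  lra.
have az0 : a z != 0 by rewrite -hnorm_gt0 (lt_le_trans _ az)// divr_gt0.
exists ((hnorm (a z))^-1%:C *: a z); split.
- by rewrite hnormZr ger0_norm ?invr_ge0 ?hnorm_ge0// mulVf// gt_eqF// hnorm_gt0.
- rewrite linearZ /=; congr (_ *: _).
  by rewrite -mul_opE range_proj_mul.
- have aZ (w : R[i]) : (a - scalar_op H l) (w *: a z) = w *: (a - scalar_op H l) (a z).
    by rewrite linearZ.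
  rewrite aZ hnormZr ger0_norm ?invr_ge0 ?hnorm_ge0// mulrC.
  rewrite ler_pdivrMr ?hnorm_gt0//.
  have -> : (a - scalar_op H l) (a z) = a ((a - scalar_op H l) z).
    by rewrite -!mul_opE mulrBl mulrBr scalar_opC.
  rewrite (le_trans (opnormP a _))// (le_trans (ler_wpM2l (opnorm_ge0 a) ze))//.
  apply: (@le_trans _ _ (d * (cabs l / 2))); last by rewrite ler_wpM2l ?(ltW d0).
  apply: (@le_trans _ _ ((`|a| + 1) * e)); first by rewrite ler_wpM2r ?(ltW e0)// lerDl.
  by rewrite mulrC -ler_pdivlMr// ge_min lexx orbT.
Qed.

Lemma isotropy_comm a t : normal_op a -> isometries_on_range a t -> orbit_map a t = a ->
  t * a = a * t.
Proof.
move=> na Vt ta; rewrite -{2}ta /orbit_map -!mulrA.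
by have -> : adjoint t * t = range_proj a by []; rewrite normal_range_proj.
Qed.

(** The partial isometry [v] is [r p_a], where the reflection [r] exchanges
    approximate eigenvectors [x] for [l] and [y] for [m]. An element [t] of the
    isotropy group maps [x] to an approximate eigenvector for [l], whose inner
    product with [y = v x] is at most [1 / 2] in modulus. *)
Lemma close_spectrum a (l m : R[i]) : normal_op a -> spectrum a l -> spectrum a m ->
    l != 0 -> l != m ->
  exists2 v, isometries_on_range a v & `|orbit_map a v - a| <= 6 * cabs (l - m) /\
    forall t, isometries_on_range a t -> orbit_map a t = a -> 1 <= `|v - t|.
Proof.
move=> na sl sm l0 lm; pose D := cabs (l - m).
have D0 : 0 < D by rewrite cabs_gt0 subr_eq0.
have d0 : 0 < D / 4 by rewrite divr_gt0.
have [x [x1 px lx]] := approx_eigenvector_range na l0 sl d0.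
have [y0 [y01 /(_ _ (mem_head _ _)) my0]] := spectrum_approx_null na sm d0.
have small x' y' : hnorm x' = 1 -> hnorm y' = 1 -> hnorm ((a - scalar_op H l) x') <= D / 4 ->
    hnorm ((a - scalar_op H m) y') <= D / 4 -> cabs (inner H x' y') <= 2^-1.
  move=> x'1 y'1 lx' my'.
  have := approx_eigenvectors_orthogonal na x'1 y'1 lx' my'.
  by rewrite -/D => le; rewrite -(ler_pM2l D0) (le_trans le)// -mulr_natl; lra.
have [y [y1 my im]] : exists y, [/\ hnorm y = 1, hnorm ((a - scalar_op H m) y) <= D / 4
    & complex.Im (inner H x y) = 0].
  have [xy0|xy0] := eqVneq (inner H x y0) 0; first by exists y0; rewrite xy0.
  (* Rotating [y0] by the phase of [<x, y0>] makes the inner product real. *)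
  pose w := inner H x y0 / `|inner H x y0|.
  have w1 : cabs w = 1.
    apply: (@complexI R); rewrite -cabsE normf_div normr_id divff//.
    by rewrite normr_eq0.
  exists (w *: y0); rewrite linearZ !hnormZ -/(cabs w) w1 !mul1r; split=> //.
  rewrite linearZr_LR /= rmorphM fmorphV /= [in X in _ * X^-1]conj_Creal ?normr_real//.
  by rewrite mulrAC [_^* * _]mulrC -normCK expr2 mulfK ?normr_eq0// cabsE.
have xy2 := small x y x1 y1 lx my.
have xyn : 1 <= hnorm (x - y).
  rewrite -(@ler_pXn2r _ 2) ?nnegrE ?hnorm_ge0// hnormB_sqr x1 y1.
  by have := le_trans (Re_le_cabs _) xy2; rewrite -mulr_natl expr1n; lra.
have xy : x != y by rewrite -subr_eq0 -hnorm_gt0 (lt_le_trans _ xyn).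
have [r [rr r2 rx rb]] := swap_reflection xy (etrans x1 (esym y1)) im.
have Vv : isometries_on_range a (r * range_proj a).
  rewrite /isometries_on_range /= adjointM range_proj_selfadjoint rr -mulrA (mulrA r).
  by rewrite r2 mul1r range_proj_idem.
have oE : orbit_map a (r * range_proj a) = r * a * r.
  rewrite /orbit_map adjointM range_proj_selfadjoint rr !mulrA -(mulrA r _ a).
  by rewrite range_proj_mul -(mulrA r a) normal_range_proj.
exists (r * range_proj a) => //; rewrite oE; split.
  pose b := a - scalar_op H l.
  have nb : normal_op b by exact: normal_subscalar.
  have -> : r * a * r - a = (r * b - b * r) * r.
    have -> : r * b - b * r = r * a - a * r.
      by rewrite /b mulrBr [X in _ - X]mulrBl -scalar_opC opprB addrA subrK.
    by rewrite mulrBl -(mulrA a) r2 mulr1.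
  have r1 : `|r| <= 1.
    apply: opnorm_le => // z; rewrite mul1r -hnorm_sqr_le !hnorm_sqr adjointP rr -mul_opE.
    by rewrite r2 one_opE.
  rewrite (le_trans (opnormM _ _))// -[leRHS]mulr1 ler_pM//.
  rewrite (le_trans (rb b nb))// ler_pdivrMr ?(lt_le_trans _ xyn)//.
  apply: (@le_trans _ _ (6 * D * 1)); last by rewrite ler_wpM2l ?mulr_ge0 ?(ltW D0).
  have : hnorm (b (x - y)) <= D / 4 + (D / 4 + D).
    have -> : b (x - y) = b x - b y by rewrite linearB.
    rewrite (le_trans (Defs.hnormD _ _))// Defs.hnormN lerD//.
    have -> : b y = (a - scalar_op H m) y - (l - m) *: y.
      by rewrite !sub_opE /= scalerBl opprB addrA subrK.
    by rewrite (le_trans (Defs.hnormD _ _))// Defs.hnormN lerD// hnormZ y1 mulr1.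
  lra.
move=> t Vt ta.
have ca := isotropy_comm na Vt ta.
have tx1 : hnorm (t x) = 1 by rewrite (isometry_hnorm _ Vt) px.
have ltx : hnorm ((a - scalar_op H l) (t x)) <= D / 4.
  have -> : (a - scalar_op H l) (t x) = t ((a - scalar_op H l) x).
    by rewrite -!mul_opE mulrBl mulrBr scalar_opC ca.
  rewrite (le_trans (opnormP t _))// -[leRHS]mul1r ler_pM ?hnorm_ge0 ?opnorm_ge0//.
  exact: opnorm_isometry Vt.
have := small _ _ tx1 y1 ltx my => txy.
rewrite (le_trans _ (_ : hnorm ((r * range_proj a - t) x) <= _))//; last first.
  by rewrite (le_trans (opnormP _ _))// x1 mulr1.
rewrite sub_opE mul_opE px rx -Defs.hnormN opprB.
rewrite -(@ler_pXn2r _ 2) ?nnegrE ?hnorm_ge0// hnormB_sqr tx1 y1.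
by have := le_trans (Re_le_cabs _) txy; rewrite -mulr_natl expr1n; lra.
Qed.

End FiniteSpectrumMain.

Section SpectrumFinite.
Context (R : realType) (H : hilbertSpace R).
Implicit Types (a b c k s t u v : boundedOp H) (l : R[i]).

Lemma isotropy_range a s : normal_op a -> isometries_on_range a s -> orbit_map a s = a ->
  range_proj a * s = s.
Proof.
move=> na Vs sa; apply/eqP; rewrite -subr_eq0; apply/eqP.
have : (range_proj a * s - s) * range_proj a = 0.
  apply: range_proj_vanish; apply/eqP; rewrite mulrBl subr_eq0 -!mulrA.
  by rewrite (isotropy_comm na Vs sa) mulrA range_proj_mul.
by rewrite mulrBl -mulrA (isometry_range_proj Vs).
Qed.

Lemma isotropyM a t s : normal_op a ->
    isometries_on_range a t -> orbit_map a t = a ->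
    isometries_on_range a s -> orbit_map a s = a ->
  isometries_on_range a (t * s) /\ orbit_map a (t * s) = a.
Proof.
move=> na Vt ta Vs sa; split.
  rewrite /isometries_on_range /= adjointM -mulrA (mulrA (adjoint t)).
  have -> : adjoint t * t = range_proj a by [].
  by rewrite isotropy_range.
have <- : orbit_map (orbit_map a s) t = orbit_map a (t * s).
  by rewrite /orbit_map adjointM !mulrA.
by rewrite sa.
Qed.

(** The set [W] of the operators at distance less than [1] from the isotropy
    group is open, and it is saturated: partial isometries over the same orbit
    point differ by right multiplication by an element of the isotropy group,
    which is contractive. *)
Lemma orbit_topology_lift a : normal_op a ->
    orbit_quotient_topology a = orbit_norm_topology a ->
  exists2 e : R, 0 < e & forall v, isometries_on_range a v -> `|orbit_map a v - a| < e ->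
    exists t, [/\ isometries_on_range a t, orbit_map a t = a & `|v - t| < 1].
Proof.
move=> na topE.
pose S := [set t | isometries_on_range a t /\ orbit_map a t = a].
have Sp : S (range_proj a).
  split; first by rewrite /isometries_on_range /= range_proj_selfadjoint range_proj_idem.
  by rewrite /orbit_map range_proj_selfadjoint range_proj_mul normal_range_proj.
pose W := \bigcup_(t in S) ball t (1 : R).
pose U := orbit_map a @` (isometries_on_range a `&` W).
have Uinv : isometries_on_range a `&` orbit_map a @^-1` U = isometries_on_range a `&` W.
  apply/seteqP; split=> v [Vv Uv]; split=> //; last by exists v.
  have [z [Vz [t [Vt ta] zt]] zv] := Uv.
  have [s [Vs sa vE]] := same_orbit_point na Vz Vv zv.
  exists (t * s).
    exact: isotropyM.
  move: zt; rewrite vE -!ball_normE /= -mulrBl => zt.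
  rewrite (le_lt_trans (opnormM _ _))// (le_lt_trans _ zt)// -[leRHS]mulr1.
  by rewrite ler_wpM2l// (opnorm_isometry Vs).
have : orbit_quotient_topology a U.
  split; first by move=> _ [v [Vv _] <-]; exists v.
  by rewrite Uinv; exists W => //; apply: bigcup_open => t _; exact: ball_open.
rewrite topE => -[G oG GU].
have aU : U a.
  exists (range_proj a); last by case: Sp.
  split; first by case: Sp.
  by exists (range_proj a) => //; exact: ballxx.
have Ga : G a by rewrite -GU in aU; case: aU.
have /nbhs_ballP[e /= e0 gram_rexpr] : nbhs a G by apply: open_nbhs_nbhs; split.
exists e => // v Vv va.
have : U (orbit_map a v).
  rewrite -GU; split; first by exists v.
  by apply: gram_rexpr; rewrite -ball_normE /= distrC.
move=> Uv.
have : (isometries_on_range a `&` orbit_map a @^-1` U) v by [].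
rewrite Uinv => -[_ [t [Vt ta]]]; rewrite -ball_normE /= distrC => vt.
by exists t.
Qed.

Lemma abs_Re_le_cabs l : `|complex.Re l| <= cabs l.
Proof.
case: l => u v; rewrite /cabs normc_def /= -sqrtr_sqr.
by rewrite ler_sqrt ?addr_ge0 ?sqr_ge0// lerDl sqr_ge0.
Qed.

Lemma abs_Im_le_cabs l : `|complex.Im l| <= cabs l.
Proof.
case: l => u v; rewrite /cabs normc_def /= -sqrtr_sqr.
by rewrite ler_sqrt ?addr_ge0 ?sqr_ge0// lerDr sqr_ge0.
Qed.

Lemma cabs_le_add l : cabs l <= `|complex.Re l| + `|complex.Im l|.
Proof.
case: l => u v; rewrite /cabs normc_def /= -(@ler_pXn2r _ 2) ?nnegrE ?addr_ge0 ?sqrtr_ge0//.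
rewrite sqr_sqrtr ?addr_ge0 ?sqr_ge0// sqrrD !real_normK ?num_real// addrAC lerDl.
by rewrite mulrn_wge0// mulr_ge0.
Qed.

(** A square of side [e / 2] contains at most one point of [A]. *)
Lemma separated_bounded_finite (A : set R[i]) (K e : R) : 0 < e ->
    (forall l, A l -> cabs l <= K) ->
    (forall l m, A l -> A m -> l != m -> e <= cabs (l - m)) ->
  finite_set A.
Proof.
move=> e0 AK Ae.
pose n (r : R) := Num.truncn ((r + K) * 2 / e).
pose f l := (n (complex.Re l), n (complex.Im l)).
have box l : A l -> 0 <= complex.Re l + K /\ 0 <= complex.Im l + K /\
  complex.Re l <= K /\ complex.Im l <= K.
  move=> /AK lK; have := le_trans (abs_Re_le_cabs l) lK; have := le_trans (abs_Im_le_cabs l) lK.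
  by rewrite !ler_norml => /andP[? ?] /andP[? ?]; split; [|split; [|split]]; lra.
have nP (r : R) : 0 <= r + K -> (n r)%:R <= (r + K) * 2 / e < (n r).+1%:R.
  by move=> r0; apply: truncn_itv; rewrite mulr_ge0 ?invr_ge0 ?(ltW e0)// mulr_ge0.
have ndist (r s : R) : 0 <= r + K -> 0 <= s + K -> n r = n s -> `|r - s| < e / 2.
  move=> r0 s0 rs; have /andP[r1 r2] := nP r r0; have /andP[s1 s2] := nP s s0.
  rewrite rs in r1 r2; rewrite -(ltr_pM2r (_ : 0 < 2 / e)) ?divr_gt0//.
  have -> : e / 2 * (2 / e) = 1 by field; rewrite gt_eqF.
  rewrite -[X in _ * X]gtr0_norm ?divr_gt0// -normrM mulrBl.
  rewrite !mulrDl -!mulrA in r1 r2 s1 s2.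
  move: r1 r2 s1 s2; rewrite -natr1 => r1 r2 s1 s2.
  by rewrite ltr_norml; apply/andP; split; lra.
have fi : {in A &, injective f}.
  move=> l m /set_mem Al /set_mem Am [fr fim]; apply/eqP; apply: contraT => lm.
  have [r0 [i0 _]] := box l Al; have [r1 [i1 _]] := box m Am.
  have := Ae l m Al Am lm; rewrite leNgt (le_lt_trans (cabs_le_add _))//.
  rewrite [e]splitr !raddfB /= ltrD//; exact: ndist.
rewrite -(eq_finite_set (inj_card_eq fi)).
pose N := (Num.truncn ((K + K) * 2 / e)).+1.
apply: (@sub_finite_set _ _ (`I_N `*` `I_N)); last by apply: finite_setX; exact: finite_II.
move=> _ [l Al <-]; have [r0 [i0 [rK iK]]] := box l Al.
have nN (r : R) : 0 <= r + K -> r <= K -> (n r < N)%N.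
  move=> r0' rK'; rewrite ltnS /n; apply: le_truncn; rewrite ler_pM2r ?invr_gt0//.
  by rewrite ler_pM2r// lerD2r.
by split=> /=; apply: nN.
Qed.

Lemma spectrum_bounded a l : normal_op a -> spectrum a l -> cabs l <= `|a|.
Proof.
move=> na sl; apply/ler_addgt0Pr => d d0.
have [z [z1 /(_ _ (mem_head _ _)) ze]] := spectrum_approx_null na sl d0.
rewrite -[cabs l]mulr1 -z1 -hnormZ.
have -> : l *: z = a z - (a - scalar_op H l) z by rewrite sub_opE subKr.
rewrite (le_trans (Defs.hnormD _ _))// Defs.hnormN lerD//.
by rewrite (le_trans (opnormP _ _))// z1 mulr1.
Qed.

Lemma spectrum_finite a : normal_op a ->
    orbit_quotient_topology a = orbit_norm_topology a -> finite_set (spectrum a).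
Proof.
move=> na /(orbit_topology_lift na)[e e0 he].
apply: (@sub_finite_set _ _ (spectrum a `\ 0 `|` [set 0])).
  by move=> l sl; have [->|/eqP l0] := eqVneq l 0; [right|left].
rewrite finite_setU; split=> //.
apply: (@separated_bounded_finite _ `|a| (e / 7)); first by rewrite divr_gt0.
  by move=> l [sl _]; exact: spectrum_bounded.
move=> l m [sl /eqP l0] [sm _] lm; rewrite leNgt; apply/negP => lme.
have [v Vv [va vt]] := close_spectrum na sl sm l0 lm.
have [||t [Vt ta]] := he v => //.
  by rewrite (le_lt_trans va)//; move: lme (cabs_ge0 (l - m)) e0; lra.
by rewrite ltNge vt.
Qed.
End SpectrumFinite.

(** * Orthogonal families of projections *)

Section SpectralFamilies.
Context (R : realType) (H : hilbertSpace R) (m : nat).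
Implicit Types (a b c s t u v : boundedOp H) (p q : 'I_m -> boundedOp H).
Implicit Types (e : 'I_m -> R[i]) (f g : {poly R[i]}).

(** Orthogonal projections onto pairwise orthogonal subspaces. *)
Definition orth_family p :=
  (forall i, adjoint (p i) = p i) /\ forall i j, p i * p j = if i == j then p i else 0.

Definition spectral_sum e p : boundedOp H := \sum_i scalar_op H (e i) * p i.

Lemma orth_family_suml p (P : pred 'I_m) j : orth_family p ->
  (\sum_(i | P i) p i) * p j = if P j then p j else 0.
Proof.
move=> [_ pp]; rewrite mulr_suml big_mkcond (bigD1 j)//= pp eqxx big1 ?addr0// => i ij.
by rewrite pp (negbTE ij) if_same.
Qed.

Lemma orth_family_sumr p (P : pred 'I_m) j : orth_family p ->
  p j * (\sum_(i | P i) p i) = if P j then p j else 0.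
Proof.
move=> [_ pp]; rewrite mulr_sumr big_mkcond (bigD1 j)//= pp eqxx big1 ?addr0// => i ij.
by rewrite pp eq_sym (negbTE ij) if_same.
Qed.

Lemma spectral_sum_mulr e p j : orth_family p ->
  spectral_sum e p * p j = scalar_op H (e j) * p j.
Proof.
move=> [_ pp]; rewrite /spectral_sum mulr_suml (bigD1 j)//= -mulrA pp eqxx big1 ?addr0//.
by move=> i ij; rewrite -mulrA pp (negbTE ij) mulr0.
Qed.

(** On the complement of the ranges of [p] the operator is zero, whence the term
    with the value of [f] at [0]. *)
Lemma poly_op_spectral_sum f e p : orth_family p ->
  poly_op f (spectral_sum e p) =
    scalar_op H f.[0] * (1 - \sum_i p i) + \sum_i scalar_op H f.[e i] * p i.
Proof.
move=> pf; elim/poly_ind: f => [|f w ih].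
  rewrite -(rmorph0 polyC) poly_opC scalar_op0 hornerC scalar_op0 mul0r add0r.
  by rewrite big1// => i _; rewrite hornerC scalar_op0 mul0r.
rewrite poly_opD poly_opMX ih poly_opC mulrDl hornerMXaddC mulr0 add0r.
have -> : scalar_op H f.[0] * (1 - \sum_i p i) * spectral_sum e p = 0.
  rewrite -mulrA /spectral_sum mulr_sumr [X in _ * X]big1 ?mulr0// => i _.
  rewrite mulrA -scalar_opC -mulrA mulrBl mul1r orth_family_suml//.
  by rewrite subrr mulr0.
rewrite add0r mulr_suml.
rewrite (eq_bigr (fun i => scalar_op H (f.[e i] * e i) * p i)); last first.
  move=> i _; rewrite -mulrA scalar_opM -mulrA; congr (_ * _).
  rewrite /spectral_sum mulr_sumr (bigD1 i)//= mulrA -scalar_opC -mulrA.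
  have [_ pp] := pf; rewrite pp eqxx big1 ?addr0// => j ji.
  by rewrite mulrA -scalar_opC -mulrA pp eq_sym (negbTE ji) mulr0.
have -> : \sum_i scalar_op H (f * 'X + w%:P).[e i] * p i =
    \sum_i scalar_op H (f.[e i] * e i) * p i + scalar_op H w * \sum_i p i.
  rewrite mulr_sumr -big_split /=; apply: eq_bigr => i _.
  by rewrite hornerMXaddC scalar_opD mulrDl.
by rewrite addrCA; congr (_ + _); rewrite mulrBr mulr1 subrK.
Qed.

Lemma orth_family_conj p v s : orth_family p -> adjoint v * v = s ->
  (forall i, s * p i = p i) -> orth_family (fun i => v * p i * adjoint v).
Proof.
move=> [pa pp] vs sp; split=> [i|i j].
  by rewrite !adjointM adjointK pa mulrA.
rewrite -!mulrA (mulrA (adjoint v)) vs (mulrA s) sp (mulrA (p i)) pp.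
by case: eqP => // _; rewrite mul0r mulr0.
Qed.

Lemma spectral_sum_conj e p v :
  v * spectral_sum e p * adjoint v = spectral_sum e (fun i => v * p i * adjoint v).
Proof.
rewrite /spectral_sum mulr_sumr mulr_suml; apply: eq_bigr => i _.
by rewrite !mulrA -(scalar_opC _ v).
Qed.

End SpectralFamilies.

(** A normal operator has the same kernel as its adjoint, so that
    [adjoint p * (1 - p) = 0]. *)
Lemma normal_idem_selfadjoint (R : realType) (H : hilbertSpace R) (p : boundedOp H) :
  normal_op p -> p * p = p -> adjoint p = p.
Proof.
move=> np pp.
have : adjoint p * (1 - p) = 0.
  apply/boundedOpP => x; apply: hnorm0_eq0; rewrite mul_opE normal_hnorm// -mul_opE.
  by rewrite mulrBr mulr1 pp subrr hnorm0.
rewrite mulrBr mulr1 => /eqP; rewrite subr_eq0 => /eqP ap.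
by rewrite -[RHS]adjointK {2}ap adjointM adjointK -ap.
Qed.

Section Lagrange.
Context (R : realType) (H : hilbertSpace R) (m : nat) (e : 'I_m -> R[i]).
Hypotheses (e0 : forall i, e i != 0) (einj : injective e).
Implicit Types (a b c s t u v : boundedOp H) (p q : 'I_m -> boundedOp H).

(** The factor ['X] makes the interpolation polynomials vanish at [0]: the kernel of
    [spectral_sum e p] belongs to no member of the family. *)
Definition lagrange_num (i : 'I_m) : {poly R[i]} := 'X * \prod_(j | j != i) ('X - (e j)%:P).

Definition lagrange (i : 'I_m) : {poly R[i]} := (lagrange_num i).[e i]^-1 *: lagrange_num i.

Lemma lagrange0 i : (lagrange i).[0] = 0.
Proof.
rewrite /lagrange hornerZ [X in _ * X](_ : _ = 0) ?mulr0//.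
by rewrite /lagrange_num hornerM hornerX mul0r.
Qed.

Lemma lagrangeE i j : (lagrange i).[e j] = (i == j)%:R.
Proof.
rewrite /lagrange hornerZ; case: eqVneq => [->|ij].
  rewrite mulVf// /lagrange_num hornerM hornerX mulf_neq0// horner_prod.
  apply/prodf_neq0 => k kj; rewrite hornerXsubC subr_eq0.
  by apply: contra kj => /eqP/einj ->.
rewrite [X in _ * X](_ : _ = 0) ?mulr0// /lagrange_num hornerM horner_prod.
rewrite (bigD1 j) 1?eq_sym//= hornerXsubC subrr mul0r mulr0//.
Qed.

Lemma lagrange_spectral_sum p i : orth_family p ->
  poly_op (lagrange i) (spectral_sum e p) = p i.
Proof.
move=> pf; rewrite poly_op_spectral_sum// lagrange0 scalar_op0 mul0r add0r.
rewrite (bigD1 i)//= lagrangeE eqxx big1 => [|j ji]; first by rewrite addr0 mul1r.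
by rewrite lagrangeE eq_sym (negbTE ji) scalar_op0 mul0r.
Qed.

(** Identities between the Lagrange polynomials that hold at all points of the
    spectrum hold for their values at [a], by [poly_op_eq0]. *)
Lemma finite_spectrum_decomposition a : normal_op a ->
    (forall w, spectrum a w -> w = 0 \/ exists i, w = e i) ->
  let p i := poly_op (lagrange i) a in
  orth_family p /\ a = spectral_sum e p.
Proof.
move=> na spa p.
have vanish (f g : {poly R[i]}) : f.[0] = g.[0] -> (forall i, f.[e i] = g.[e i]) ->
    poly_op f a = poly_op g a.
  move=> fg0 fge; apply/eqP; rewrite -subr_eq0 -poly_opB; apply/eqP.
  apply: poly_op_eq0 => // w /spa[->|[i ->]];
    by rewrite rootE hornerD hornerN ?fg0 ?fge subrr.
split; first split.
- move=> i; apply: normal_idem_selfadjoint; first exact: normal_poly_op.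
  rewrite /p -poly_opM; apply: vanish => [|k]; rewrite hornerM ?lagrange0 ?mul0r// lagrangeE.
  by case: (i == k); rewrite ?mulr1 ?mulr0.
- move=> i j; rewrite /p -poly_opM; case: eqVneq => [<-|ij].
    apply: vanish => [|k]; rewrite hornerM ?lagrange0 ?mul0r// lagrangeE.
    by case: (i == k); rewrite ?mulr1 ?mulr0.
  rewrite (vanish _ 0) ?poly_op0//.
    by rewrite -(rmorph0 polyC) poly_opC scalar_op0.
  by rewrite hornerM lagrange0 mul0r horner0.
  move=> k; rewrite hornerM !lagrangeE horner0.
  case: eqVneq => [<-|]; rewrite ?mul0r// eq_sym (negbTE ij) mulr0//.
rewrite /spectral_sum /p.
rewrite (eq_bigr (fun i => poly_op ((e i)%:P * lagrange i) a)); last first.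
  by move=> i _; rewrite poly_opM poly_opC.
have <- : poly_op (\sum_i (e i)%:P * lagrange i) a =
    \sum_i poly_op ((e i)%:P * lagrange i) a.
  elim/big_rec2: _ => [|i u v _ <-]; last by rewrite poly_opD.
  by rewrite -(rmorph0 polyC) poly_opC scalar_op0.
rewrite -[LHS]poly_opX; apply: vanish => [|k]; rewrite horner_sum hornerX.
  by rewrite big1// => i _; rewrite hornerM lagrange0 mulr0.
rewrite (bigD1 k)//= hornerM hornerC lagrangeE eqxx mulr1 big1 ?addr0// => i ik.
by rewrite hornerM lagrangeE (negbTE ik) mulr0.
Qed.
End Lagrange.

(** * Flags and their triangular frames *)

Section Flags.
Context (R : realType) (H : hilbertSpace R) (m : nat).
Implicit Types (a b c s t u v x y : boundedOp H) (p q : 'I_m -> boundedOp H) (n : nat).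

Definition flag p n : boundedOp H := \sum_(j < m | (j < n)%N) p j.

Lemma flag0 p : flag p 0 = 0. Proof. by rewrite /flag big1. Qed.

Lemma flagS p (i : 'I_m) : flag p i.+1 = flag p i + p i.
Proof.
rewrite /flag (bigD1 i) ?ltnS//= addrC; congr (_ + _); apply: eq_bigl => j.
by rewrite ltnS andbC -ltn_neqAle.
Qed.

Lemma flag_telescope (F : nat -> boundedOp H) n : (n <= m)%N ->
  flag (fun i => F i.+1 - F i) n = F n - F 0%N.
Proof.
elim: n => [|n ih] nm; first by rewrite flag0 subrr.
by rewrite (flagS _ (Ordinal nm)) /= ih 1?ltnW// addrC addrA subrK.
Qed.

Section flag_facts.
Variables (p : 'I_m -> boundedOp H) (pf : orth_family p).
Local Notation P := (flag p).

Lemma flag_adjoint n : adjoint (P n) = P n.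
Proof. by rewrite /flag adjoint_sum; apply: eq_bigr => i _; case: pf. Qed.

Lemma flag_mull n i : P n * p i = if (i < n)%N then p i else 0.
Proof. exact: orth_family_suml. Qed.

Lemma flag_muln k n : (k <= n)%N -> P n * P k = P k.
Proof.
move=> kn; rewrite {2}/flag mulr_sumr; apply: eq_bigr => i ik.
by rewrite flag_mull (leq_trans ik).
Qed.

Lemma flag_idem n : P n * P n = P n.
Proof. exact: flag_muln. Qed.

Lemma flagC_idem n : (1 - P n) * (1 - P n) = 1 - P n.
Proof. by rewrite mulrBl mul1r mulrBr mulr1 flag_idem subrr subr0. Qed.

End flag_facts.

Section fix_family.
Variables (p : 'I_m -> boundedOp H) (pf : orth_family p).
Local Notation P := (flag p).

(** Block lower triangular part with respect to the family [p]. *)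
Definition lower_part x : boundedOp H := \sum_(j < m) (1 - P j.+1) * x * p j.

(** The frame attached to a block lower triangular [x] is [1 + x]; the flag that it
    spans consists of the ranges of [(1 + x) * P n]. Its Gram matrix and its upper
    left corner on the range of [P n] are completed by the identity, so that
    invertibility on that range becomes invertibility in the algebra. *)
Definition frame_gram x n : boundedOp H :=
  P n * adjoint (1 + x) * (1 + x) * P n + (1 - P n).

Definition frame_corner x n : boundedOp H := P n * (1 + x) * P n + (1 - P n).

Definition frame_proj x n : boundedOp H :=
  (1 + x) * P n * op_inv (frame_gram x n) * P n * adjoint (1 + x).

(** Let [Q] be a projection. On the range of [Q], [proj_shift Q n] is [P n]; on the
    range of [P n], [proj_coshift Q n] is [Q]. Together their invertibility says that
    [P n] maps the range of [Q] bijectively onto its own range. *)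
Definition proj_shift (Q : boundedOp H) n : boundedOp H := 1 - Q + P n.

Definition proj_coshift (Q : boundedOp H) n : boundedOp H := 1 + Q - P n.

(** Column [i] of the frame is the vector of the range of [Q i.+1] with projection
    [p i] on the range of [P i.+1]; the inverse of [proj_shift] solves this equation. *)
Definition frame_of (Q : nat -> boundedOp H) : boundedOp H :=
  \sum_(i < m) (op_inv (proj_shift (Q i.+1) i.+1) - 1) * p i.

Lemma lower_part_col x i : lower_part x = x -> x * p i = (1 - P i.+1) * x * p i.
Proof.
move=> <-; rewrite {2}/lower_part mulr_sumr mulr_suml /lower_part mulr_suml.
apply: eq_bigr => j _; have [_ pp] := pf; rewrite -!mulrA pp.
case: eqP => [->|_]; last by rewrite !mulr0.
by rewrite [RHS]mulrA (flagC_idem pf).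
Qed.

Lemma lower_part_idem x : lower_part (lower_part x) = lower_part x.
Proof.
rewrite /lower_part; apply: eq_bigr => i _; rewrite -mulrA mulr_suml (bigD1 i)//= big1 ?addr0.
  have [_ pp] := pf; rewrite -!mulrA pp eqxx !mulrA.
  by rewrite (flagC_idem pf).
by move=> j ji; have [_ pp] := pf; rewrite -mulrA pp (negbTE ji) mulr0.
Qed.

Lemma lower_part_sum x : lower_part x = x -> x = \sum_(i < m) x * p i.
Proof.
move=> xl; rewrite -{1}xl /lower_part; apply: eq_bigr => i _.
by rewrite -lower_part_col.
Qed.

Lemma lower_frame_corner x (i : 'I_m) : lower_part x = x -> P i.+1 * ((1 + x) * p i) = p i.
Proof.
move=> xl; rewrite mulrDl mul1r mulrDr (flag_mull pf) ltnSn lower_part_col//.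
by rewrite !mulrA mulrBr mulr1 (flag_idem pf) subrr !mul0r addr0.
Qed.

Section frame.
Variables (x : boundedOp H).
Hypothesis Gu : forall n, (n <= m)%N -> op_unit (frame_gram x n).
Local Notation N := (1 + x).
Local Notation G := (frame_gram x).
Local Notation Q := (frame_proj x).

Lemma frame_gram_mul n : G n * P n = P n * adjoint N * N * P n.
Proof. by rewrite /frame_gram mulrDl mulrBl mul1r -!mulrA !(flag_idem pf) subrr addr0. Qed.

Lemma frame_gram_adjoint n : adjoint (G n) = G n.
Proof.
by rewrite /frame_gram adjointD adjointB !adjointM !adjointK adjoint1 (flag_adjoint pf) !mulrA.
Qed.

Lemma frame_proj_adjoint n : (n <= m)%N -> adjoint (Q n) = Q n.
Proof.
move=> nm; rewrite /frame_proj !adjointM adjointK -(op_inv_adjoint (Gu nm)).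
by rewrite frame_gram_adjoint (flag_adjoint pf) !mulrA.
Qed.

(** [Q n] is the orthogonal projection onto the range of [(1 + x) * P n]. *)
Lemma frame_proj_frame n : (n <= m)%N -> Q n * (N * P n) = N * P n.
Proof.
move=> nm; rewrite /frame_proj -!mulrA.
have -> : P n * (adjoint N * (N * P n)) = G n * P n by rewrite frame_gram_mul !mulrA.
by rewrite (op_mulKr _ (Gu nm)) (flag_idem pf).
Qed.

Lemma frame_proj_frameW k n : (k <= n)%N -> (n <= m)%N -> Q n * (N * P k) = N * P k.
Proof.
move=> kn nm; have -> : N * P k = N * P n * P k by rewrite -mulrA (flag_muln pf).
by rewrite mulrA frame_proj_frame.
Qed.

Lemma frame_proj_muln k n : (k <= n)%N -> (n <= m)%N -> Q n * Q k = Q k.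
Proof.
move=> kn nm; rewrite {2}/frame_proj !mulrA -(mulrA (Q n)) frame_proj_frameW//.
Qed.

Lemma frame_proj_nmul k n : (k <= n)%N -> (n <= m)%N -> Q k * Q n = Q k.
Proof.
move=> kn nm; apply: (can_inj (@adjointK _ H)); rewrite adjointM.
by rewrite !frame_proj_adjoint ?frame_proj_muln// (leq_trans kn).
Qed.

Definition frame_family (i : 'I_m) : boundedOp H := Q i.+1 - Q i.

Lemma frame_family_orth : orth_family frame_family.
Proof.
have lt (i j : 'I_m) : (i < j)%N -> frame_family i * frame_family j = 0.
  move=> ij; have jm := ltn_ord j; have jm' := ltnW jm.
  have ij' := ltnW ij; rewrite /frame_family mulrBl !mulrBr.
  rewrite (frame_proj_nmul ij jm') (frame_proj_nmul (leqW ij) jm).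
  by rewrite (frame_proj_nmul ij' jm') (frame_proj_nmul (leqW ij') jm) !subrr.
split=> [i|i j].
  by rewrite /frame_family adjointB !frame_proj_adjoint// ltnW.
case: eqVneq => [<-|]; last first.
  rewrite neq_ltn => /orP[/lt//|/lt ji].
  apply: (can_inj (@adjointK _ H)); rewrite adjointM adjoint0.
  rewrite -[RHS]ji /frame_family !adjointB !frame_proj_adjoint//; exact: ltnW.
have im := ltn_ord i; have im' := ltnW im.
rewrite /frame_family mulrBl !mulrBr (frame_proj_muln (leqnSn i) im).
rewrite (frame_proj_muln (leqnn _) im) (frame_proj_muln (leqnn _) im').
by rewrite (frame_proj_nmul (leqnSn i) im) subrr subr0.
Qed.

Lemma flag_frame_family n : (n <= m)%N -> flag frame_family n = Q n.
Proof.
move=> nm; rewrite flag_telescope//.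
by rewrite {2}/frame_proj flag0 mulr0 !mul0r subr0.
Qed.

(** [proj_shift (Q i.+1) i.+1] maps column [i] of the frame to [p i], as the
    column lies in the range of [Q i.+1]. *)
Lemma frame_ofK : lower_part x = x ->
    (forall n, (n <= m)%N -> op_unit (proj_shift (Q n) n)) ->
  frame_of Q = x.
Proof.
move=> xl Tu; rewrite [RHS]lower_part_sum// /frame_of; apply: eq_bigr => i _.
rewrite mulrBl mul1r; apply/eqP; rewrite subr_eq; apply/eqP.
have -> : x * p i + p i = N * p i by rewrite mulrDl mul1r addrC.
apply: (op_mulrI (Tu i.+1 (ltn_ord i))); rewrite [LHS]mulrA (op_mulrV (Tu i.+1 (ltn_ord i))) mul1r.
have Np : N * P i.+1 * p i = N * p i by rewrite -mulrA (flag_mull pf) ltnSn.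
rewrite /proj_shift mulrDl mulrBl mul1r lower_frame_corner//.
by rewrite -Np mulrA frame_proj_frame// subrr add0r.
Qed.
End frame.

Section flag_to_frame.
Variables (q : 'I_m -> boundedOp H) (qf : orth_family q).
Local Notation Q := (flag q).
Hypothesis Tu : forall n, (n <= m)%N -> op_unit (proj_shift (Q n) n).
Hypothesis Cu : forall n, (n <= m)%N -> op_unit (proj_coshift (Q n) n).
Local Notation x := (frame_of Q).
Local Notation N := (1 + x).

Local Notation f i := (op_inv (proj_shift (Q i.+1) i.+1) * p i).

Lemma frame_of_col (i : 'I_m) : x * p i = f i - p i.
Proof.
have [_ pp] := pf; rewrite /frame_of mulr_suml (bigD1 i)//= -mulrA pp eqxx big1 ?addr0.
  by rewrite mulrBl mul1r.
by move=> j ji; rewrite -mulrA pp (negbTE ji) mulr0.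
Qed.

Lemma frame_col (i : 'I_m) : N * p i = f i.
Proof. by rewrite mulrDl mul1r frame_of_col addrC subrK. Qed.

(** With [n] the column, [1 - P i.+1] annihilates [(1 - Q i.+1) * n] because
    [proj_shift] maps [n] to [p i]; so [proj_coshift] annihilates it too. *)
Lemma frame_col_range (i : 'I_m) : Q i.+1 * f i = f i.
Proof.
have im := ltn_ord i; set n := f i.
have Tn : proj_shift (Q i.+1) i.+1 * n = p i by rewrite mulrA (op_mulrV (Tu im)) mul1r.
have QQ : Q i.+1 * ((1 - Q i.+1) * n) = 0.
  by rewrite mulrA mulrBr mulr1 (flag_idem qf) subrr mul0r.
have PQ : (1 - P i.+1) * ((1 - Q i.+1) * n) = 0.
  have -> : (1 - Q i.+1) * n = p i - P i.+1 * n.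
    by rewrite -Tn /proj_shift [X in _ = X - _]mulrDl addrK.
  by rewrite mulrBr mulrBl mul1r (flag_mull pf) ltnSn subrr mulrA mulrBl mul1r (flag_idem pf) subrr mul0r subrr.
have : (1 - Q i.+1) * n = 0.
  apply: (op_mulrI (Cu im)); rewrite mulr0 /proj_coshift mulrBl mulrDl mul1r QQ addr0.
  by move: PQ; rewrite mulrBl mul1r.
by rewrite mulrBl mul1r => /eqP; rewrite subr_eq0 => /eqP <-.
Qed.

Lemma frame_col_corner (i : 'I_m) : P i.+1 * f i = p i.
Proof.
have im := ltn_ord i.
have : proj_shift (Q i.+1) i.+1 * f i = p i by rewrite mulrA (op_mulrV (Tu im)) mul1r.
by rewrite {1}/proj_shift mulrDl mulrBl mul1r frame_col_range subrr add0r.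
Qed.

Lemma frame_of_lower : lower_part x = x.
Proof.
rewrite /lower_part {2}/frame_of; apply: eq_bigr => i _.
rewrite -mulrA frame_of_col [RHS]mulrBl [LHS]mulrBl !mul1r.
by rewrite mulrBr frame_col_corner (flag_mull pf) ltnSn subrr subr0.
Qed.

Lemma frame_range n : (n <= m)%N -> Q n * (N * P n) = N * P n.
Proof.
move=> nm; rewrite {3 5}/flag !mulr_sumr; apply: eq_bigr => j jn.
by rewrite frame_col -frame_col_range mulrA (flag_muln qf).
Qed.

Hypothesis Gu : forall n, (n <= m)%N -> op_unit (frame_gram x n).
Hypothesis Au : forall n, (n <= m)%N -> op_unit (frame_corner x n).

(** By [frame_range] the flag spanned by the frame is contained in [Q]. Conversely
    [Q n] factors through [N * P n]: invert the corner of the frame and use that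
    [proj_shift] is injective. *)
Lemma frame_proj_of_flag n : (n <= m)%N -> frame_proj x n = Q n.
Proof.
move=> nm; have A := Au nm; have NP := frame_range nm.
have PA : P n * N * P n = P n * frame_corner x n.
  by rewrite /frame_corner [RHS]mulrDr [in RHS]mulrBr mulr1 (flag_idem pf) subrr addr0 !mulrA (flag_idem pf).
have QE : Q n = N * P n * op_inv (frame_corner x n) * P n * Q n.
  set y := (X in _ = X).
  have Qy : Q n * y = y by rewrite /y !(mulrA (Q n)) -(mulrA (Q n) N) NP.
  have Py : P n * y = P n * Q n.
    rewrite /y !(mulrA (P n)) PA -(mulrA (P n) (frame_corner x n)) op_mulrV//.
    by rewrite mulr1 (flag_idem pf).
  apply: (op_mulrI (Tu nm)); rewrite /proj_shift ![(_ + P n) * _]mulrDl ![(1 - _) * _]mulrBl.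
  by rewrite !mul1r Qy Py (flag_idem qf) !subrr.
have Q'Q : frame_proj x n * Q n = Q n.
  by rewrite QE !mulrA -(mulrA _ N) frame_proj_frame.
have QQ' : Q n * frame_proj x n = frame_proj x n.
  by rewrite /frame_proj !mulrA -(mulrA (Q n)) NP.
have := congr1 (@adjoint _ _) Q'Q.
by rewrite adjointM frame_proj_adjoint// (flag_adjoint qf) QQ'.
Qed.

Lemma frame_family_of_flag i : frame_family x i = q i.
Proof.
rewrite /frame_family !frame_proj_of_flag//; last exact: ltnW.
by rewrite flagS addrC addKr.
Qed.
End flag_to_frame.
End fix_family.
End Flags.

(** * Unitary equivalence of nearby families *)

Section OrbitNeighbours.
Context (R : realType) (H : hilbertSpace R).
Implicit Types (a b c s t u v x y : boundedOp H).

(** A Lipschitz function has closed zero set. *)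
Lemma closed_additive_kernel (h : boundedOp H -> boundedOp H) (K : R) :
    (forall x y, h (x - y) = h x - h y) -> (forall x, `|h x| <= K * `|x|) ->
  closed [set x | h x = 0].
Proof.
move=> hB hK x clx /=; apply/eqP; rewrite -normr_le0; apply: (@le0_eps _ _ `|K|) => d d0.
have [y [/= hy]] := clx _ (nbhsx_ballx x _ d0).
rewrite -ball_normE /= => xy.
rewrite -[h x]subr0 -hy -hB (le_trans (hK _))//.
rewrite (le_trans (ler_wpM2r (normr_ge0 _) (ler_norm K)))//.
by rewrite ler_wpM2l// ltW.
Qed.

(** The square root of [1 - x] is [1 - y], where [y = (x + y^2) / 2] is the fixed
    point of a contraction of the ball of radius [1 / 2]. The contraction
    preserves the closed set of selfadjoint elements that commute with [p], so
    the fixed point belongs to it. *)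
Lemma op_sqrt x (I : Type) (p : I -> boundedOp H) : adjoint x = x -> `|x| <= 4^-1 ->
    (forall i, x * p i = p i * x) ->
  exists y, [/\ adjoint y = y, op_unit (1 - y), (1 - y) * (1 - y) = 1 - x
    & forall i, y * p i = p i * y].
Proof.
move=> xx x4 xp.
pose U := [set y : boundedOp H | [/\ `|y| <= 2^-1, adjoint y - y = 0
                                  & forall i, y * p i - p i * y = 0]].
have Ucl : closed U.
  have -> : U = [set y : boundedOp H | `|y| <= 2^-1] `&` [set y | adjoint y - y = 0]
      `&` \bigcap_i [set y | y * p i - p i * y = 0].
    apply/seteqP; split=> y; first by move=> [y2 yy yp]; split=> // i _; exact: yp.
    by move=> [[y2 yy] yp]; split=> // i; exact: yp.
  apply: closedI; [apply: closedI|].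
  - have -> : [set y : boundedOp H | `|y| <= 2^-1] = (fun y => `|y|) @^-1` [set r : R | r <= 2^-1] by [].
    apply: closed_comp; last exact: closed_le.
    by move=> y _; exact: norm_continuous.
  - apply: (@closed_additive_kernel (fun y => adjoint y - y) 2) => [y z|y].
      by rewrite adjointB !opprB addrACA [RHS]addrACA; congr (_ + _); rewrite addrC.
    rewrite (le_trans (ler_normB _ _))// opnorm_adjoint; lra.
  - apply: closed_bigI => i _.
    apply: (@closed_additive_kernel (fun y => y * p i - p i * y) (2 * `|p i|)) => [y z|y].
      by rewrite mulrBl mulrBr !opprB addrACA [RHS]addrACA; congr (_ + _); rewrite addrC.
    rewrite (le_trans (ler_normB _ _))//.
    have := opnormM y (p i); have := opnormM (p i) y; lra.
pose f y : boundedOp H := 2^-1 *: (x + y * y).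
have fU : set_fun U U f.
  move=> y [y2 yy yp]; have {}yy : adjoint y = y by apply/eqP; rewrite -subr_eq0 yy.
  have {}yp i : y * p i = p i * y by apply/eqP; rewrite -subr_eq0 yp.
  split=> [||i].
  - rewrite normrZ ger0_norm// (le_trans (ler_wpM2l _ (ler_normD _ _)))//.
    have : `|y * y| <= 2^-1 * 2^-1 by rewrite (le_trans (opnormM _ _))// ler_pM.
    move: x4; lra.
  - by rewrite /f adjointZ adjointD adjointM xx yy subrr.
  - by rewrite /f scale_opl scale_opr mulrDl mulrDr xp mulrA -yp -!mulrA yp subrr.
pose f' : {fun U >-> U} := HB.pack f (isFun.Build _ _ _ _ f fU).
have ctr : is_contraction f'.
  have h0 : 0 <= 2^-1 :> R by rewrite invr_ge0.
  exists (NngNum h0); split=> /=; first by rewrite invf_lt1// ltr1n.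
  move=> -[y z] [[y2 _ _] [z2 _ _]] /=.
  have -> : f y - f z = 2^-1 *: (y * (y - z) + (y - z) * z).
    by rewrite /f -scalerBr mulrBr mulrBl addrA subrK opprD addrACA subrr add0r.
  rewrite normrZ ger0_norm// ler_wpM2l// (le_trans (ler_normD _ _))//.
  have h1 : `|y * (y - z)| <= 2^-1 * `|y - z|.
    by rewrite (le_trans (opnormM _ _))// ler_wpM2r.
  have h2 : `|(y - z) * z| <= `|y - z| * 2^-1.
    by rewrite (le_trans (opnormM _ _))// ler_wpM2l.
  by move: h1 h2; lra.
have [|y [y2 yy yp] yE] := banach_fixed_point ctr Ucl.
  exists 0; split; rewrite ?normr0 ?adjoint0 ?subrr// => i.
  by rewrite mul0r mulr0 subrr.
exists y; split.
- by apply/eqP; rewrite -subr_eq0 yy.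
- by apply: neumann; rewrite (le_lt_trans y2)// invf_lt1// ltr1n.
- have : y + y = x + y * y.
    rewrite -[y + y]mulr2n -scaler_nat {1}yE /= /f scalerA divff// scale1r//.
  rewrite mulrBl mul1r mulrBr mulr1 => E.
  have -> : x = y + y - y * y by rewrite E addrK.
  by rewrite -(addrA y y) (opprD y (y - _)) addrA.
- by move=> i; apply/eqP; rewrite -subr_eq0 yp.
Qed.

(** It maps the range of [p i] to the range of [q i] and the common complement of
    the first family to that of the second. *)
Definition intertwiner m (q p : 'I_m -> boundedOp H) : boundedOp H :=
  \sum_i q i * p i + (1 - \sum_i q i) * (1 - \sum_i p i).

(** The intertwiner [S] satisfies [S p i = q i S], and [S^* S] commutes with [p],
    hence so does its inverse square root: the unitary part of the polar
    decomposition of [S] intertwines the families too. *)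
Lemma conj_unitary m (q p : 'I_m -> boundedOp H) : orth_family q -> orth_family p ->
    op_unit (intertwiner q p) ->
    `|1 - adjoint (intertwiner q p) * intertwiner q p| <= 4^-1 ->
  exists u, [/\ adjoint u * u = 1, u * adjoint u = 1 & forall i, u * p i = q i * u].
Proof.
move=> qf pf; set S := intertwiner q p => Su Sx.
have [[_ pp] [_ qq]] := (pf, qf).
have Sp i : S * p i = q i * p i.
  have zp : (1 - \sum_i p i) * p i = 0 by rewrite mulrBl mul1r orth_family_suml// subrr.
  rewrite /S /intertwiner mulrDl -(mulrA (1 - _)) zp mulr0 addr0.
  rewrite mulr_suml (bigD1 i)//= -mulrA pp eqxx big1 ?addr0// => j ji.
  by rewrite -mulrA pp (negbTE ji) mulr0.
have qS i : q i * S = q i * p i.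
  have zq : q i * (1 - \sum_i q i) = 0 by rewrite mulrBr mulr1 orth_family_sumr// subrr.
  rewrite /S /intertwiner mulrDr (mulrA (q i) (1 - _)) zq mul0r addr0.
  rewrite mulr_sumr (bigD1 i)//= mulrA qq eqxx big1 ?addr0// => j ji.
  by rewrite mulrA qq eq_sym (negbTE ji) mul0r.
pose x := 1 - adjoint S * S.
have xx : adjoint x = x by rewrite /x adjointB adjointM adjointK adjoint1.
have pS i : p i * adjoint S = adjoint S * q i.
  have [pa _] := pf; have [qa _] := qf.
  apply: (can_inj (@adjointK _ H)); rewrite !adjointM adjointK pa qa.
  by rewrite Sp qS.
have xp i : x * p i = p i * x.
  by rewrite /x mulrBl mulrBr mul1r mulr1 -mulrA Sp -qS !mulrA pS.
have [y [yy y1 y2 yp]] := op_sqrt xx Sx xp.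
have aS : adjoint S * S = (1 - y) * (1 - y) by rewrite y2 /x subKr.
pose u := S * op_inv (1 - y).
have aw : adjoint (op_inv (1 - y)) = op_inv (1 - y).
  by rewrite -op_inv_adjoint// adjointB adjoint1 yy.
have uu : adjoint u * u = 1.
  rewrite /u adjointM aw -mulrA (mulrA (adjoint S)) aS -!mulrA op_mulrV// mulr1.
  by rewrite op_mulVr.
have uU : op_unit u by apply: op_unitM => //; exact: op_unit_inv.
exists u; split=> //.
  have -> : adjoint u = op_inv u.
    by rewrite -[LHS]mulr1 -(op_mulrV uU) mulrA uu mul1r.
  exact: op_mulrV.
move=> i; rewrite /u -mulrA.
have -> : op_inv (1 - y) * p i = p i * op_inv (1 - y).
  by apply: op_inv_comm => //; rewrite mulrBl mulrBr mul1r mulr1 yp.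
by rewrite mulrA Sp -qS mulrA.
Qed.

End OrbitNeighbours.

(** * Rational expressions in an operator and its adjoint *)

Section RationalExpressions.
Context (R : realType) (H : hilbertSpace R).
Local Notation X := (boundedOp H).
Implicit Types (a b c h x y : X) (s t : seq X) (A : nat -> bool).

(** Expressions in one operator variable [RVar]. The constants [RSlot k] stand for
    the directions of derivation: the [n]-th derivative of an expression is again an
    expression, in the slots [0] to [n - 1]. *)
Inductive rexpr :=
| RConst of X
| RVar
| RSlot of nat
| RAdj of rexpr
| RAdd of rexpr & rexpr
| RMul of rexpr & rexpr
| RInv of rexpr.

Implicit Types e f : rexpr.

Fixpoint reval e x s : X :=
  match e with
  | RConst a => a
  | RVar => x
  | RSlot k => s`_k
  | RAdj e1 => adjoint (reval e1 x s)
  | RAdd e1 e2 => reval e1 x s + reval e2 x s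
  | RMul e1 e2 => reval e1 x s * reval e2 x s
  | RInv e1 => op_inv (reval e1 x s)
  end.

(** All inverses occurring in [e] are inverses of units at [x]. The values are taken
    without slots, because only expressions without slots are ever inverted. *)
Fixpoint rwd e x : Prop :=
  match e with
  | RConst _ | RVar | RSlot _ => True
  | RAdj e1 => rwd e1 x
  | RAdd e1 e2 | RMul e1 e2 => rwd e1 x /\ rwd e2 x
  | RInv e1 => rwd e1 x /\ op_unit (reval e1 x [::])
  end.

Fixpoint rshift e :=
  match e with
  | RConst a => RConst a
  | RVar => RVar
  | RSlot k => RSlot k.+1
  | RAdj e1 => RAdj (rshift e1)
  | RAdd e1 e2 => RAdd (rshift e1) (rshift e2)
  | RMul e1 e2 => RMul (rshift e1) (rshift e2)
  | RInv e1 => RInv (rshift e1)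
  end.

(** The new direction takes slot [0], so that the slots present before are shifted. *)
Fixpoint rder e :=
  match e with
  | RConst _ => RConst 0
  | RVar => RSlot 0
  | RSlot _ => RConst 0
  | RAdj e1 => RAdj (rder e1)
  | RAdd e1 e2 => RAdd (rder e1) (rder e2)
  | RMul e1 e2 => RAdd (RMul (rder e1) (rshift e2)) (RMul (rshift e1) (rder e2))
  | RInv e1 => RMul (RMul (RConst (-1)) (RInv (rshift e1)))
                    (RMul (rder e1) (RInv (rshift e1)))
  end.

(** [e] is linear in each of the slots of [A] and involves no other slot; in a
    product the slots are divided between the factors. *)
Fixpoint rhom A e : Prop :=
  match e with
  | RConst a => a = 0 \/ A = xpred0
  | RVar => A = xpred0
  | RSlot k => A = pred1 k
  | RAdj e1 => rhom A e1
  | RAdd e1 e2 => rhom A e1 /\ rhom A e2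
  | RMul e1 e2 => exists A1 A2, [/\ rhom A1 e1, rhom A2 e2,
      A = (fun k => A1 k || A2 k) & forall k, ~~ (A1 k && A2 k)]
  | RInv e1 => A = xpred0 /\ rhom A e1
  end.

Definition shift_slots A k := if k is k'.+1 then A k' else false.
Definition add_slot A k := if k is k'.+1 then A k' else true.

Lemma shift_slots0 : shift_slots xpred0 = xpred0.
Proof. by apply/funext => -[]. Qed.

Lemma reval_shift e x s : reval (rshift e) x s = reval e x (behead s).
Proof.
by elim: e => //= [k|e ->|e -> f ->|e -> f ->|e ->]//; rewrite nth_behead.
Qed.

Lemma rwd_shift e x : rwd e x -> rwd (rshift e) x.
Proof.
elim: e => //= [e he f hf [/he ? /hf]|e he f hf [/he ? /hf]|e he [/he ? ue]] //.
by rewrite reval_shift.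
Qed.

Lemma rwd_der e x : rwd e x -> rwd (rder e) x.
Proof.
elim: e => //= [e he f hf [/he ? /hf]|e he f hf [we wf]|e he [we ue]] //.
  by split; split; try exact: rwd_shift; [exact: he|exact: hf].
have ws := rwd_shift we; have wd := he we.
by rewrite !reval_shift.
Qed.

Lemma rhom_shift e A : rhom A e -> rhom (shift_slots A) (rshift e).
Proof.
elim: e A => //= [a A [->|->]|A ->|k A ->|e he f hf A [/he ? /hf]|
    e he f hf A [A1 [A2 [/he h1 /hf h2 -> dA]]]|e he A [-> /he]] //.
- by left.
- by right; exact: shift_slots0.
- exact: shift_slots0.
- by apply/funext => -[].
- exists (shift_slots A1), (shift_slots A2); split=> //; last by move=> [].
  by apply/funext => -[].
- by rewrite shift_slots0.
Qed.

Lemma rhom_der e A : rhom A e -> rhom (add_slot A) (rder e).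
Proof.
elim: e A => //= [a A _|A ->|k A _|e he f hf A [/he ? /hf]|
    e he f hf A [A1 [A2 [h1 h2 -> dA]]]|e he A [-> h]] //.
- by left.
- by apply/funext => -[].
- by left.
- split.
    exists (add_slot A1), (shift_slots A2); split; [exact: he|exact: rhom_shift| |by move=> []].
    by apply/funext => -[].
  exists (shift_slots A1), (add_slot A2); split; [exact: rhom_shift|exact: hf| |by move=> []].
  by apply/funext => -[].
- have hs : rhom xpred0 (rshift e) by rewrite -shift_slots0; exact: rhom_shift.
  exists xpred0, (add_slot xpred0); split=> //.
    exists xpred0, xpred0; split=> //; first by right.
  exists (add_slot xpred0), xpred0; split=> //; first exact: he.
    by apply/funext => k; rewrite orbF.
  by move=> k; rewrite andbF.
Qed.

Lemma rhom_iter_der e n : rhom xpred0 e -> rhom (fun k => (k < n)%N) (iter n rder e).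
Proof.
move=> h; elim: n => [|n ih] //=.
have -> : (fun k => (k < n.+1)%N) = add_slot (fun k => (k < n)%N) by apply/funext => -[].
exact: rhom_der.
Qed.

Lemma rwd_iter_der e n x : rwd e x -> rwd (iter n rder e) x.
Proof. by move=> w; elim: n => [|n ih] //=; exact: rwd_der. Qed.

Lemma reval_slots e A x s t : rhom A e -> (forall k, A k -> s`_k = t`_k) ->
  reval e x s = reval e x t.
Proof.
elim: e A => //= [k A -> |e he A h st|e he f hf A [h1 h2] st|
    e he f hf A [A1 [A2 [h1 h2 -> dA]]] st|e he A [_ h] st].
- by apply; rewrite /= eqxx.
- by rewrite (he A).
- by rewrite (he A)// (hf A).
- by rewrite (he A1)// ?(hf A2)// => k Ak; apply: st; rewrite Ak ?orbT.
- by rewrite (he A).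
Qed.

Lemma reval_linear e A x s t (r : R) a b : rhom A e -> A (size s) ->
  reval e x (s ++ (r *: a + b) :: t) =
  r *: reval e x (s ++ a :: t) + reval e x (s ++ b :: t).
Proof.
elim: e A => /= [c A [->|-> //]|A -> //|k A ->|e he A h As|e he f hf A [h1 h2] As|
    e he f hf A [A1 [A2 [h1 h2 -> dA]]] As|e he A [-> _]] //.
- by rewrite scaler0 addr0.
- by move=> /eqP <-; rewrite !nth_cat ltnn subnn.
- by rewrite (he A)// adjointD adjointZ.
- by rewrite (he A)// (hf A)// scalerDr addrACA.
- have indep (g : rexpr) B v w : rhom B g -> ~~ B (size s) ->
      reval g x (s ++ v :: t) = reval g x (s ++ w :: t).
    move=> hg nB; apply: reval_slots hg _ => k Bk; rewrite !nth_cat.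
    case: ltnP => // sk; case E: (k - size s)%N => [|j] //.
    have ks : k = size s by apply/eqP; rewrite eqn_leq sk -subn_eq0 E.
    by rewrite -ks Bk in nB.
  have := dA (size s); move: As; case A1s : (A1 (size s)) => /= As nA.
    rewrite (he A1)// (indep f A2 _ a h2)// (indep f A2 b a h2)//.
    by rewrite mulrDl scale_opl.
  rewrite (hf A2)// (indep e A1 _ a h1) ?A1s// (indep e A1 b a h1) ?A1s//.
  by rewrite mulrDr scale_opr.
Qed.

(** The product of the norms of the directions in the slots of [A]. *)
Definition slot_prod A s : R := \prod_(i < size s | A i) `|s`_i|.

Lemma slot_prod_ge0 A s : 0 <= slot_prod A s.
Proof. by apply: prodr_ge0 => i _. Qed.

Lemma slot_prod0 s : slot_prod xpred0 s = 1.
Proof. by rewrite /slot_prod big_pred0. Qed.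

Lemma slot_prodU A1 A2 s : (forall k, ~~ (A1 k && A2 k)) ->
  slot_prod (fun k => A1 k || A2 k) s = slot_prod A1 s * slot_prod A2 s.
Proof.
move=> dA; rewrite /slot_prod [LHS]big_mkcond [X in _ = X * _]big_mkcond.
rewrite [X in _ = _ * X]big_mkcond -big_split /=.
apply: eq_bigr => i _; have := dA i.
by case: (A1 i); case: (A2 i); rewrite ?mulr1 ?mul1r.
Qed.

Lemma slot_prod_add A h s : slot_prod (add_slot A) (h :: s) = `|h| * slot_prod A s.
Proof. by rewrite /slot_prod big_mkcond big_ord_recl /= -big_mkcond. Qed.

Lemma slot_prod_full s : slot_prod (fun k => (k < size s)%N) s = \prod_(v <- s) `|v|.
Proof.
rewrite /slot_prod (big_nth 0) big_mkord; apply: eq_bigl => i.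
by rewrite ltn_ord.
Qed.

Lemma reval_bounded e A x : rhom A e ->
  exists2 C : R, 0 <= C & forall s, `|reval e x s| <= C * slot_prod A s.
Proof.
elim: e A => /= [c A [->|->]|A ->|k A ->|e he A h|e he f hf A [h1 h2]|
    e he f hf A [A1 [A2 [h1 h2 -> dA]]]|e he A [-> h]].
- by exists 0 => // s; rewrite normr0 mul0r.
- by exists `|c| => // s; rewrite slot_prod0 mulr1.
- by exists `|x| => // s; rewrite slot_prod0 mulr1.
- exists 1 => // s; rewrite mul1r; case: (ltnP k (size s)) => ks; last first.
    by rewrite nth_default// normr0 slot_prod_ge0.
  by rewrite /slot_prod (big_pred1 (Ordinal ks)).
- by have [C C0 hC] := he A h; exists C => // s; rewrite opnorm_adjoint.
- have [C C0 hC] := he A h1; have [D D0 hD] := hf A h2.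
  exists (C + D) => [|s]; first exact: addr_ge0.
  by rewrite (le_trans (ler_normD _ _))// mulrDl lerD.
- have [C C0 hC] := he A1 h1; have [D D0 hD] := hf A2 h2.
  exists (C * D) => [|s]; first exact: mulr_ge0.
  by rewrite (le_trans (opnormM _ _))// slot_prodU// mulrACA ler_pM.
- exists `|op_inv (reval e x [::])| => // s; rewrite slot_prod0 mulr1.
  by rewrite (@reval_slots e xpred0 x s [::]).
Qed.

End RationalExpressions.

Section RationalDifferentiability.
Context (R : realType) (H : hilbertSpace R).
Local Notation X := (boundedOp H).
Implicit Types (a b c h x y : X) (s t : seq X) (A : nat -> bool) (e f : rexpr H).

(** [a + h = a (1 + a^-1 h)], and the second factor is invertible for small [h]. *)
Lemma op_inv_near a : op_unit a -> exists C d : R, [/\ 0 <= C, 0 < d &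
  forall h, `|h| < d -> op_unit (a + h) /\ `|op_inv (a + h)| <= C].
Proof.
move=> ua; have i1 : 0 < `|op_inv a| + 1 by rewrite ltr_wpDl.
exists (`|op_inv a| *+ 2), (2^-1 / (`|op_inv a| + 1)); split.
- exact: mulrn_wge0.
- by rewrite divr_gt0// invr_gt0.
move=> h; rewrite ltr_pdivlMr// => hd.
have ih : `|op_inv a * h| <= 2^-1.
  rewrite (le_trans (opnormM _ _))// (le_trans _ (ltW hd))// mulrC ler_wpM2l//.
  by rewrite lerDl.
have ahE : a + h = a * (1 - (- (op_inv a * h))).
  by rewrite opprK mulrDr mulr1 mulrA op_mulrV// mul1r.
have uah : op_unit (a + h).
  rewrite ahE; apply: op_unitM => //; apply: neumann.
  by rewrite normrN (le_lt_trans ih)// invf_lt1// ltr1n.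
split=> //.
have iE : op_inv (a + h) = op_inv a - op_inv a * h * op_inv (a + h).
  apply: (op_mulrI ua); rewrite mulrBr op_mulrV// !mulrA op_mulrV// mul1r.
  by apply/eqP; rewrite eq_sym subr_eq -mulrDl op_mulrV.
have : `|op_inv (a + h)| <= `|op_inv a| + 2^-1 * `|op_inv (a + h)|.
  rewrite {1}iE (le_trans (ler_normB _ _))// lerD2l (le_trans (opnormM _ _))//.
  by rewrite ler_wpM2r.
rewrite -mulr_natl; lra.
Qed.

Lemma op_inv_sub a h : op_unit a -> op_unit (a + h) ->
  op_inv (a + h) - op_inv a = - (op_inv a * h * op_inv (a + h)).
Proof.
move=> ua uah; apply: (op_mulrI ua).
rewrite mulrBr mulrN op_mulrV// !mulrA op_mulrV// mul1r.
apply/eqP; rewrite subr_eq -[X in X == _]addr0; apply/eqP.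
by rewrite addr0 -[1](op_mulrV uah) mulrDl [RHS]addrC addrK.
Qed.

(** [rder e] is the derivative of [e] at [x], with an error that is uniform in the
    directions of the earlier derivations. *)
Definition rdifferentiable e A x := forall r : R, 0 < r -> \forall h \near (0 : X),
  forall s, `|reval e (x + h) s - reval e x s - reval (rder e) x (h :: s)|
    <= r * `|h| * slot_prod A s.

Lemma norm_near0 (r : R) : 0 < r -> \forall h \near (0 : X), `|h| < r.
Proof.
move=> r0; have := nbhsx_ballx (0 : X) _ r0; apply: filterS => h.
by rewrite -ball_normE /= sub0r normrN.
Qed.

Lemma near0W (P : X -> Prop) : (forall h, P h) -> \forall h \near (0 : X), P h.
Proof. by move=> Ph; apply: filterS (norm_near0 ltr01) => h _; exact: Ph. Qed.

Lemma rdifferentiable_lipschitz e A x : rhom A e -> rdifferentiable e A x ->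
  exists2 K : R, 0 <= K & \forall h \near (0 : X),
    forall s, `|reval e (x + h) s - reval e x s| <= K * `|h| * slot_prod A s.
Proof.
move=> he de; have [C C0 hC] := reval_bounded x (rhom_der he).
exists (C + 1); first by rewrite addr_ge0.
have := de 1 ltr01; apply: filterS => h hh s.
have h2 := hh s; have h1 := hC (h :: s); rewrite slot_prod_add in h1; rewrite mul1r in h2.
rewrite -[reval e (x + h) s - _](subrK (reval (rder e) x (h :: s))).
by rewrite (le_trans (ler_normD _ _))// addrC -mulrA mulrDl mul1r lerD.
Qed.

Lemma rdifferentiable_bounded e A x : rhom A e -> rdifferentiable e A x ->
  exists2 C : R, 0 <= C & \forall h \near (0 : X),
    forall s, `|reval e (x + h) s| <= C * slot_prod A s.
Proof.
move=> he de; have [C C0 hC] := reval_bounded x he.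
have [K K0 hK] := rdifferentiable_lipschitz he de.
exists (C + K); first by rewrite addr_ge0.
have := norm_near0 ltr01; apply: filterS2 hK => h hh h1 s.
rewrite -[reval e (x + h) s](subrK (reval e x s)) addrC (le_trans (ler_normD _ _))//.
rewrite mulrDl lerD// (le_trans (hh s))// ler_wpM2r ?slot_prod_ge0//.
by rewrite ler_piMr// ltW.
Qed.

Lemma rdifferentiable_add e f A x : rdifferentiable e A x -> rdifferentiable f A x ->
  rdifferentiable (RAdd e f) A x.
Proof.
move=> de df r r0; have r2 : 0 < r / 2 by rewrite divr_gt0.
have := df _ r2; apply: filterS2 (de _ r2) => h h1 h2 s /=.
have E (a b c d u v : X) : a + b - (c + d) - (u + v) = (a - c - u) + (b - d - v).
  by rewrite (opprD c) (addrACA a b) (opprD u) (addrACA (a - c)).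
rewrite E (le_trans (ler_normD _ _))//.
by rewrite [r]splitr !mulrDl lerD.
Qed.

Lemma rdifferentiable_mul e f A1 A2 x : rhom A1 e -> rhom A2 f ->
    (forall k, ~~ (A1 k && A2 k)) ->
    rdifferentiable e A1 x -> rdifferentiable f A2 x ->
  rdifferentiable (RMul e f) (fun k => A1 k || A2 k) x.
Proof.
move=> he hf dA de df r r0.
have [C C0 hC] := rdifferentiable_bounded hf df.
have [D D0 hD] := reval_bounded x he.
have [D' D'0 hD'] := reval_bounded x (rhom_der he).
have [K K0 hK] := rdifferentiable_lipschitz hf df.
have r1 : 0 < r / 3 / (C + 1) by rewrite !divr_gt0// ltr_wpDl.
have r2 : 0 < r / 3 / (D + 1) by rewrite !divr_gt0// ltr_wpDl.
have r3 : 0 < r / 3 / (D' * K + 1) by rewrite !divr_gt0// ltr_wpDl ?mulr_ge0.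
near=> h.
have de' : forall s, `|reval e (x + h) s - reval e x s - reval (rder e) x (h :: s)|
    <= r / 3 / (C + 1) * `|h| * slot_prod A1 s by near: h; exact: de.
have df' : forall s, `|reval f (x + h) s - reval f x s - reval (rder f) x (h :: s)|
    <= r / 3 / (D + 1) * `|h| * slot_prod A2 s by near: h; exact: df.
have hC' : forall s, `|reval f (x + h) s| <= C * slot_prod A2 s by near: h; exact: hC.
have hK' : forall s, `|reval f (x + h) s - reval f x s| <= K * `|h| * slot_prod A2 s.
  by near: h; exact: hK.
have hd : `|h| <= r / 3 / (D' * K + 1) by apply/ltW; near: h; exact: norm_near0.
move=> s; rewrite slot_prodU//=.
set p1 := slot_prod A1 s; set p2 := slot_prod A2 s.
have p10 : 0 <= p1 := slot_prod_ge0 _ _.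
have p20 : 0 <= p2 := slot_prod_ge0 _ _.
rewrite !reval_shift /=.
set u := reval e x s; set v := reval f x s.
set u' := reval (rder e) x _; set v' := reval (rder f) x _.
set w := reval e (x + h) s; set z := reval f (x + h) s.
have -> : w * z - u * v - (u' * v + u * v') =
    (w - u - u') * z + u' * (z - v) + u * (z - v - v').
  rewrite !mulrBl !mulrBr [X in _ = X + _]addrA subrK.
  rewrite -[X in _ = _ + X]addrA -opprD [X in _ = X + _]addrAC addrA subrK.
  by rewrite -!addrA -!opprD; congr (_ - _); exact: addrCA.
have e1 : `|w - u - u'| <= r / 3 / (C + 1) * `|h| * p1 := de' s.
have e2 : `|z - v - v'| <= r / 3 / (D + 1) * `|h| * p2 := df' s.
have e3 : `|z| <= C * p2 := hC' s.
have e4 : `|z - v| <= K * `|h| * p2 := hK' s.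
have e6 : `|u| <= D * p1 by exact: hD.
have e7 : `|u'| <= D' * (`|h| * p1) by have := hD' (h :: s); rewrite slot_prod_add.
have aux (k : R) : 0 <= k -> r / 3 / (k + 1) * k <= r / 3.
  move=> k0; rewrite mulrAC ler_pdivrMr ?ltr_wpDl// ler_wpM2l ?divr_ge0 ?(ltW r0)//.
  by rewrite lerDl.
have hp0 : 0 <= `|h| * (p1 * p2) by rewrite !mulr_ge0.
have f1 : `|(w - u - u') * z| <= r / 3 * (`|h| * (p1 * p2)).
  rewrite (le_trans (opnormM _ _))// (le_trans (ler_pM _ _ e1 e3))//.
  have -> : r / 3 / (C + 1) * `|h| * p1 * (C * p2) =
    r / 3 / (C + 1) * C * (`|h| * (p1 * p2)) by ring.
  by rewrite ler_wpM2r// aux.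
have f2 : `|u' * (z - v)| <= r / 3 * (`|h| * (p1 * p2)).
  rewrite (le_trans (opnormM _ _))// (le_trans (ler_pM _ _ e7 e4))//.
  have -> : D' * (`|h| * p1) * (K * `|h| * p2) =
    D' * K * `|h| * (`|h| * (p1 * p2)) by ring.
  rewrite ler_wpM2r// (le_trans _ (aux (D' * K) _)) ?mulr_ge0//.
  by rewrite mulrC ler_wpM2r ?mulr_ge0.
have f3 : `|u * (z - v - v')| <= r / 3 * (`|h| * (p1 * p2)).
  rewrite (le_trans (opnormM _ _))// (le_trans (ler_pM _ _ e6 e2))//.
  have -> : D * p1 * (r / 3 / (D + 1) * `|h| * p2) =
    r / 3 / (D + 1) * D * (`|h| * (p1 * p2)) by ring.
  by rewrite ler_wpM2r// aux.
rewrite (le_trans (ler_normD _ _))// (le_trans (lerD (ler_normD _ _) (lexx _)))//.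
rewrite -[r * _ * _]mulrA; move: f1 f2 f3; lra.
Unshelve. all: by end_near. Qed.

(** Write [i] and [j] for the old and the new inverse, [k] for the increment and [d]
    for its linear part: [j - i = - i k j], whence
    [j - i + i d i = - i (k - d) j - i d (j - i)]. *)
Lemma rdifferentiable_inv e x : rhom xpred0 e -> rdifferentiable e xpred0 x ->
    op_unit (reval e x [::]) ->
  rdifferentiable (RInv e) xpred0 x /\
  \forall h \near (0 : X), op_unit (reval e (x + h) [::]).
Proof.
move=> he de; set a := reval e x [::] => ua.
have slotless y s : reval e y s = reval e y [::] by exact: reval_slots he _.
have [C [dl [C0 dl0 hC]]] := op_inv_near ua.
have [D D0 hD] := reval_bounded x (rhom_der he).
have [K K0 hK] := rdifferentiable_lipschitz he de.
have K1 : 0 < dl / (K + 1) by rewrite divr_gt0// ltr_wpDl.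
have near_k : \forall h \near (0 : X), `|reval e (x + h) [::] - a| < dl.
  have := norm_near0 K1; apply: filterS2 hK => h /(_ [::]) hh.
  rewrite slot_prod0 mulr1 in hh; rewrite ltr_pdivlMr ?ltr_wpDl// => hd.
  rewrite (le_lt_trans hh)// (le_lt_trans _ hd)// mulrC ler_wpM2l//.
  by rewrite lerDl.
have unit_near : \forall h \near (0 : X), op_unit (reval e (x + h) [::]).
  by apply: filterS near_k => h /hC[]; rewrite addrC subrK.
split=> // r r0; pose i := op_inv a.
have c1 : 0 <= `|i| * C by rewrite mulr_ge0.
have c2 : 0 <= `|i| * D * `|i| * K * C by rewrite !mulr_ge0.
have r1 : 0 < r / 2 / (`|i| * C + 1) by rewrite !divr_gt0// ltr_wpDl.
have r2 : 0 < r / 2 / (`|i| * D * `|i| * K * C + 1) by rewrite !divr_gt0// ltr_wpDl.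
near=> h.
have e1 : forall s, `|reval e (x + h) s - reval e x s - reval (rder e) x (h :: s)|
    <= r / 2 / (`|i| * C + 1) * `|h| * slot_prod xpred0 s by near: h; exact: de.
have e2 : forall s, `|reval e (x + h) s - reval e x s| <= K * `|h| * slot_prod xpred0 s.
  by near: h; exact: hK.
have e3 : `|reval e (x + h) [::] - a| < dl by near: h; exact: near_k.
have e4 : `|h| <= r / 2 / (`|i| * D * `|i| * K * C + 1).
  by apply/ltW; near: h; exact: norm_near0.
move=> s; rewrite slot_prod0 mulr1 /= !reval_shift /= !slotless.
have := e1 s; have := e2 s; have := hD (h :: s).
rewrite slot_prod_add !slot_prod0 !mulr1 !slotless -/a -/i.
set d := reval (rder e) x (h :: s) => hd hk hkd.
have [] := hC _ e3; rewrite addrC subrK => uk jC.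
set j := op_inv _ in jC *; set k := reval e (x + h) [::] - a in hk hkd *.
have ijk : j - i = - (i * k * j).
  have := @op_inv_sub a k ua; rewrite /k addrC subrK; exact.
have -> : j - i - -1 * i * (d * i) = - (i * (k - d) * j) - i * d * (j - i).
  rewrite (mulrBr i k d) (mulrBl j) (mulrBr (i * d)) mulN1r mulNr opprK ijk.
  by rewrite !opprB [RHS]addrC addrA subrK addrC mulrA.
have f1 : `|i * (k - d) * j| <= r / 2 * `|h|.
  rewrite (le_trans (opnormM _ _))//.
  rewrite (le_trans (ler_pM _ _ (le_trans (opnormM _ _) (ler_wpM2l _ hkd)) jC))//.
  have -> : `|i| * (r / 2 / (`|i| * C + 1) * `|h|) * C =
      r / 2 / (`|i| * C + 1) * (`|i| * C) * `|h| by ring.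
  rewrite ler_wpM2r// mulrAC ler_pdivrMr ?ltr_wpDl// ler_wpM2l ?divr_ge0 ?(ltW r0)//.
  by rewrite lerDl.
have f2 : `|i * d * (j - i)| <= r / 2 * `|h|.
  rewrite ijk mulrN normrN (le_trans (opnormM _ _))//.
  have g1 : `|i * d| <= `|i| * (D * `|h|) by rewrite (le_trans (opnormM _ _))// ler_wpM2l.
  have g2 : `|i * k * j| <= `|i| * (K * `|h|) * C.
    rewrite (le_trans (opnormM _ _))// ler_pM// (le_trans (opnormM _ _))//.
    by rewrite ler_wpM2l.
  rewrite (le_trans (ler_pM _ _ g1 g2))//.
  have -> : `|i| * (D * `|h|) * (`|i| * (K * `|h|) * C) =
      `|i| * D * `|i| * K * C * `|h| * `|h| by ring.
  rewrite ler_wpM2r//; move: e4; rewrite ler_pdivlMr ?ltr_wpDl//; apply: le_trans.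
  by rewrite mulrC ler_wpM2l// lerDl.
rewrite (le_trans (ler_normB _ _))// normrN.
by move: f1 f2; lra.
Unshelve. all: by end_near. Qed.

Lemma reval_differentiable e A x : rhom A e -> rwd e x ->
  rdifferentiable e A x /\ \forall h \near (0 : X), rwd e (x + h).
Proof.
have zero (g : X) r h s B : g = 0 -> 0 < r -> `|g| <= r * `|h| * slot_prod B s.
  by move=> -> r0; rewrite normr0 !mulr_ge0 ?slot_prod_ge0 ?(ltW r0).
elim: e A => [c||k|e he|e he f hf|e he f hf|e he] A.
- move=> _ _; split; last exact: near0W.
  by move=> r r0; apply: near0W => h s /=; apply: zero => //; rewrite subrr subr0.
- move=> _ _; split; last exact: near0W.
  by move=> r r0; apply: near0W => h s /=; apply: zero => //; rewrite addrAC addrK subrr.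
- move=> _ _; split; last exact: near0W.
  by move=> r r0; apply: near0W => h s /=; apply: zero => //; rewrite subrr subr0.
- move=> /= h w; have [d n] := he _ h w; split=> // r r0.
  by apply: filterS (d r r0) => k kd s; rewrite -!adjointB opnorm_adjoint.
- move=> /= [h1 h2] [w1 w2]; have [d1 n1] := he _ h1 w1; have [d2 n2] := hf _ h2 w2.
  by split; [exact: rdifferentiable_add|apply: filterS2 n1 n2].
- move=> /= [A1 [A2 [h1 h2 -> dA]]] [w1 w2].
  have [d1 n1] := he _ h1 w1; have [d2 n2] := hf _ h2 w2.
  by split; [exact: rdifferentiable_mul|apply: filterS2 n1 n2].
- move=> /= [-> h] [w u]; have [d n] := he _ h w.
  have [di ni] := rdifferentiable_inv h d u.
  by split=> //; apply: filterS2 n ni.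
Qed.

End RationalDifferentiability.

Section RationalContinuity.
Context (R : realType) (H : hilbertSpace R).
Local Notation X := (boundedOp H).
Implicit Types (a b c h x y : X) (s t : seq X) (A : nat -> bool) (e f : rexpr H).

Lemma near0_shift (P : X -> Prop) x :
  (\forall h \near (0 : X), P (x + h)) -> nbhs x P.
Proof.
move=> /nbhs_ballP[d /= d0 hd]; apply/nbhs_ballP; exists d => //= y.
rewrite -ball_normE /= => xy.
have := hd (y - x); rewrite -ball_normE /= sub0r normrN distrC => /(_ xy) /=.
by rewrite addrC subrK.
Qed.

Lemma reval_continuous e x : rhom xpred0 e -> rwd e x ->
  reval e y [::] @[y --> x] --> reval e x [::].
Proof.
move=> he we; have [de _] := reval_differentiable he we.
have [K K0 hK] := rdifferentiable_lipschitz he de.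
move=> P /nbhs_ballP[r /= r0 hr].
have K1 : 0 < r / (K + 1) by rewrite divr_gt0// ltr_wpDl.
pose Q (y : X) : Prop := `|reval e x [::] - reval e y [::]| < r.
have nQ : \forall h \near (0 : X), Q (x + h).
  rewrite /Q.
  have := @norm_near0 _ H _ K1; apply: filterS2 hK => h /(_ [::]).
  rewrite slot_prod0 mulr1 ltr_pdivlMr ?ltr_wpDl// distrC => hh hd.
  by rewrite (le_lt_trans hh)// (le_lt_trans _ hd)// mulrC ler_wpM2l// lerDl.
apply: filterS (near0_shift nQ) => y xy.
by apply: hr; rewrite -ball_normE.
Qed.

Lemma open_rwd_preimage e (O : set X) : rhom xpred0 e -> open O ->
  open [set x | rwd e x /\ O (reval e x [::])].
Proof.
move=> he oO; rewrite openE => x [we Ox] /=.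
have [_ nw] := reval_differentiable he we.
have nO : nbhs (reval e x [::]) O by apply: open_nbhs_nbhs.
have nw' : nbhs x [set y | rwd e y] by exact: near0_shift nw.
exact: filterI nw' (reval_continuous he we nO).
Qed.

End RationalContinuity.

Section RationalSmooth.
Context (R : realType) (H : hilbertSpace R).
Local Notation X := (boundedOp H).
Implicit Types (e f : rexpr H).

Fixpoint rsubst (f e : rexpr H) : rexpr H :=
  match e with
  | RConst a => RConst a
  | RVar => f
  | RSlot k => RSlot H k
  | RAdj e1 => RAdj (rsubst f e1)
  | RAdd e1 e2 => RAdd (rsubst f e1) (rsubst f e2)
  | RMul e1 e2 => RMul (rsubst f e1) (rsubst f e2)
  | RInv e1 => RInv (rsubst f e1)
  end.

Fixpoint slotless e : bool :=
  match e with
  | RConst _ | RVar => true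
  | RSlot _ => false
  | RAdj e1 | RInv e1 => slotless e1
  | RAdd e1 e2 | RMul e1 e2 => slotless e1 && slotless e2
  end.

Lemma slotless_rhom e : slotless e -> rhom xpred0 e.
Proof.
elim: e => //= [a _|e he f hf /andP[/he ? /hf]|e he f hf /andP[/he h1 /hf h2]|e he /he] //.
- by right.
- by exists xpred0, xpred0.
Qed.

Lemma slotless_subst f e : slotless f -> slotless e -> slotless (rsubst f e).
Proof.
by move=> sf; elim: e => //= [e he g hg /andP[/he -> /hg]|e he g hg /andP[/he -> /hg]].
Qed.

Lemma reval_subst f e x : slotless e ->
  reval (rsubst f e) x [::] = reval e (reval f x [::]) [::].
Proof.
by elim: e => //= [e he /he ->|e he g hg /andP[/he -> /hg ->]|e he g hg /andP[/he -> /hg ->]|e he /he ->].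
Qed.

Lemma rwd_subst f e x : slotless e -> rwd f x -> rwd e (reval f x [::]) -> rwd (rsubst f e) x.
Proof.
move=> + fx; elim: e => //= [e he g hg /andP[/he h1 /hg h2] [/h1 ? /h2]|
  e he g hg /andP[/he h1 /hg h2] [/h1 ? /h2]|e he se [/(he se) ?]] //.
by rewrite reval_subst.
Qed.

(** The [n]-th derivative is the value of the expression derived [n] times. The
    linear maps [J] and [L] restrict the variable to a model space and project
    the value to one. *)
Lemma rexpr_smooth_on (E F : normedModType R) (J : {linear E -> X}) (L : {linear X -> F})
    (K : R) (U : set E) (e : rexpr H) (g : E -> F) :
    (forall v, `|J v| <= `|v|) -> (forall y, `|L y| <= K * `|y|) -> slotless e ->
    (forall x, U x -> rwd e (J x) /\ g x = L (reval e (J x) [::])) ->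
  smooth_on U g.
Proof.
move=> Jle LK se Ug; have he := slotless_rhom se.
have K0 : 0 <= `|K| by [].
have {}LK y : `|L y| <= `|K| * `|y|.
  by rewrite (le_trans (LK y))// ler_wpM2r// ler_norm.
exists (fun x s => L (reval (iter (size s) (@rder R H) e) (J x) (map J s))) => x Ux.
have [wx gx] := Ug x Ux; split.
- by rewrite gx.
- move=> s t r v w /=; rewrite !size_cat /= !map_cat /= linearP.
  rewrite (@reval_linear _ _ _ (fun k => (k < size s + (size t).+1)%N)) ?linearP//.
    exact: rhom_iter_der.
  by rewrite size_map addnS ltnS leq_addr.
- move=> n; have hn := rhom_iter_der n he.
  have [C C0 hC] := reval_bounded (J x) hn.
  exists (`|K| * C) => s sn; rewrite sn (le_trans (LK _))// -mulrA ler_wpM2l//.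
  rewrite (le_trans (hC _))// ler_wpM2l//.
  have -> : n = size (map J s) by rewrite size_map.
  rewrite slot_prod_full big_map; apply: ler_prod => v _; rewrite normr_ge0 /=; exact: Jle.
- move=> n r r0; have hn := rhom_iter_der n he.
  have wn := rwd_iter_der n wx.
  have [dn _] := reval_differentiable hn wn.
  have r1 : 0 < r / (`|K| + 1) by rewrite divr_gt0// ltr_wpDl.
  have /nbhs_ballP[d /= d0 hd] := dn _ r1.
  apply/nbhs_ballP; exists d => //= h; rewrite -ball_normE /= sub0r normrN => hh s sn.
  rewrite /= sn linearD.
  rewrite -!linearB /= (le_trans (LK _))//.
  have hJ : ball (0 : X) d (J h).
    by rewrite -ball_normE /= sub0r normrN (le_lt_trans (Jle h)).
  have := hd (J h) hJ (map J s) => hhs.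
  rewrite (le_trans (ler_wpM2l K0 hhs))//.
  have -> : n = size (map J s) by rewrite size_map.
  rewrite slot_prod_full big_map.
  have p1 : \prod_(v <- s) `|J v| <= \prod_(v <- s) `|v|.
    by apply: ler_prod => v _; rewrite normr_ge0 Jle.
  have p0 : 0 <= \prod_(v <- s) `|J v| by apply: prodr_ge0.
  have k1 : `|K| * (r / (`|K| + 1)) <= r.
    rewrite mulrA ler_pdivrMr ?ltr_wpDl// mulrC ler_wpM2l ?(ltW r0)//.
    by rewrite lerDl.
  rewrite !mulrA -mulrA -[leRHS]mulrA ler_pM ?mulr_ge0 ?invr_ge0 ?addr_ge0 ?(ltW r0)//.
    by rewrite -mulrA.
  by rewrite ler_pM.
Qed.
End RationalSmooth.

(** * Manifolds with rational charts *)

(** The closed complemented subspaces that serve as model spaces of charts are given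
    by a bounded projection. *)
Record bounded_proj (R : realType) (X : completeNormedModType R) := BoundedProj {
  proj_fun :> {linear X -> X};
  proj_idem : forall x, proj_fun (proj_fun x) = proj_fun x;
  proj_bound : R;
  proj_bounded : forall x, `|proj_fun x| <= proj_bound * `|x| }.

Section FixedSpace.
Context (R : realType) (X : completeNormedModType R) (rho : bounded_proj X).

Record fixed_space := FixedSpace { fixed_val : X; fixed_valP : rho fixed_val = fixed_val }.

Lemma fixed_inj (x y : fixed_space) : fixed_val x = fixed_val y -> x = y.
Proof.
case: x y => [x xP] [y yP] /= xy; subst y.
by rewrite (Prop_irrelevance xP yP).
Qed.

HB.instance Definition _ := gen_eqMixin fixed_space.
HB.instance Definition _ := gen_choiceMixin fixed_space.

Fact fixed0_subproof : rho 0 = 0. Proof. exact: linear0. Qed.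
Fact fixedN_subproof (x : fixed_space) : rho (- fixed_val x) = - fixed_val x.
Proof. by rewrite linearN fixed_valP. Qed.
Fact fixedD_subproof (x y : fixed_space) : rho (fixed_val x + fixed_val y) = fixed_val x + fixed_val y.
Proof. by rewrite linearD !fixed_valP. Qed.
Fact fixedZ_subproof (r : R) (x : fixed_space) : rho (r *: fixed_val x) = r *: fixed_val x.
Proof. by rewrite linearZ fixed_valP. Qed.

Definition fixed0 := FixedSpace fixed0_subproof.
Definition fixedN x := FixedSpace (fixedN_subproof x).
Definition fixedD x y := FixedSpace (fixedD_subproof x y).
Definition fixedZ r x := FixedSpace (fixedZ_subproof r x).

Fact fixedA : associative fixedD.
Proof. by move=> x y z; apply: fixed_inj; exact: addrA. Qed.
Fact fixedC : commutative fixedD.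
Proof. by move=> x y; apply: fixed_inj; exact: addrC. Qed.
Fact fixed0D : left_id fixed0 fixedD.
Proof. by move=> x; apply: fixed_inj; exact: add0r. Qed.
Fact fixedND : left_inverse fixed0 fixedN fixedD.
Proof. by move=> x; apply: fixed_inj; exact: addNr. Qed.
HB.instance Definition _ := GRing.isZmodule.Build fixed_space fixedA fixedC fixed0D fixedND.

Fact fixedZA r s x : fixedZ r (fixedZ s x) = fixedZ (r * s) x.
Proof. by apply: fixed_inj; exact: scalerA. Qed.
Fact fixedZ1 : left_id 1 fixedZ.
Proof. by move=> x; apply: fixed_inj; exact: scale1r. Qed.
Fact fixedZDr : right_distributive fixedZ +%R.
Proof. by move=> r x y; apply: fixed_inj; exact: scalerDr. Qed.
Fact fixedZDl x : {morph fixedZ^~ x : r s / r + s}.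
Proof. by move=> r s; apply: fixed_inj; exact: scalerDl. Qed.
HB.instance Definition _ := GRing.Zmodule_isLmodule.Build R fixed_space
  fixedZA fixedZ1 fixedZDr fixedZDl.

Definition fixed_norm (x : fixed_space) : R := `|fixed_val x|.

Fact fixed_normD x y : fixed_norm (x + y) <= fixed_norm x + fixed_norm y.
Proof. exact: ler_normD. Qed.
Fact fixed_normZ (r : R) x : fixed_norm (r *: x) = `|r| * fixed_norm x.
Proof. exact: normrZ. Qed.
Fact fixed_norm0 x : fixed_norm x = 0 -> x = 0.
Proof. by move=> /normr0_eq0 x0; apply: fixed_inj. Qed.
HB.instance Definition _ :=
  Lmodule_isNormed.Build R fixed_space fixed_normD fixed_normZ fixed_norm0.

Fact fixed_val_linear : linear (fixed_val : fixed_space -> X).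
Proof. by []. Qed.
HB.instance Definition _ := GRing.isLinear.Build R fixed_space X _ fixed_val fixed_val_linear.

Lemma fixed_valE (x : fixed_space) : `|x| = `|fixed_val x|.
Proof. by []. Qed.

Lemma linear_bounded_cvg (Y : normedModType R) (T : {linear X -> Y}) (K : R) (x : X) :
  (forall y, `|T y| <= K * `|y|) -> T @ x --> T x.
Proof.
move=> TK; have {}TK y : `|T y| <= `|K| * `|y|.
  by rewrite (le_trans (TK y))// ler_wpM2r// ler_norm.
move=> P /nbhs_ballP[r /= r0 hr]; apply/nbhs_ballP.
exists (r / (`|K| + 1)) => /=; first by rewrite divr_gt0// ltr_wpDl.
move=> y; rewrite -ball_normE /= ltr_pdivlMr ?ltr_wpDl// => xy.
apply: hr; rewrite -ball_normE /= -linearB (le_lt_trans (TK _))// (le_lt_trans _ xy)//.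
by rewrite mulrC ler_wpM2l// lerDl.
Qed.

Fact fixed_complete (F : set_system fixed_space) : ProperFilter F -> cauchy F -> cvg F.
Proof.
move=> FF Fc.
have Gc : cauchy (fixed_val @ F).
  apply/cauchy_ballP => e e0.
  have := (@cauchy_ballP _ _ F FF).2 Fc _ e0.
  rewrite (near_map2 fixed_val fixed_val).
  by apply: filterS => -[x y] /=; rewrite -!ball_normE.
have Gl : cvg (fixed_val @ F) by exact: (@cauchy_cvg X _ _ Gc).
set l := lim (fixed_val @ F) in Gl.
have lP : rho l = l.
  apply: (@norm_cvg_unique _ X (fixed_val @ F)) => //=.
  have h : (rho \o fixed_val) @ F --> rho l.
    by apply: cvg_comp Gl _; exact: linear_bounded_cvg (@proj_bounded _ _ rho).
  apply: cvg_trans h; apply: near_eq_cvg; apply: nearW => x /=.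
  by rewrite fixed_valP.
apply/cvg_ex; exists (FixedSpace lP) => P /nbhs_ballP[r /= r0 hr].
have : nbhs l (ball l r) by exact: nbhsx_ballx.
move=> /Gl gl.
have sub : fixed_val @^-1` ball l r `<=` P.
  by move=> x; rewrite /= -ball_normE /= => xl; apply: hr; rewrite -ball_normE.
exact: (filterS sub gl).
Qed.
HB.instance Definition _ := Uniform_isComplete.Build fixed_space fixed_complete.

Definition fixed_proj (x : X) : fixed_space := FixedSpace (proj_idem rho x).

Fact fixed_proj_linear : linear fixed_proj.
Proof. by move=> r x y; apply: fixed_inj; rewrite /= linearP. Qed.
HB.instance Definition _ := GRing.isLinear.Build R X fixed_space _ fixed_proj fixed_proj_linear.

Lemma fixed_proj_bounded x : `|fixed_proj x| <= proj_bound rho * `|x|.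
Proof. exact: proj_bounded. Qed.

End FixedSpace.

Section RationalCharts.
Context (R : realType) (H : hilbertSpace R).
Local Notation X := (boundedOp H).
Implicit Types (a b c h x y : X) (e f : rexpr H).

(** Local charts of [S]: a rational expression [rc_param] parametrizes [S] by the range
    of [rc_rho], and a rational expression [rc_coord] inverts it. Both live on open
    sets of operators, [rc_V] and [rc_W]; the domain and the codomain of the
    chart are cut out by the requirement that each expression takes values in
    the open set of the other. The point [rc_base] is the value of the inverse
    chart outside of its codomain. *)
Record rational_chart (S : set X) := RationalChart {
  rc_rho : bounded_proj X;
  rc_V : set X;
  rc_W : set X;
  rc_param : rexpr H;
  rc_coord : rexpr H;
  rc_base : X;
  rc_V_open : open rc_V;
  rc_W_open : open rc_W;
  rc_param_slotless : slotless rc_param;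
  rc_coord_slotless : slotless rc_coord;
  rc_param_wd : forall x, rc_V x -> rwd rc_param x;
  rc_coord_wd : forall x, rc_W x -> rwd rc_coord x;
  rc_baseS : S rc_base;
  rc_paramP : forall x, rc_rho x = x -> rc_V x -> rc_W (reval rc_param x [::]) ->
    S (reval rc_param x [::]) /\ reval rc_coord (reval rc_param x [::]) [::] = x;
  rc_coordP : forall c, S c -> rc_W c -> rc_V (reval rc_coord c [::]) ->
    rc_rho (reval rc_coord c [::]) = reval rc_coord c [::] /\
    reval rc_param (reval rc_coord c [::]) [::] = c }.

Definition rc_codom S (d : rational_chart S) : set X :=
  [set x | rwd (rc_param d) x /\ rc_W d (reval (rc_param d) x [::])] `&` rc_V d.

Definition rc_dom S (d : rational_chart S) : set X :=
  [set c | rwd (rc_coord d) c /\ rc_V d (reval (rc_coord d) c [::])] `&` rc_W d.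

Lemma rc_codom_open S (d : rational_chart S) : open (rc_codom d).
Proof.
apply: openI; last exact: rc_V_open.
by apply: open_rwd_preimage; [exact/slotless_rhom/rc_param_slotless|exact: rc_W_open].
Qed.

Lemma rc_dom_open S (d : rational_chart S) : open (rc_dom d).
Proof.
apply: openI; last exact: rc_W_open.
by apply: open_rwd_preimage; [exact/slotless_rhom/rc_coord_slotless|exact: rc_V_open].
Qed.

Section chart_of.
Variables (S : set X) (d : rational_chart S).
Local Notation M := (set_type S).
Local Notation E := (fixed_space (rc_rho d)).
Local Notation F x := (reval (rc_param d) x [::]).
Local Notation g c := (reval (rc_coord d) c [::]).

Definition mk_point (c : X) (Sc : S c) : M := exist _ c (mem_set Sc).

Definition co_dom : set M := [set m | rc_dom d (set_val m)].
Definition co_cod : set E := [set x | rc_codom d (fixed_val x)].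
Definition co_map (m : M) : E := fixed_proj (rc_rho d) (g (set_val m)).
Definition co_inv (x : E) : M :=
  if pselect (S (F (fixed_val x))) is left Sx then mk_point Sx
  else mk_point (rc_baseS d).

Lemma set_valS (m : M) : S (set_val m).
Proof. by rewrite set_valE; exact: set_valP. Qed.

Lemma set_val_injective (m n : M) : set_val m = set_val n -> m = n.
Proof. by rewrite set_valE; exact: val_inj. Qed.

Lemma co_invE (x : E) : co_cod x -> set_val (co_inv x) = F (fixed_val x).
Proof.
move=> [[_ Wx] Vx]; rewrite /co_inv set_valE; case: pselect => // nS.
by case: nS; have [] := rc_paramP (fixed_valP x) Vx Wx.
Qed.

Lemma co_mapE (m : M) : co_dom m -> fixed_val (co_map m) = g (set_val m).
Proof.
move=> [[_ Vm] Wm] /=; by have [] := rc_coordP (set_valS m) Wm Vm.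
Qed.

Lemma co_map_cod m : co_dom m -> co_cod (co_map m).
Proof.
move=> dm; have [[_ Vm] Wm] := dm; change (rc_codom d (fixed_val (co_map m))); rewrite co_mapE//.
have [_ FgE] := rc_coordP (set_valS m) Wm Vm; split=> //; split; first exact: rc_param_wd.
by rewrite FgE.
Qed.

Lemma co_inv_dom (x : E) : co_cod x -> co_dom (co_inv x).
Proof.
move=> cx; have [[_ Wx] Vx] := cx; change (rc_dom d (set_val (co_inv x))); rewrite co_invE//.
have [_ gFE] := rc_paramP (fixed_valP x) Vx Wx; split=> //; split; first exact: rc_coord_wd.
by rewrite gFE.
Qed.

Lemma co_mapK m : co_dom m -> co_inv (co_map m) = m.
Proof.
move=> dm; apply: set_val_injective; rewrite co_invE; last exact: co_map_cod.
rewrite co_mapE//; have [[_ Vm] Wm] := dm.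
by have [] := rc_coordP (set_valS m) Wm Vm.
Qed.

Lemma co_invK (x : E) : co_cod x -> co_map (co_inv x) = x.
Proof.
move=> cx; apply: fixed_inj; rewrite co_mapE; last exact: co_inv_dom.
rewrite co_invE//; have [[_ Wx] Vx] := cx.
by have [] := rc_paramP (fixed_valP x) Vx Wx.
Qed.

Lemma set_val_continuous : continuous (set_val : M -> X).
Proof. exact: initial_continuous. Qed.

Lemma fixed_val_continuous : continuous (@fixed_val _ _ _ : E -> X).
Proof.
move=> x P /nbhs_ballP[r /= r0 hr]; apply/nbhs_ballP; exists r => //= y.
rewrite -ball_normE /= => xy; apply: hr; rewrite -ball_normE; exact: xy.
Qed.

Lemma co_dom_open : open co_dom.
Proof.
by exists (rc_dom d) => //; exact: rc_dom_open.
Qed.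

Lemma co_cod_open : open co_cod.
Proof.
apply: (@open_comp E X (@fixed_val _ _ _) (rc_codom d)); last exact: rc_codom_open.
by move=> m _; exact: fixed_val_continuous.
Qed.

Lemma co_map_continuous : {within co_dom, continuous co_map}.
Proof.
apply: continuous_in_subspaceT => m /set_mem dm; rewrite /co_map.
have [[wm _] _] := dm.
have h1 := reval_continuous (slotless_rhom (rc_coord_slotless d)) wm.
have h2 := @linear_bounded_cvg _ X _ (fixed_proj (rc_rho d)) _ (g (set_val m)) (@fixed_proj_bounded _ _ (rc_rho d)).
apply: (cvg_comp (fun m : M => g (set_val m)) (fixed_proj (rc_rho d)) _ h2).
exact: (cvg_comp set_val (fun c => g c) (@set_val_continuous m) h1).
Qed.

Lemma co_inv_continuous : {within co_cod, continuous co_inv}.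
Proof.
apply: continuous_in_subspaceT => x /set_mem cx.
have [[wx _] _] := cx.
have h1 := reval_continuous (slotless_rhom (rc_param_slotless d)) wx.
have h2 : (fun x : E => F (fixed_val x)) @ x --> F (fixed_val x).
  exact: (cvg_comp (@fixed_val _ _ _) (fun c => F c) (@fixed_val_continuous x) h1).
move=> P; rewrite nbhsE /= => -[U [oU Ux] UP].
have [B oB BU] : exists2 B, open B & set_val @^-1` B = U by case: oU => B; exists B.
have Bx : B (F (fixed_val x)) by rewrite -co_invE// -[B _]/((set_val @^-1` B) (co_inv x)) BU.
have nB : nbhs (F (fixed_val x)) B by apply: open_nbhs_nbhs.
have nc : nbhs x co_cod by apply: open_nbhs_nbhs; split=> //; exact: co_cod_open.
apply: filterS (filterI nc (h2 _ nB)) => y [cy By]; apply: UP.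
by rewrite -BU /= co_invE.
Qed.

Definition chart_of : chart R M :=
  Chart co_dom_open co_cod_open co_map_cod co_inv_dom co_mapK co_invK
    co_map_continuous co_inv_continuous.

End chart_of.
End RationalCharts.

Section RationalManifold.
Context (R : realType) (H : hilbertSpace R).
Local Notation X := (boundedOp H).
Implicit Types (a b c h x y : X) (e f : rexpr H).

Lemma id_norm_le (y : X) : `|idfun y| <= 1 * `|y|.
Proof. by rewrite mul1r. Qed.

Lemma fixed_val_norm (rho : bounded_proj X) (v : fixed_space rho) : `|fixed_val v| <= `|v|.
Proof. by rewrite fixed_valE. Qed.

Lemma chart_transition_smooth (S : set X) (d d' : rational_chart S)
    (c := chart_of d) (c' := chart_of d') :
  smooth_on (chart_cod c `&` chart_inv c @^-1` chart_dom c') (chart_map c' \o chart_inv c).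
Proof.
apply: (@rexpr_smooth_on _ _ _ _ (@fixed_val _ _ (rc_rho d)) (fixed_proj (rc_rho d')) _ _
  (rsubst (rc_param d) (rc_coord d')) _ (@fixed_val_norm _) (@fixed_proj_bounded _ _ _)).
  by apply: slotless_subst; [exact: rc_param_slotless|exact: rc_coord_slotless].
move=> x [cx dx]; have [[wF _] _] := cx; have [[wg _] _] := dx.
rewrite co_invE// in wg.
split; first by apply: rwd_subst => //; exact: rc_coord_slotless.
by rewrite reval_subst ?rc_coord_slotless//= /co_map co_invE.
Qed.

Lemma chart_param_smooth (S : set X) (d : rational_chart S) :
  smooth_on (chart_cod (chart_of d)) (set_val \o chart_inv (chart_of d)).
Proof.
apply: (@rexpr_smooth_on _ _ _ _ (@fixed_val _ _ (rc_rho d)) (idfun : {linear X -> X}) _ _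
  (rc_param d) _ (@fixed_val_norm _) id_norm_le); first exact: rc_param_slotless.
by move=> x cx; have [[wF _] _] := cx; split=> //=; rewrite co_invE.
Qed.

Section manifold.
Variables (S : set X) (Scover : forall c, S c -> exists d : rational_chart S, rc_dom d c).

Definition rational_atlas (c : chart R (set_type S)) := exists d, c = chart_of d.

Lemma rational_atlas_cover (x : set_type S) : exists2 c, rational_atlas c & chart_dom c x.
Proof.
by have [d dx] := Scover (set_valS x); exists (chart_of d) => //; exists d.
Qed.

Lemma rational_atlas_smooth (c d : chart R (set_type S)) : rational_atlas c -> rational_atlas d ->
  smooth_on (chart_cod c `&` chart_inv c @^-1` chart_dom d) (chart_map d \o chart_inv c).
Proof. by move=> [c' ->] [d' ->]; exact: chart_transition_smooth. Qed.

Definition rational_manifold := BanachManifold rational_atlas_cover rational_atlas_smooth.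

End manifold.

(** The chain rule for formal derivatives. *)
Lemma reval_der_subst f e x v : slotless f -> slotless e ->
  reval (rder (rsubst f e)) x [:: v] =
  reval (rder e) (reval f x [::]) [:: reval (rder f) x [:: v]].
Proof.
move=> sf; elim: e => //= [e he /he ->|e he g hg /andP[/he -> /hg ->]|
  e he g hg /andP[se sg]|e he se] //.
- by rewrite he// hg// !reval_shift /= !reval_subst.
- by rewrite he// !reval_shift /= !reval_subst.
Qed.

Section tangent.
Variables (S : set X) (d : rational_chart S).
Local Notation E := (fixed_space (rc_rho d)).
Variables (y : E) (cy : co_cod y).

Definition param_der (h : X) : X := reval (rder (rc_param d)) (fixed_val y) [:: h].
(** The derivative of the expression [rc_coord] followed by the projection on the model
    space; it is defined on all operators. *)
Definition coord_der (k : X) : X :=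
  rc_rho d (reval (rder (rc_coord d)) (reval (rc_param d) (fixed_val y) [::]) [:: k]).

Lemma rder_linear e x : slotless e -> linear (fun h : X => reval (rder e) x [:: h]).
Proof.
move=> /slotless_rhom/rhom_der he r u v.
exact: (@reval_linear _ _ _ _ x [::] [::] r u v he).
Qed.

Lemma rder_bounded e x : slotless e ->
  exists K : R, forall h : X, `|reval (rder e) x [:: h]| <= K * `|h|.
Proof.
move=> /slotless_rhom/rhom_der he; have [C _ hC] := reval_bounded x he.
by exists C => h; have := hC [:: h]; rewrite slot_prod_add slot_prod0 mulr1.
Qed.

Lemma linear_subZ (f : X -> X) : linear f ->
  (forall u w, f (u - w) = f u - f w) /\ (forall t u, f (t *: u) = t *: f u).
Proof.
move=> fl; pose f' : {linear X -> X} := HB.pack f (GRing.isLinear.Build R X X _ f fl).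
by split=> [u w|t u]; [exact: (linearB f')|exact: (linearZ_LR f' t u)].
Qed.

Definition param_diff (v : E) : X := param_der (fixed_val v).

Fact param_diff_linear : linear param_diff.
Proof. by move=> r u v; rewrite /param_diff /param_der /= rder_linear// rc_param_slotless. Qed.
HB.instance Definition _ := GRing.isLinear.Build R E X _ param_diff param_diff_linear.

Lemma coord_der_linear : linear coord_der.
Proof. by move=> r u v; rewrite /coord_der rder_linear ?rc_coord_slotless// linearP. Qed.

Lemma co_cod_near : exists2 r : R, 0 < r & forall w : E, `|w| < r -> co_cod (y + w).
Proof.
have : nbhs y (co_cod (d := d)) by apply: open_nbhs_nbhs; split=> //; exact: co_cod_open.
move=> /nbhs_ballP[r /= r0 hr]; exists r => // w wr; apply: hr.
by rewrite -ball_normE /= opprD addrA subrr add0r normrN.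
Qed.

(** [rc_coord] inverts [rc_param] near [y] on the model space. By the chain rule the
    derivative of the composite at [y] differs from the identity by a map that is
    [o] of its argument; being linear, this difference is zero. *)
Lemma coord_derK (v : E) : coord_der (param_diff v) = fixed_val v.
Proof.
have [[wF Wy] Vy] := cy.
have sFg : slotless (rsubst (rc_param d) (rc_coord d)).
  by apply: slotless_subst; [exact: rc_param_slotless|exact: rc_coord_slotless].
have wFg : rwd (rsubst (rc_param d) (rc_coord d)) (fixed_val y).
  by apply: rwd_subst => //; [exact: rc_coord_slotless|exact: rc_coord_wd].
pose D v := reval (rder (rsubst (rc_param d) (rc_coord d))) (fixed_val y) [:: v].
suff Dv : D (fixed_val v) = fixed_val v.
  rewrite /coord_der /param_diff /param_der -reval_der_subst ?rc_param_slotless ?rc_coord_slotless//.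
  by rewrite [reval _ _ _]Dv fixed_valP.
have [r1 r10 h1] := co_cod_near.
have gF (w : E) : co_cod w ->
    reval (rsubst (rc_param d) (rc_coord d)) (fixed_val w) [::] = fixed_val w.
  move=> [[_ Ww] Vw]; rewrite reval_subst ?rc_coord_slotless//.
  by have [] := rc_paramP (fixed_valP w) Vw Ww.
apply/eqP; rewrite -subr_eq0 -normr_le0; apply: (@le0_eps R _ `|v|) => r r0.
have [dFg _] := reval_differentiable (slotless_rhom sFg) wFg.
have /nbhs_ballP[r2 /= r20 h2] := dFg _ r0.
pose t := Num.min r1 r2 / 2 / (`|v| + 1).
have v1 : 0 < `|v| + 1 by rewrite ltr_wpDl.
have r12 : 0 < Num.min r1 r2 by rewrite lt_min r10.
have t0 : 0 < t by rewrite !divr_gt0.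
have tv : `|t *: v| < Num.min r1 r2.
  rewrite normrZ gtr0_norm// /t mulrAC ltr_pdivrMr//.
  apply: (@le_lt_trans _ _ (Num.min r1 r2 / 2 * (`|v| + 1))).
    by rewrite ler_wpM2l ?lerDl// divr_ge0// ltW.
  by rewrite ltr_pM2r// ltr_pdivrMr// ltr_pMr// ltr1n.
have b2 : ball (0 : X) r2 (fixed_val (t *: v)).
  rewrite -ball_normE /= sub0r normrN -[X in X < _]/(`|t *: v|).
  by rewrite (lt_le_trans tv)// ge_min lexx orbT.
have := h2 _ b2 [::].
have vD : fixed_val (y + t *: v) = fixed_val y + t *: fixed_val v :> X by [].
have vZ : fixed_val (t *: v) = t *: fixed_val v :> X by [].
rewrite vZ -vD !gF//; last by apply: h1; rewrite (lt_le_trans tv)// ge_min lexx.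
rewrite slot_prod0 mulr1 vD (addrC (fixed_val y)) addrK.
have [_ DZ] := linear_subZ (@rder_linear _ (fixed_val y) sFg).
clearbody t; rewrite DZ -/(D _) -scalerBr !normrZ gtr0_norm// mulrCA ler_pM2l// => hh.
by rewrite -normrN opprB mulrC.
Qed.

Lemma param_diffE :
  'd (set_val \o @co_inv R H S d) y = param_diff :> (E -> X).
Proof.
have [[wF _] _] := cy; have hF := slotless_rhom (rc_param_slotless d).
have [dF _] := reval_differentiable hF wF.
have [K hK] := rder_bounded (fixed_val y) (rc_param_slotless d).
apply: diff_unique.
  by move=> v; apply: (@linear_bounded_cvg _ E _ _ K) => w; exact: hK.
apply/eqaddoP => r r0.
have [r1 r10 h1] := co_cod_near.
have /nbhs_ballP[r2 /= r20 h2] := dF _ r0.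
apply/nbhs_ballP; exists (Num.min r1 r2) => /=; first by rewrite lt_min r10.
move=> w; rewrite -ball_normE /= sub0r normrN lt_min => /andP[w1 w2].
have b2 : ball (0 : X) r2 (fixed_val w) by rewrite -ball_normE /= sub0r normrN.
have := h2 _ b2 [::]; rewrite slot_prod0 mulr1.
have c1 := h1 w w1.
have -> : (set_val \o co_inv (d := d)) \o shift y - (cst ((set_val \o co_inv (d := d)) y) + param_diff)
   = fun w => set_val (co_inv (w + y)) - (set_val (co_inv y) + param_diff w) by [].
rewrite (addrC w) !co_invE// opprD addrA.
by [].
Qed.

(** The composite [param_der \o coord_der] is a bounded projection onto the range. *)
Lemma tangent_split :
  [/\ injective param_diff, closed (range param_diff) & complemented (range param_diff)].
Proof.
have sg := rc_coord_slotless d; have sF := rc_param_slotless d.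
have rangeP w : range param_diff w <-> w - param_der (coord_der w) = 0.
  split=> [[v _ <-]|/eqP]; first by rewrite coord_derK subrr.
  rewrite subr_eq0 => /eqP ->.
  by exists (fixed_proj (rc_rho d) (reval (rder (rc_coord d)) (reval (rc_param d) (fixed_val y) [::]) [:: w])).
have [K1 hK1] := rder_bounded (fixed_val y) sF.
have [K2 hK2] := rder_bounded (reval (rc_param d) (fixed_val y) [::]) sg.
have [cB cZ] := linear_subZ coord_der_linear.
have c0 : coord_der 0 = 0 by have := cB 0 0; rewrite !subrr.
have [pB _] := linear_subZ (@rder_linear _ (fixed_val y) sF).
have bound (T : X -> X) K : (forall w, `|T w| <= K * `|w|) -> forall w, `|T w| <= `|K| * `|w|.
  by move=> TK w; rewrite (le_trans (TK w))// ler_wpM2r// ler_norm.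
have {hK1} hK1 := bound _ _ hK1; have {hK2} hK2 := bound _ _ hK2.
have hK3 w : `|coord_der w| <= `|proj_bound (rc_rho d)| * (`|K2| * `|w|).
  rewrite (le_trans (bound _ _ (@proj_bounded _ _ (rc_rho d)) _))// ler_wpM2l//.
have rhoE w : rc_rho d (coord_der w) = coord_der w by exact: proj_idem.
have inR w : range param_diff (param_der (coord_der w)).
  by exists (FixedSpace (rhoE w)).
split.
- by move=> u v /(congr1 coord_der); rewrite !coord_derK; exact: fixed_inj.
- have -> : range param_diff = [set w | w - param_der (coord_der w) = 0].
    by apply/seteqP; split=> w /rangeP.
  apply: (@closed_additive_kernel _ _ (fun w => w - param_der (coord_der w))
     (1 + `|K1| * (`|proj_bound (rc_rho d)| * `|K2|))) => [u w|w].
    rewrite cB [param_der _]pB !opprB addrACA [RHS]addrACA; congr (_ + _).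
    by rewrite addrC.
  rewrite (le_trans (ler_normB _ _))// mulrDl mul1r lerD2l (le_trans (hK1 _))//.
  by rewrite -mulrA ler_wpM2l// -mulrA.
- exists [set w | coord_der w = 0]; split.
  + apply: (@closed_additive_kernel _ _ coord_der (`|proj_bound (rc_rho d)| * `|K2|)) => // w.
    by rewrite -mulrA.
  + split=> [|u w /= u0 w0|t w /= w0].
    * exact: c0.
    * by rewrite -[w]opprK cB u0 -[- w]sub0r cB w0 c0 !subrr.
    * by rewrite cZ w0 scaler0.
  + apply/seteqP; split=> w /=.
      move=> [[v _ <-]]; rewrite coord_derK => v0.
      have -> : v = 0 by exact: fixed_inj.
      exact: linear0.
    move=> ->; split; first by exists 0 => //; exact: linear0.
    exact: c0.
  + move=> w; exists (param_der (coord_der w)), (w - param_der (coord_der w)).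
    split; [exact: inR| |by rewrite addrC subrK].
    rewrite /= cB; have := coord_derK (FixedSpace (rhoE w)).
    by rewrite /param_diff /= => ->; rewrite subrr.
Qed.

End tangent.

(** The manifold is [S] with the topology induced by the norm, embedded by the
    inclusion. *)
Lemma embedded_of_rational_charts (S : set X) :
  (forall c, S c -> exists d : rational_chart S, rc_dom d c) ->
  embedded_split_submanifold S.
Proof.
move=> Scover; exists (rational_manifold Scover), (set_val : set_type S -> X); split.
- by move=> c [d ->]; exact: chart_param_smooth.
- split; [exact: set_val_continuous|exact: set_val_injective|].
  move=> U [B oB <-]; exists B => //; apply/seteqP; split=> x.
    by move=> [[m _ <-] Bm]; exists m.
  by move=> [m Bm <-]; split=> //; exists m.
- apply/seteqP; split=> x; last by move=> [m _ <-]; exact: set_valS.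
  by move=> Sx; exists (mk_point Sx) => //; rewrite set_valE.
- move=> c x [d ->] dx.
  have cy := co_map_cod dx.
  by rewrite /tangent_map /= param_diffE//; exact: tangent_split.
Qed.
End RationalManifold.

(** * The charts of the orbit *)

Section RationalSums.
Context (R : realType) (H : hilbertSpace R).
Local Notation X := (boundedOp H).
Implicit Types (e f : rexpr H) (x c : X).

Definition rsub e f : rexpr H := RAdd e (RMul (RConst (-1)) f).

Lemma reval_sub e f x s : reval (rsub e f) x s = reval e x s - reval f x s.
Proof. by rewrite /= mulN1r. Qed.

Definition rsum (I : Type) (r : seq I) (F : I -> rexpr H) : rexpr H :=
  foldr (fun i e => RAdd (F i) e) (RConst 0) r.

Lemma reval_sum (I : Type) (r : seq I) (F : I -> rexpr H) x s :
  reval (rsum r F) x s = \sum_(i <- r) reval (F i) x s.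
Proof. by elim: r => [|i r ih]; rewrite ?big_nil// big_cons /= ih. Qed.

Lemma rwd_sum (I : eqType) (r : seq I) (F : I -> rexpr H) x :
  rwd (rsum r F) x <-> (forall i, i \in r -> rwd (F i) x).
Proof.
elim: r => [|i r ih] /=; first by split.
split=> [[Fi /ih Fr] j|Fr]; first by rewrite inE => /orP[/eqP ->|/Fr].
by split; [apply: Fr; exact: mem_head|apply/ih => j jr; apply: Fr; rewrite inE jr orbT].
Qed.

Lemma slotless_sum (I : Type) (r : seq I) (F : I -> rexpr H) :
  (forall i, slotless (F i)) -> slotless (rsum r F).
Proof. by move=> Fs; elim: r => //= i r ->; rewrite Fs. Qed.

Definition rpow n : rexpr H := iter n (RMul (RVar H)) (RConst 1).

Lemma reval_pow n x s : reval (rpow n) x s = x ^+ n.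
Proof. by elim: n => //= n ->; rewrite exprS. Qed.

Definition rpoly (f : {poly R[i]}) : rexpr H :=
  rsum (index_enum 'I_(size f)) (fun i => RMul (RConst (scalar_op H f`_i)) (rpow i)).

Lemma reval_poly (f : {poly R[i]}) x s : reval (rpoly f) x s = poly_op f x.
Proof. by rewrite reval_sum; apply: eq_bigr => i _; rewrite /= reval_pow. Qed.

Lemma slotless_pow n : slotless (rpow n).
Proof. by elim: n. Qed.

Lemma slotless_poly (f : {poly R[i]}) : slotless (rpoly f).
Proof. by apply: slotless_sum => i; rewrite /= slotless_pow. Qed.

Lemma rwd_pow n x : rwd (rpow n) x.
Proof. by elim: n. Qed.

Lemma rwd_poly (f : {poly R[i]}) x : rwd (rpoly f) x.
Proof. by apply/rwd_sum => i _; split=> //; exact: rwd_pow. Qed.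

End RationalSums.

Section OrbitChart.
Context (R : realType) (H : hilbertSpace R) (m : nat) (e : 'I_m -> R[i]).
Hypotheses (e0 : forall i, e i != 0) (einj : injective e).
Local Notation X := (boundedOp H).
Implicit Types (x y c : X) (n : nat).
Variables (p : 'I_m -> X) (pf : orth_family p).
Local Notation P := (flag p).

Lemma lower_part_linear : linear (lower_part p).
Proof.
move=> r x y; rewrite /lower_part scaler_sumr -big_split /=; apply: eq_bigr => j _.
by rewrite mulrDr mulrDl scale_opr scale_opl.
Qed.

Lemma lower_part_bounded : exists K : R, forall x, `|lower_part p x| <= K * `|x|.
Proof.
exists (\sum_(j < m) `|1 - P j.+1| * `|p j|) => x.
rewrite (le_trans (ler_norm_sum _ _ _))// mulr_suml ler_sum// => j _.
rewrite (le_trans (opnormM _ _))// mulrAC ler_wpM2r// opnormM//.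
Qed.

Definition chart_rho : bounded_proj X :=
  BoundedProj (proj_fun := HB.pack (lower_part p)
     (GRing.isLinear.Build R X X _ (lower_part p) lower_part_linear))
    (lower_part_idem pf) (projT2 (cid lower_part_bounded)).

Definition frame_rexpr : rexpr H := RAdd (RConst 1) (RVar H).
Definition gram_rexpr n : rexpr H :=
  RAdd (RMul (RMul (RMul (RConst (P n)) (RAdj frame_rexpr)) frame_rexpr) (RConst (P n))) (RConst (1 - P n)).
Definition corner_rexpr n : rexpr H :=
  RAdd (RMul (RMul (RConst (P n)) frame_rexpr) (RConst (P n))) (RConst (1 - P n)).
Definition frame_proj_rexpr n : rexpr H :=
  RMul (RMul (RMul (RMul frame_rexpr (RConst (P n))) (RInv (gram_rexpr n))) (RConst (P n))) (RAdj frame_rexpr).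
(** The value is [spectral_sum e] of the family with flag [frame_proj p x]. *)
Definition param_rexpr : rexpr H := rsum (index_enum 'I_m)
  (fun i => RMul (RConst (scalar_op H (e i))) (rsub (frame_proj_rexpr i.+1) (frame_proj_rexpr i))).
(** The sum of the inverses whose existence is required of [x]: being defined is an
    open condition on an expression. *)
Definition param_dom_rexpr : rexpr H := rsum (iota 0 m.+1) (fun n => RAdd (RInv (gram_rexpr n)) (RInv (corner_rexpr n))).

Lemma reval_param x : reval param_rexpr x [::] = spectral_sum e (frame_family p x).
Proof.
rewrite reval_sum; apply: eq_bigr => i _; rewrite [LHS]/= mulN1r.
by congr (_ * _).
Qed.

Lemma rwd_param_dom x : rwd param_dom_rexpr x <-> forall n, (n <= m)%N ->
  op_unit (frame_gram p x n) /\ op_unit (frame_corner p x n).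
Proof.
rewrite /param_dom_rexpr; split=> [/rwd_sum h n nm|h].
  have : n \in iota 0 m.+1 by rewrite mem_iota.
  by move=> /h[[_ ?] [_ ?]].
apply/rwd_sum => n; rewrite mem_iota add0n ltnS => /andP[_ nm].
by have [? ?] := h n nm.
Qed.

Definition eigenproj_rexpr i : rexpr H := rpoly H (lagrange e i).
Definition flag_rexpr n : rexpr H := rsum [seq i : 'I_m <- index_enum 'I_m | (i < n)%N] eigenproj_rexpr.
Definition shift_rexpr n : rexpr H := RAdd (rsub (RConst 1) (flag_rexpr n)) (RConst (P n)).
Definition coshift_rexpr n : rexpr H := rsub (RAdd (RConst 1) (flag_rexpr n)) (RConst (P n)).
Definition coord_rexpr : rexpr H := rsum (index_enum 'I_m)
  (fun i => RMul (rsub (RInv (shift_rexpr i.+1)) (RConst 1)) (RConst (p i))).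
Definition intertwiner_rexpr : rexpr H :=
  RAdd (rsum (index_enum 'I_m) (fun i => RMul (eigenproj_rexpr i) (RConst (p i))))
    (RMul (rsub (RConst 1) (rsum (index_enum 'I_m) eigenproj_rexpr)) (RConst (1 - \sum_i p i))).
Definition shifts_rexpr : rexpr H := rsum (iota 0 m.+1) (fun n => RAdd (RInv (shift_rexpr n)) (RInv (coshift_rexpr n))).
Definition coord_dom_rexpr : rexpr H := RAdd shifts_rexpr (RInv intertwiner_rexpr).
Definition defect_rexpr : rexpr H := rsub (RConst 1) (RMul (RAdj intertwiner_rexpr) intertwiner_rexpr).

Local Notation Lf c := (fun i => poly_op (lagrange e i) c).

Lemma reval_flag n c : reval (flag_rexpr n) c [::] = flag (Lf c) n.
Proof. by rewrite reval_sum big_filter; apply: eq_bigr => i _; exact: reval_poly. Qed.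

Lemma reval_proj_shift n c : reval (shift_rexpr n) c [::] = proj_shift p (flag (Lf c) n) n.
Proof. by rewrite [LHS]/= mulN1r reval_flag. Qed.

Lemma reval_proj_coshift n c : reval (coshift_rexpr n) c [::] = proj_coshift p (flag (Lf c) n) n.
Proof. by rewrite [LHS]/= mulN1r reval_flag. Qed.

Lemma reval_coord c : reval coord_rexpr c [::] = frame_of p (flag (Lf c)).
Proof.
rewrite reval_sum; apply: eq_bigr => i _.
by rewrite -reval_proj_shift -[LHS]/((op_inv (reval (shift_rexpr i.+1) c [::]) + -1 * 1) * p i) mulr1.
Qed.

Lemma reval_intertwiner c : reval intertwiner_rexpr c [::] = intertwiner (Lf c) p.
Proof.
rewrite [LHS]/= !reval_sum mulN1r; congr (_ + (1 - _) * _).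
  by apply: eq_bigr => i _; rewrite /= reval_poly.
by apply: eq_bigr => i _; rewrite /= reval_poly.
Qed.

Lemma reval_defect c : reval defect_rexpr c [::] = 1 - adjoint (intertwiner (Lf c) p) * intertwiner (Lf c) p.
Proof. by rewrite -reval_intertwiner; exact: reval_sub. Qed.

Lemma rwd_flag n c : rwd (flag_rexpr n) c.
Proof. by apply/rwd_sum => i _; exact: rwd_poly. Qed.

Lemma rwd_intertwiner c : rwd intertwiner_rexpr c.
Proof.
split; first by apply/rwd_sum => i _; split=> //; exact: rwd_poly.
by split=> //; split=> //; split=> //; apply/rwd_sum => i _; exact: rwd_poly.
Qed.

Lemma rwd_coord_dom c : rwd coord_dom_rexpr c <-> (forall n, (n <= m)%N ->
    op_unit (proj_shift p (flag (Lf c) n) n) /\ op_unit (proj_coshift p (flag (Lf c) n) n))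
  /\ op_unit (intertwiner (Lf c) p).
Proof.
have -> : rwd coord_dom_rexpr c = (rwd shifts_rexpr c /\ rwd (RInv intertwiner_rexpr) c) by [].
rewrite -reval_intertwiner; split=> [[hTC [_ uS]]|[h uS]].
  move/rwd_sum: hTC => h; split=> // n nm; rewrite -reval_proj_shift -reval_proj_coshift.
  have : n \in iota 0 m.+1 by rewrite mem_iota.
  by move=> /h[[_ ?] [_ ?]].
split; last by split=> //; exact: rwd_intertwiner.
apply/rwd_sum => n; rewrite mem_iota add0n ltnS => /andP[_ nm].
have [uT uC] := h n nm; rewrite -reval_proj_shift in uT; rewrite -reval_proj_coshift in uC.
by split; split=> //; do ?split=> //; exact: rwd_flag.
Qed.

(** The conditions of [frame_ofK] and [frame_family_of_flag] on the frame. *)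
Definition chart_V : set X := [set x | rwd param_dom_rexpr x /\ setT (reval param_dom_rexpr x [::])].
(** The conditions on the flag, together with those of [conj_unitary], which ensure
    that a sum of [e_i q_i] in this set belongs to the orbit. *)
Definition chart_W : set X := [set c | rwd coord_dom_rexpr c /\ setT (reval coord_dom_rexpr c [::])] `&`
  [set c | rwd defect_rexpr c /\ ball (0 : X) (4^-1 : R) (reval defect_rexpr c [::])].

Lemma slotless_flag n : slotless (flag_rexpr n).
Proof. by apply: slotless_sum => i; exact: slotless_poly. Qed.
Lemma slotless_param : slotless param_rexpr. Proof. by apply: slotless_sum. Qed.
Lemma slotless_param_dom : slotless param_dom_rexpr. Proof. by apply: slotless_sum. Qed.
Lemma slotless_coord : slotless coord_rexpr.
Proof. by apply: slotless_sum => i; rewrite /= slotless_flag. Qed.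
Lemma slotless_intertwiner : slotless intertwiner_rexpr.
Proof.
rewrite /= !slotless_sum //= => i; first exact: slotless_poly.
by rewrite slotless_poly.
Qed.
Lemma slotless_coord_dom : slotless coord_dom_rexpr.
Proof.
rewrite -[slotless _]/(slotless shifts_rexpr && slotless intertwiner_rexpr) slotless_intertwiner andbT.
by apply: slotless_sum => n; rewrite /= slotless_flag.
Qed.
Lemma slotless_defect : slotless defect_rexpr.
Proof. by rewrite -[slotless _]/(slotless intertwiner_rexpr && slotless intertwiner_rexpr) slotless_intertwiner. Qed.

Lemma chart_V_open : open chart_V.
Proof. by apply: open_rwd_preimage; [exact/slotless_rhom/slotless_param_dom|exact: openT]. Qed.

Lemma chart_W_open : open chart_W.
Proof.
apply: openI; apply: open_rwd_preimage.
- exact/slotless_rhom/slotless_coord_dom.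
- exact: openT.
- exact/slotless_rhom/slotless_defect.
- exact: ball_open.
Qed.

Lemma rwd_param x : chart_V x -> rwd param_rexpr x.
Proof.
move=> [/rwd_param_dom h _]; apply/rwd_sum => i _.
have [u1 _] := h i.+1 (ltn_ord i); have [u2 _] := h i (ltnW (ltn_ord i)).
by do !split.
Qed.

Lemma rwd_coord c : chart_W c -> rwd coord_rexpr c.
Proof.
move=> [[/rwd_coord_dom[h _] _] _]; apply/rwd_sum => i _.
have [u1 _] := h i.+1 (ltn_ord i); rewrite -reval_proj_shift in u1.
by do !split => //; exact: rwd_flag.
Qed.

Lemma chart_W_intertwiner c : chart_W c -> op_unit (intertwiner (Lf c) p) /\
  `|1 - adjoint (intertwiner (Lf c) p) * intertwiner (Lf c) p| <= 4^-1.
Proof.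
move=> [[/rwd_coord_dom[_ uS] _] [_ bD]]; split=> //.
by move: bD; rewrite reval_defect -ball_normE /= sub0r normrN => /ltW.
Qed.

Lemma chart_param_family x : lower_part p x = x -> chart_V x ->
  orth_family (frame_family p x) /\
  Lf (reval param_rexpr x [::]) = frame_family p x.
Proof.
move=> xl [/rwd_param_dom h _]; have qf : orth_family (frame_family p x).
  by apply: frame_family_orth => // n /h[].
by split=> //; apply/funext => i; rewrite reval_param lagrange_spectral_sum.
Qed.

Lemma chart_coordK x : lower_part p x = x -> chart_V x -> chart_W (reval param_rexpr x [::]) ->
  reval coord_rexpr (reval param_rexpr x [::]) [::] = x.
Proof.
move=> xl Vx [[/rwd_coord_dom[h _] _] _]; have [_ LE] := chart_param_family xl Vx.
have [/rwd_param_dom hx _] := Vx.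
have Gu n : (n <= m)%N -> op_unit (frame_gram p x n) by move=> /hx[].
rewrite reval_coord LE in h *; rewrite -[RHS](frame_ofK pf Gu xl).
  by rewrite /frame_of; apply: eq_bigr => i _; rewrite flag_frame_family.
by move=> n nm; rewrite -flag_frame_family//; have [] := h n nm.
Qed.

Lemma chart_paramK c q : orth_family q -> c = spectral_sum e q -> chart_W c ->
  lower_part p (reval coord_rexpr c [::]) = reval coord_rexpr c [::] /\
  (chart_V (reval coord_rexpr c [::]) -> reval param_rexpr (reval coord_rexpr c [::]) [::] = c).
Proof.
move=> qf cE [[/rwd_coord_dom[h _] _] _].
have LE : Lf c = q by apply/funext => i; rewrite cE lagrange_spectral_sum.
rewrite LE in h; have Tu n : (n <= m)%N -> op_unit (proj_shift p (flag q n) n) by move=> /h[].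
have Cu n : (n <= m)%N -> op_unit (proj_coshift p (flag q n) n) by move=> /h[].
rewrite reval_coord LE; split; first exact: frame_of_lower.
move=> [/rwd_param_dom hg _]; rewrite reval_param cE; apply: eq_bigr => i _.
by rewrite frame_family_of_flag// => n /hg[].
Qed.

Lemma chart_W_center : chart_W (spectral_sum e p) /\ reval coord_rexpr (spectral_sum e p) [::] = 0.
Proof.
have LE : Lf (spectral_sum e p) = p by apply/funext => i; rewrite lagrange_spectral_sum.
have T1 n : proj_shift p (flag p n) n = 1 by rewrite /proj_shift subrK.
have S1 : intertwiner p p = 1.
  rewrite /intertwiner; have [_ pp] := pf.
  rewrite (eq_bigr p); last by move=> i _; rewrite pp eqxx.
  have idem : (\sum_i p i) * (\sum_i p i) = \sum_i p i.
    rewrite [X in _ * X = _](eq_bigr p)// mulr_sumr; apply: eq_bigr => i _.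
    exact: orth_family_suml.
  by rewrite mulrBl mul1r mulrBr mulr1 idem subrr subr0 addrC subrK.
split; last first.
  rewrite reval_coord LE /frame_of big1// => i _.
  by rewrite T1 op_inv1 subrr mul0r.
split; split=> //.
- apply/rwd_coord_dom; rewrite LE S1; split; last exact: op_unit1.
  move=> n nm; rewrite T1 /proj_coshift addrK; split; exact: op_unit1.
- by split=> //; split=> //; split; exact: rwd_intertwiner.
- rewrite reval_defect LE S1 adjoint1 mulr1 subrr; apply: ballxx; by rewrite invr_gt0.
Qed.

Lemma chart_V0 : chart_V 0.
Proof.
split=> //; apply/rwd_param_dom => n nm; rewrite /frame_gram /frame_corner addr0 adjoint1 !mulr1.
by rewrite (flag_idem pf) addrC subrK; split; exact: op_unit1.
Qed.

End OrbitChart.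

Section OrbitManifold.
Context (R : realType) (H : hilbertSpace R) (m : nat) (e : 'I_m -> R[i]).
Hypotheses (e0 : forall i, e i != 0) (einj : injective e).
Local Notation X := (boundedOp H).
Implicit Types (a b c x u v : X).

Lemma orbit_spectral_sum a (p : 'I_m -> X) b : orth_family p -> a = spectral_sum e p ->
  groupoid_orbit a b -> exists2 q, orth_family q & b = spectral_sum e q.
Proof.
move=> pf aE [v Vv <-]; exists (fun i => v * p i * adjoint v).
  apply: (orth_family_conj pf Vv) => i.
  have pE : p i = scalar_op H (e i)^-1 * (a * p i).
    rewrite aE spectral_sum_mulr// mulrA -scalar_opM mulVf//.
    by rewrite -[RHS]/(1 * p i) mul1r.
  by rewrite {1}pE mulrA -scalar_opC -mulrA (mulrA _ a) range_proj_mul -pE.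
by rewrite /orbit_map aE spectral_sum_conj.
Qed.

Lemma orbit_conj a b u : adjoint u * u = 1 -> groupoid_orbit a b ->
  groupoid_orbit a (u * b * adjoint u).
Proof.
move=> uu [v Vv <-]; exists (u * v).
  by rewrite /isometries_on_range /= adjointM -mulrA (mulrA _ u) uu mul1r.
by rewrite /orbit_map adjointM !mulrA.
Qed.

(** The chart is centred at [b]. The parametrization takes values in the orbit
    because its values are unitarily equivalent to [b]. *)
Lemma orbit_chart a (p : 'I_m -> X) b : orth_family p -> a = spectral_sum e p ->
  groupoid_orbit a b -> exists d : rational_chart (groupoid_orbit a), rc_dom d b.
Proof.
move=> pf aE ab; have [q qf bE] := orbit_spectral_sum pf aE ab.
have orbW c : chart_W e q c -> (exists2 q', orth_family q' & c = spectral_sum e q') ->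
    groupoid_orbit a c.
  move=> Wc [q' q'f cE].
  have LE : (fun i => poly_op (lagrange e i) c) = q'.
    by apply/funext => i; rewrite cE lagrange_spectral_sum.
  have := chart_W_intertwiner Wc; rewrite LE => -[uS Sx].
  have [u [uu uu' uq]] := conj_unitary q'f qf uS Sx.
  suff -> : c = u * b * adjoint u by exact: orbit_conj.
  rewrite bE spectral_sum_conj cE; apply: eq_bigr => i _; congr (_ * _).
  by rewrite uq -mulrA uu' mulr1.
have FP x : chart_rho qf x = x -> chart_V q x -> chart_W e q (reval (param_rexpr e q) x [::]) ->
    groupoid_orbit a (reval (param_rexpr e q) x [::]) /\ reval (coord_rexpr e q) (reval (param_rexpr e q) x [::]) [::] = x.
  move=> xl Vx Wx; split; last exact: chart_coordK.
  apply: orbW => //; exists (frame_family q x); last exact: reval_param.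
  by have [] := chart_param_family e0 einj qf xl Vx.
have gP c : groupoid_orbit a c -> chart_W e q c -> chart_V q (reval (coord_rexpr e q) c [::]) ->
    chart_rho qf (reval (coord_rexpr e q) c [::]) = reval (coord_rexpr e q) c [::] /\
    reval (param_rexpr e q) (reval (coord_rexpr e q) c [::]) [::] = c.
  move=> ac Wc Vg; have [q' q'f cE] := orbit_spectral_sum pf aE ac.
  by have [h1 h2] := chart_paramK e0 einj qf q'f cE Wc; split=> //; exact: h2.
exists (RationalChart (@chart_V_open _ _ _ q) (@chart_W_open _ _ _ e q)
  (@slotless_param _ _ _ e q) (@slotless_coord _ _ _ e q) (@rwd_param _ _ _ e q) (@rwd_coord _ _ _ e q) ab FP gP).
have [Wb gb] := chart_W_center e0 einj qf; rewrite -bE in Wb gb.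
split=> //; split; first exact: rwd_coord.
by rewrite gb; exact: chart_V0.
Qed.

End OrbitManifold.

Lemma finite_spectrum_manifold (R : realType) (H : hilbertSpace R) (a : boundedOp H) :
  normal_op a -> finite_set (spectrum a) -> embedded_split_submanifold (groupoid_orbit a).
Proof.
move=> na /finite_seqP[s sE].
(* The nonzero points of the spectrum, without repetition. *)
pose t := [seq w <- undup s | w != 0]; pose e (i : 'I_(size t)) := t`_i.
have e0 i : e i != 0.
  by have := mem_nth 0 (ltn_ord i); rewrite mem_filter => /andP[].
have einj : injective e.
  move=> i j /eqP; rewrite nth_uniq// ?filter_uniq ?undup_uniq// => /eqP ij.
  exact: val_inj.
have spa w : spectrum a w -> w = 0 \/ exists i, w = e i.
  have [->|w0] := eqVneq w 0; first by left.
  rewrite sE /= => ws; right.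
  have wt : w \in t by rewrite mem_filter w0 mem_undup.
  have it : (index w t < size t)%N by rewrite index_mem.
  by exists (Ordinal it); rewrite /e nth_index.
have [pf aE] := finite_spectrum_decomposition e0 einj na spa.
apply: embedded_of_rational_charts => b ab.
exact: (orbit_chart e0 einj pf aE ab).
Qed.

Theorem theorem5p22 (R : realType) (H : hilbertSpace R)
  (Hseparable : separable_space H) (Hinfinite : infinite_dimensional H)
  (a : boundedOp H) (a_normal : normal_op a)
  (orbit_closed : closed (groupoid_orbit a))
  (topologies_eq : orbit_quotient_topology a = orbit_norm_topology a) :
  finite_set (spectrum a) /\
  (closed (groupoid_orbit a) /\ embedded_split_submanifold (groupoid_orbit a)).
Proof.
have fs := spectrum_finite a_normal topologies_eq.
by split=> //; split=> //; exact: finite_spectrum_manifold.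
Qed.
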